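(* Let $0<\alpha_1,\alpha_2,\dots,\alpha_n<2$ with $\prod_{j=1}^n\alpha_j<2$, let $\mu$ be any complex number, let $\varepsilon>0$, and let $\eta$ be a real number satisfying $$\frac{\pi}{2}\prod_{j=1}^n\alpha_j<\eta\le\min\Bigl(\pi,\pi\prod_{j=1}^n\alpha_j\Bigr).$$ For $j=1,\dots,n$ put $\beta_j=\frac{1}{\alpha_j}\prod_{i=1}^n\alpha_i$, $\varepsilon_{\alpha_j}=\varepsilon^{1/\beta_j}$ and $\eta_{\alpha_j}=\frac{\eta}{\beta_j}$. If $z_j\in\Omega^{(-)}(\varepsilon_{\alpha_j};\eta_{\alpha_j})$ for $j=1,\dots,n$, then $$E_{\alpha_1,\dots,\alpha_n}(z_1,\dots,z_n;\mu)=\frac{1}{2\pi i}\,\frac{1}{\prod_{j=1}^n\alpha_j}\int_{\omega(\varepsilon;\eta)}\frac{\exp\!\left(s^{1/\prod_{j=1}^n\alpha_j}\right)\,s^{\frac{\sum_{j=1}^n\alpha_j+1-\mu}{\prod_{j=1}^n\alpha_j}-1}}{\prod_{j=1}^n\left(s^{1/\beta_j}-z_j\right)}\,ds.$$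
   Context: The multivariate Mittag-Leffler function is $$E_{\alpha_1,\dots,\alpha_n}(z_1,\dots,z_n;\mu)=\sum_{k_1,\dots,k_n=0}^{\infty}\frac{\prod_{j=1}^n z_j^{k_j}}{\Gamma\!\left(\mu+\sum_{j=1}^n\alpha_jk_j\right)},\qquad \alpha_j>0,\ \mu,z_1,\dots,z_n\in\mathbb{C},$$ with $1/\Gamma$ understood as the entire reciprocal Gamma function (zero at the poles of $\Gamma$). Hankel contour: for $\varepsilon>0$ and $\eta>0$, $\omega(\varepsilon;\eta)$ is the path, oriented in the direction of non-decreasing $\arg s$, consisting of the two rays $S_{\pm\eta}=\{\arg s=\pm\eta,\ |s|\ge\varepsilon\}$ and the circular arc $\{|s|=\varepsilon,\ -\eta\le\arg s\le\eta\}$. That is, it comes in from infinity along $\arg s=-\eta$, follows the arc counterclockwise, and goes out to infinity along $\arg s=\eta$. If $\eta=\pi$ it is the keyhole path around the negative real axis, i.e. the ray $(-\infty,-\varepsilon]$ traversed in both directions (with $\arg s=-\pi$ incoming and $\arg s=\pi$ outgoing) together with the circle $|s|=\varepsilon$. For $0<\eta<\pi$ the contour divides the complex plane into two unbounded regions, $\Omega^{(-)}(\varepsilon;\eta)$ to the left of the contour and $\Omega^{(+)}(\varepsilon;\eta)$ to the right. Explicitly, with $\arg s\in(-\pi,\pi]$, $\Omega^{(-)}(\varepsilon;\eta)=\{|s|<\varepsilon\}\cup\{s\neq0:\ |\arg s|>\eta\}$ and $\Omega^{(+)}(\varepsilon;\eta)=\{|s|>\varepsilon,\ |\arg s|<\eta\}$;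 these formulas are used as the definition also when $\eta\ge\pi$. In contour integrals, powers are $s^a=\exp(a(\ln|s|+i\arg s))$ with $\arg s\in[-\eta,\eta]$ the argument along the contour. *)

(* Defs.v *)
From Stdlib Require Import Reals ZArith Lra Lia.
From mathcomp Require Import all_boot.
From Coquelicot Require Import Coquelicot.

Set Implicit Arguments.
Unset Strict Implicit.
Unset Printing Implicit Defensive.

Open Scope R_scope.

Definition Cexp (z : C) : C :=
  (exp (Re z) * cos (Im z), exp (Re z) * sin (Im z)).

(* Principal argument in (-PI, PI]; the value at 0 is irrelevant. *)
Definition Carg (z : C) : R :=
  if Rle_dec 0 (Im z) then acos (Re z / Cmod z) else - acos (Re z / Cmod z).

(* A point of the Riemann surface of the logarithm is given by its polar
   coordinates (r, th) with r > 0 and th real, not reduced modulo 2 PI. *)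
Definition polar (r th : R) : C := (r * cos th, r * sin th).

Definition polar_pow (r th : R) (a : C) : C := Cexp (a * (ln r, th))%C.

Lemma Carg_spec (z : C) (hz : z <> RtoC 0) :
  - PI < Carg z <= PI /\ z = polar (Cmod z) (Carg z).
Proof.
have m0 : 0 < Cmod z by apply Cmod_gt_0.
have m2 : Cmod z ^ 2 = Re z ^ 2 + Im z ^ 2 by apply Cmod2_alt.
set m := Cmod z in m0 m2 *.
have q0 : (Re z / m) ^ 2 + (Im z / m) ^ 2 = 1.
  have -> : (Re z / m) ^ 2 + (Im z / m) ^ 2 = (Re z ^ 2 + Im z ^ 2) / m ^ 2.
    by field; lra.
  by rewrite -m2; field; lra.
have q2 : -1 <= Re z / m <= 1 by nra.
have sA : sin (acos (Re z / m)) = Rabs (Im z) / m.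
  rewrite sin_acos // /Rsqr.
  have -> : 1 - Re z / m * (Re z / m) = (Rabs (Im z) / m) ^ 2.
    rewrite /Rdiv (Rpow_mult_distr (Rabs _)) pow2_abs -Rpow_mult_distr; lra.
  rewrite sqrt_pow2 //; apply: Rdiv_le_0_compat => //; exact: Rabs_pos.
have bA := acos_bound (Re z / m); have piP := PI_RGT_0.
rewrite /Carg /polar -/m; case: Rle_dec => hI /=.
- split; first by case: bA => *; split; [apply: Rlt_le_trans; [|eassumption]; lra|].
  by rewrite cos_acos // sA Rabs_pos_eq //; apply injective_projections; rewrite /= /Re /Im; field; lra.
- have hA : acos (Re z / m) <> PI.
    move=> e; move: sA; rewrite e sin_PI Rabs_left; last lra.
    have : 0 < - Im z / m by apply: Rdiv_lt_0_compat; lra.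
    lra.
  split; first by case: bA => b1 [b2|/hA []]; split; lra.
  by rewrite cos_neg sin_neg cos_acos // sA Rabs_left; [apply injective_projections; rewrite /= /Re /Im; field; lra|lra].
Qed.

(* Euler's integral, meaningful for 0 < Re z. *)
Definition Gamma_Euler (z : C) : C :=
  @RInt_gen C_R_CompleteNormedModule
    (fun t => polar_pow t 0 (z - 1)%C * exp (- t))%C
    (at_right 0) (Rbar_locally p_infty).

(* The entire function 1 / Gamma: the Euler integral is extended by
   Gamma (z + m) = z (z + 1) .. (z + m - 1) Gamma z, with m any natural number
   such that 0 < Re (z + m).  The product contains the factor 0 when
   z = 0, -1, -2, .. *)
Definition rGamma (z : C) : C :=
  let m := Z.to_nat (up (- Re z)) in
  ((\big[Cmult/RtoC 1]_(k < m) (z + INR k)) / Gamma_Euler (z + INR m))%C.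

(* Unconditional summation of a family, i.e. convergence along the finite
   subsets of the index set; for complex terms it is equivalent to absolute
   convergence. *)
Definition is_unordered_sum (I : eqType) (a : I -> C) (l : C) : Prop :=
  forall e : R, 0 < e ->
  exists s0 : seq I, forall s : seq I, uniq s -> {subset s0 <= s} ->
    Cmod (\big[Cplus/RtoC 0]_(i <- s) a i - l)%C < e.

Definition unordered_sum (I : eqType) (a : I -> C) : C :=
  @iota C_R_CompleteNormedModule (is_unordered_sum a).

Definition weight (n : nat) (alpha : 'I_n -> R) (k : {ffun 'I_n -> nat}) : R :=
  \big[Rplus/0]_(j < n) (alpha j * INR (k j)).

Definition mittag_leffler (n : nat) (alpha : 'I_n -> R) (z : 'I_n -> C)
    (mu : C) : C :=
  unordered_sum (fun k : {ffun 'I_n -> nat} =>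
    (\big[Cmult/RtoC 1]_(j < n) Cpow (z j) (k j)
     * rGamma (mu + RtoC (weight alpha k)))%C).

(* Integrals along omega(eps; eta).  The integrand f r th is a function of the
   polar coordinates of s, so that the two rays remain distinct at eta = PI. *)
Definition ray_integrand (f : R -> R -> C) (th : R) (r : R) : C :=
  (f r th * polar 1 th)%C.

Definition arc_integrand (f : R -> R -> C) (eps : R) (th : R) : C :=
  (f eps th * (Ci * polar eps th))%C.

Definition ex_hankel_integral (eps eta : R) (f : R -> R -> C) : Prop :=
  [/\ @ex_RInt_gen C_R_NormedModule (ray_integrand f (- eta))
        (at_point eps) (Rbar_locally p_infty),
      @ex_RInt C_R_NormedModule (arc_integrand f eps) (- eta) eta
    & @ex_RInt_gen C_R_NormedModule (ray_integrand f eta)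
        (at_point eps) (Rbar_locally p_infty)].

Definition hankel_integral (eps eta : R) (f : R -> R -> C) : C :=
  (- @RInt_gen C_R_CompleteNormedModule (ray_integrand f (- eta))
       (at_point eps) (Rbar_locally p_infty)
   + @RInt C_R_CompleteNormedModule (arc_integrand f eps) (- eta) eta
   + @RInt_gen C_R_CompleteNormedModule (ray_integrand f eta)
       (at_point eps) (Rbar_locally p_infty))%C.

Definition Omega_minus (eps eta : R) (s : C) : Prop :=
  Cmod s < eps \/ (s <> RtoC 0 /\ eta < Rabs (Carg s)).

Definition prod_alpha (n : nat) (alpha : 'I_n -> R) : R :=
  \big[Rmult/1]_(j < n) alpha j.

Definition sum_alpha (n : nat) (alpha : 'I_n -> R) : R :=
  \big[Rplus/0]_(j < n) alpha j.

Definition beta (n : nat) (alpha : 'I_n -> R) (j : 'I_n) : R :=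
  / alpha j * prod_alpha alpha.

Definition ml_integrand (n : nat) (alpha : 'I_n -> R) (mu : C)
    (z : 'I_n -> C) (r th : R) : C :=
  (Cexp (polar_pow r th (1 / prod_alpha alpha))
   * polar_pow r th
       ((RtoC (sum_alpha alpha) + 1 - mu) / prod_alpha alpha - 1)
   / \big[Cmult/RtoC 1]_(j < n)
       (polar_pow r th (1 / beta alpha j) - z j))%C.

(* Main.v *)
Require Import Defs.
From HB Require Import structures.
From Stdlib Require Import Reals Lra Lia.
From mathcomp Require Import all_boot.
From Coquelicot Require Import Coquelicot.

(** The substitution [s = e^(P v)], with [P] the product of the [alpha j], turns
    the Hankel contour into the boundary of a half-strip of half-width
    [th = eta / P], and the integrand into
    [exp (e^v) e^((sum alpha + 1 - mu) v) / prod_j (e^(alpha_j v) - z_j)].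
    This is a single-valued function of [v], so that the branches of the powers
    disappear from the problem, and the assumption on [eta] gives
    [PI / 2 < th <= PI]: on the two rays [cos th < 0], and [exp (e^v)] decays
    there as a double exponential. All the analysis is done in this coordinate.

    The assumption on [z] says that no pole lies in the closed half-strip. By
    Cauchy's theorem the contour may therefore be pushed to the right
    ([ml_integral]), until [|z_j e^(- alpha_j v)| <= 1/2] on it for all [j].
    There the integrand expands in a multiple geometric series, which converges
    uniformly and unconditionally ([geometric_uniform]) against the integrable
    weight [exp (e^v)]. Integration term by term ([ml_integral_right]) leaves,
    for every multi-index [k], the integral of [exp (e^v) e^((1 - nu) v)] with
    [nu = mu + sum_j alpha_j k_j], so that the theorem is reduced to Hankel's
    formula: this integral is [2 PI i / Gamma nu] ([hankel_limit_rGamma]).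

    Hankel's formula is proved without the reflection formula. Both sides obey
    the recursion [1 / Gamma nu = nu / Gamma (nu + 1)], by an integration by
    parts ([hankel_limit_rec]), and this reduces it to [0 < Re nu]. In that
    half-plane, scaling the contour by [u] shows that [u^(nu - 1)] times the
    Hankel integral is the integral of [e^(u s) s^(- nu)]. Multiply by [e^(- u)],
    integrate over [u > 0], and interchange the integrals
    ([strip_Fubini_limit]): the product of the Euler and the Hankel integrals is
    the integral of [s^(- nu) / (1 - s)] over a contour with [Re s < 1]. Pushing
    that contour to infinity on the right crosses the only pole, at [s = 1], and
    this gives [2 PI i] ([hankel_kernel_limit], [hankel_limit_Gamma]).

    All the contours consist of horizontal and vertical segments, so that
    Cauchy's theorem on rectangles is enough, and this is Fubini's theorem for
    the derivative of the integrand ([Cauchy_rect]). The residue at a simple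
    pole follows by shrinking a square around it ([residue_square]). *)

Set Implicit Arguments.
Unset Strict Implicit.
Unset Printing Implicit Defensive.

Open Scope R_scope.

(** * Complex-valued functions of real variables *)

Lemma continuous_Cpair (T : UniformSpace) (f g : T -> R) (x : T) :
  continuous f x -> continuous g x ->
  @continuous T C_UniformSpace (fun t => (f t, g t)) x.
Proof.
move=> hf hg.
apply: (@continuous_comp_2 T R_UniformSpace R_UniformSpace C_UniformSpace
  f g (fun a b => (a, b))) => //.
apply: (continuous_ext (fun p => p)); first by case.
exact: continuous_id.
Qed.

Lemma continuous_Re (T : UniformSpace) (f : T -> C) (x : T) :
  @continuous T C_UniformSpace f x -> continuous (fun t => fst (f t)) x.
Proof.
move=> hf; apply: (continuous_comp f (fun p : C => fst p)) => //.
by case: (f x) => a b; exact: continuous_fst.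
Qed.

Lemma continuous_Im (T : UniformSpace) (f : T -> C) (x : T) :
  @continuous T C_UniformSpace f x -> continuous (fun t => snd (f t)) x.
Proof.
move=> hf; apply: (continuous_comp f (fun p : C => snd p)) => //.
by case: (f x) => a b; exact: continuous_snd.
Qed.

Lemma continuous_Cplus (T : UniformSpace) (f g : T -> C) (x : T) :
  @continuous T C_UniformSpace f x -> @continuous T C_UniformSpace g x ->
  @continuous T C_UniformSpace (fun t => f t + g t)%C x.
Proof.
move=> hf hg; apply: continuous_Cpair; apply: (continuous_plus (V := R_NormedModule)).
- exact: continuous_Re.
- exact: continuous_Re.
- exact: continuous_Im.
- exact: continuous_Im.
Qed.

Lemma continuous_Copp (T : UniformSpace) (f : T -> C) (x : T) :
  @continuous T C_UniformSpace f x ->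
  @continuous T C_UniformSpace (fun t => - f t)%C x.
Proof.
move=> hf; apply: continuous_Cpair; apply: (continuous_opp (V := R_NormedModule)).
- exact: continuous_Re.
- exact: continuous_Im.
Qed.

Lemma continuous_Cminus (T : UniformSpace) (f g : T -> C) (x : T) :
  @continuous T C_UniformSpace f x -> @continuous T C_UniformSpace g x ->
  @continuous T C_UniformSpace (fun t => f t - g t)%C x.
Proof. by move=> hf hg; apply: continuous_Cplus => //; exact: continuous_Copp. Qed.

Lemma continuous_Cmult (T : UniformSpace) (f g : T -> C) (x : T) :
  @continuous T C_UniformSpace f x -> @continuous T C_UniformSpace g x ->
  @continuous T C_UniformSpace (fun t => f t * g t)%C x.
Proof.
move=> hf hg; have [f1 f2] := (continuous_Re hf, continuous_Im hf).
have [g1 g2] := (continuous_Re hg, continuous_Im hg).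
apply: continuous_Cpair.
- apply: (continuous_minus (V := R_NormedModule)); exact: (continuous_mult (K := R_AbsRing)).
- apply: (continuous_plus (V := R_NormedModule)); exact: (continuous_mult (K := R_AbsRing)).
Qed.

Lemma Csqr_pos (z : C) : z <> 0 -> 0 < z.1 ^ 2 + z.2 ^ 2.
Proof.
move=> hz; have m0 := Cmod_gt_0 z; have {m0}[m0 _] := m0.
have := Cmod2_alt z; rewrite /Re /Im => <-.
by apply: pow_lt; exact: m0.
Qed.

Lemma continuous_Cinv (T : UniformSpace) (f : T -> C) (x : T) :
  @continuous T C_UniformSpace f x -> f x <> 0 ->
  @continuous T C_UniformSpace (fun t => / f t)%C x.
Proof.
move=> hf nz; have [f1 f2] := (continuous_Re hf, continuous_Im hf).
have hq : continuous (fun t => / ((f t).1 ^ 2 + (f t).2 ^ 2)) x.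
  apply: (continuous_comp _ Rinv).
    apply: (continuous_plus (V := R_NormedModule));
    apply: (continuous_mult (K := R_AbsRing)) => //;
    apply: (continuous_mult (K := R_AbsRing)) => //; exact: continuous_const.
  apply: continuous_Rinv; have := Csqr_pos nz; lra.
apply: continuous_Cpair.
- exact: (continuous_mult (K := R_AbsRing)).
- apply: (continuous_mult (K := R_AbsRing)) => //; exact: (continuous_opp (V := R_NormedModule)).
Qed.

Lemma continuous_Cexp (T : UniformSpace) (f : T -> C) (x : T) :
  @continuous T C_UniformSpace f x ->
  @continuous T C_UniformSpace (fun t => Cexp (f t)) x.
Proof.
move=> hf; have [f1 f2] := (continuous_Re hf, continuous_Im hf).
have e : continuous (fun t => exp (f t).1) x.
  by apply: (continuous_comp _ exp) => //; exact: continuous_exp.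
apply: continuous_Cpair; apply: (continuous_mult (K := R_AbsRing)) => //.
- by apply: (continuous_comp _ cos) => //; exact: continuous_cos.
- by apply: (continuous_comp _ sin) => //; exact: continuous_sin.
Qed.

Notation is_Cderive := (@is_derive R_AbsRing C_R_NormedModule).

Lemma is_Cderive_pair (f g : R -> R) (x a b : R) :
  is_derive f x a -> is_derive g x b ->
  is_Cderive (fun t => (f t, g t)) x (a, b).
Proof.
move=> hf hg.
have hp : is_Cderive (fun t => plus (scal (f t) ((1, 0) : C_R_NormedModule))
    (scal (g t) ((0, 1) : C_R_NormedModule))) x
  (plus (scal a ((1, 0) : C_R_NormedModule)) (scal b ((0, 1) : C_R_NormedModule))).
  by apply: is_derive_plus; exact: is_derive_scal_l.
have E u v : plus (scal u ((1, 0) : C_R_NormedModule))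
    (scal v ((0, 1) : C_R_NormedModule)) = (u, v).
  by apply: injective_projections; rewrite /= /plus /scal /= /mult /=; ring.
rewrite E in hp; apply: is_derive_ext hp => t; exact: E.
Qed.

Lemma is_Cderive_Re (f : R -> C) (x : R) (l : C) :
  is_Cderive f x l -> is_derive (fun t => (f t).1) x l.1.
Proof.
move=> h; apply: filterdiff_ext_lin.
- apply: (filterdiff_comp' f (fst : C_R_NormedModule -> R_NormedModule) _ _ _ h).
  apply: filterdiff_linear; exact: is_linear_fst.
- by [].
Qed.

Lemma is_Cderive_Im (f : R -> C) (x : R) (l : C) :
  is_Cderive f x l -> is_derive (fun t => (f t).2) x l.2.
Proof.
move=> h; apply: filterdiff_ext_lin.
- apply: (filterdiff_comp' f (snd : C_R_NormedModule -> R_NormedModule) _ _ _ h).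
  apply: filterdiff_linear; exact: is_linear_snd.
- by [].
Qed.

Lemma is_Cderive_plus (f g : R -> C) (x : R) (df dg : C) :
  is_Cderive f x df -> is_Cderive g x dg ->
  is_Cderive (fun t => f t + g t)%C x (df + dg)%C.
Proof. exact: (@is_derive_plus R_AbsRing C_R_NormedModule). Qed.

Lemma is_Cderive_opp (f : R -> C) (x : R) (df : C) :
  is_Cderive f x df -> is_Cderive (fun t => - f t)%C x (- df)%C.
Proof. exact: (@is_derive_opp R_AbsRing C_R_NormedModule). Qed.

Lemma is_Cderive_mult (f g : R -> C) (x : R) (df dg : C) :
  is_Cderive f x df -> is_Cderive g x dg ->
  is_Cderive (fun t => f t * g t)%C x (df * g x + f x * dg)%C.
Proof.
move=> hf hg; have [f1 f2] := (is_Cderive_Re hf, is_Cderive_Im hf).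
have [g1 g2] := (is_Cderive_Re hg, is_Cderive_Im hg).
have -> : (df * g x + f x * dg)%C =
  ((df.1 * (g x).1 + (f x).1 * dg.1) - (df.2 * (g x).2 + (f x).2 * dg.2),
   (df.1 * (g x).2 + (f x).1 * dg.2) + (df.2 * (g x).1 + (f x).2 * dg.1)).
  by apply: injective_projections => /=; ring.
apply: is_Cderive_pair.
- by apply: (is_derive_minus (V := R_NormedModule));
    apply: (is_derive_mult (K := R_AbsRing)) => //; exact: Rmult_comm.
- by apply: (is_derive_plus (V := R_NormedModule));
    apply: (is_derive_mult (K := R_AbsRing)) => //; exact: Rmult_comm.
Qed.

Lemma is_Cderive_inv (f : R -> C) (x : R) (df : C) :
  is_Cderive f x df -> f x <> 0 ->
  is_Cderive (fun t => / f t)%C x (- (df / (f x * f x)))%C.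
Proof.
move=> hf nz; have [f1 f2] := (is_Cderive_Re hf, is_Cderive_Im hf).
have q0 := Csqr_pos nz.
have -> : (- (df / (f x * f x)))%C =
  ((df.1 * ((f x).1 ^ 2 + (f x).2 ^ 2) -
     (f x).1 * (2 * (f x).1 * df.1 + 2 * (f x).2 * df.2)) /
     ((f x).1 ^ 2 + (f x).2 ^ 2) ^ 2,
   (- df.2 * ((f x).1 ^ 2 + (f x).2 ^ 2) -
     - (f x).2 * (2 * (f x).1 * df.1 + 2 * (f x).2 * df.2)) /
     ((f x).1 ^ 2 + (f x).2 ^ 2) ^ 2).
  case: (f x) q0 => a b /= q0.
  have q1 : (a * a - b * b) * ((a * a - b * b) * 1) +
    (a * b + b * a) * ((a * b + b * a) * 1) = (a * (a * 1) + b * (b * 1)) ^ 2.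
    by ring.
  by apply: injective_projections => /=; rewrite !q1; field; lra.
have aux (u v : R -> R) (a b : R) : is_derive u x a -> is_derive v x b ->
    is_derive (fun t => u t ^ 2 + v t ^ 2) x (2 * u x * a + 2 * v x * b).
  move=> h1 h2; auto_derive; first by split; [exists a | split => //; exists b].
  by rewrite (is_derive_unique _ _ _ h1) (is_derive_unique _ _ _ h2); ring.
have hq := aux _ _ _ _ f1 f2.
apply: is_Cderive_pair.
- by apply: (is_derive_div (fun t => (f t).1)) => //; lra.
- apply: (is_derive_div (fun t => - (f t).2)) => //; last lra.
  exact: (is_derive_opp (V := R_NormedModule)).
Qed.

Lemma is_Cderive_Cexp (f : R -> C) (x : R) (df : C) :
  is_Cderive f x df ->
  is_Cderive (fun t => Cexp (f t)) x (df * Cexp (f x))%C.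
Proof.
move=> /[dup] /is_Cderive_Re f1 /is_Cderive_Im f2.
have aux (u v : R -> R) (a b : R) : is_derive u x a -> is_derive v x b ->
    is_Cderive (fun t => Cexp (u t, v t)) x ((a, b) * Cexp (u x, v x))%C.
  move=> h1 h2; have [e1 e2] := (is_derive_unique _ _ _ h1, is_derive_unique _ _ _ h2).
  have [x1 x2] : ex_derive u x /\ ex_derive v x by split; [exists a | exists b].
  by apply: is_Cderive_pair; rewrite /Re /Im /=; auto_derive => //;
    rewrite e1 e2; ring.
have := aux _ _ _ _ f1 f2; rewrite -!surjective_pairing.
by apply: is_derive_ext => t; rewrite -surjective_pairing.
Qed.

Lemma continuous_Cderive (f : R -> C) (x : R) (l : C) :
  is_Cderive f x l -> @continuous R_UniformSpace C_UniformSpace f x.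
Proof. move=> h; apply: ex_derive_continuous; by exists l. Qed.

(** * Integrals of complex-valued functions *)

Notation is_CInt := (@is_RInt C_R_NormedModule).
Notation ex_CInt := (@ex_RInt C_R_NormedModule).
Notation CInt := (@RInt C_R_CompleteNormedModule).
Notation Ccontinuous := (@continuous R_UniformSpace C_UniformSpace).

Lemma CInt_correct (f : R -> C) (a b : R) :
  ex_CInt f a b -> is_CInt f a b (CInt f a b).
Proof. exact: (@RInt_correct C_R_CompleteNormedModule). Qed.

Lemma CInt_unique (f : R -> C) (a b : R) (l : C) :
  is_CInt f a b l -> CInt f a b = l.
Proof. exact: (@is_RInt_unique C_R_CompleteNormedModule). Qed.

Lemma ex_CInt_continuous (f : R -> C) (a b : R) :
  a <= b -> (forall x, a <= x <= b -> Ccontinuous f x) -> ex_CInt f a b.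
Proof.
move=> ab hf; apply: (@ex_RInt_continuous C_R_CompleteNormedModule) => x.
by rewrite Rmin_left // Rmax_right //; exact: hf.
Qed.

Lemma is_CInt_pair (f : R -> C) (a b : R) (l : C) :
  is_CInt f a b l <->
  is_RInt (fun x => (f x).1) a b l.1 /\ is_RInt (fun x => (f x).2) a b l.2.
Proof.
split=> [h|[h1 h2]].
- by split; [exact: (is_RInt_fct_extend_fst f) | exact: (is_RInt_fct_extend_snd f)].
- by rewrite (surjective_pairing l); exact: (is_RInt_fct_extend_pair f).
Qed.

Lemma is_CInt_plus (f g : R -> C) (a b : R) (l m : C) :
  is_CInt f a b l -> is_CInt g a b m ->
  is_CInt (fun x => f x + g x)%C a b (l + m)%C.
Proof. exact: (@is_RInt_plus C_R_NormedModule). Qed.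

Lemma is_CInt_scal (c : C) (f : R -> C) (a b : R) (l : C) :
  is_CInt f a b l -> is_CInt (fun x => c * f x)%C a b (c * l)%C.
Proof.
move=> /is_CInt_pair[h1 h2]; apply/is_CInt_pair; split.
- apply: (is_RInt_minus (V := R_NormedModule)); exact: (is_RInt_scal (V := R_NormedModule)).
- apply: (is_RInt_plus (V := R_NormedModule)); exact: (is_RInt_scal (V := R_NormedModule)).
Qed.

Lemma is_CInt_minus (f g : R -> C) (a b : R) (l m : C) :
  is_CInt f a b l -> is_CInt g a b m ->
  is_CInt (fun x => f x - g x)%C a b (l - m)%C.
Proof. exact: (@is_RInt_minus C_R_NormedModule). Qed.

Lemma CInt_scal (c : C) (f : R -> C) (a b : R) :
  ex_CInt f a b -> CInt (fun x => c * f x)%C a b = (c * CInt f a b)%C.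
Proof. by move=> h; apply: CInt_unique; apply: is_CInt_scal; exact: CInt_correct. Qed.

Lemma CInt_minus (f g : R -> C) (a b : R) :
  ex_CInt f a b -> ex_CInt g a b ->
  CInt (fun x => f x - g x)%C a b = (CInt f a b - CInt g a b)%C.
Proof. by move=> hf hg; apply: CInt_unique; apply: is_CInt_minus; exact: CInt_correct. Qed.

Lemma CInt_plus (f g : R -> C) (a b : R) :
  ex_CInt f a b -> ex_CInt g a b ->
  CInt (fun x => f x + g x)%C a b = (CInt f a b + CInt g a b)%C.
Proof. by move=> hf hg; apply: CInt_unique; apply: is_CInt_plus; exact: CInt_correct. Qed.

Lemma CInt_ext (f g : R -> C) (a b : R) :
  a <= b -> (forall x, a <= x <= b -> f x = g x) -> CInt f a b = CInt g a b.
Proof.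
move=> ab h; apply: RInt_ext => x; rewrite Rmin_left // Rmax_right // => hx.
by apply: h; lra.
Qed.

Lemma is_CInt_ext (f g : R -> C) (a b : R) (l : C) :
  a <= b -> (forall x, a <= x <= b -> f x = g x) ->
  is_CInt f a b l -> is_CInt g a b l.
Proof.
move=> ab h; apply: is_RInt_ext => x; rewrite Rmin_left // Rmax_right // => hx.
by apply: h; lra.
Qed.

Lemma CInt_Chasles (f : R -> C) (a b c : R) :
  ex_CInt f a b -> ex_CInt f b c ->
  (CInt f a b + CInt f b c)%C = CInt f a c.
Proof. exact: (@RInt_Chasles C_R_CompleteNormedModule). Qed.

Lemma is_CInt_Cderive (f df : R -> C) (a b : R) :
  a <= b ->
  (forall x, a <= x <= b -> is_Cderive f x (df x)) ->
  (forall x, a <= x <= b -> Ccontinuous df x) ->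
  is_CInt df a b (f b - f a)%C.
Proof.
move=> ab h1 h2.
by apply: (@is_RInt_derive C_R_CompleteNormedModule) => x;
  rewrite Rmin_left // Rmax_right //; auto.
Qed.

Lemma Cmod_CInt_le (f : R -> C) (g : R -> R) (a b : R) (lf : C) (lg : R) :
  a <= b -> (forall x, a <= x <= b -> Cmod (f x) <= g x) ->
  is_CInt f a b lf -> is_RInt g a b lg -> Cmod lf <= lg.
Proof.
move=> ab h hf hg; rewrite Cmod_norm.
by apply: (norm_RInt_le f g) hf hg => // x hx; rewrite -Cmod_norm; exact: h.
Qed.

Lemma Cmod_CInt_le_const (f : R -> C) (a b : R) (lf : C) (M : R) :
  a <= b -> (forall x, a <= x <= b -> Cmod (f x) <= M) ->
  is_CInt f a b lf -> Cmod lf <= (b - a) * M.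
Proof.
move=> ab h hf; rewrite Cmod_norm.
by apply: (norm_RInt_le_const f) hf => // x hx; rewrite -Cmod_norm; exact: h.
Qed.

(** * Interchange of integrals over a rectangle *)

Lemma continuity_2d_pt_continuous (f : R -> R -> R) (x y : R) :
  continuous (fun p : R * R => f p.1 p.2) (x, y) -> continuity_2d_pt f x y.
Proof.
move=> h e; have := h _ (locally_ball _ e); case=> d hd.
exists d => u v hu hv; exact: (hd (u, v)).
Qed.

Lemma continuous_slice_r (T : UniformSpace) (f : R -> R -> T) (x y : R) :
  continuous (fun p : R * R => f p.1 p.2) (x, y) -> continuous (f x) y.
Proof.
move=> h; apply: (continuous_comp (fun v => (x, v)) (fun p => f p.1 p.2)) => //.
apply: (@continuous_Cpair _ (fun _ => x) id); [exact: continuous_const|exact: continuous_id].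
Qed.

Lemma continuous_slice_l (T : UniformSpace) (f : R -> R -> T) (x y : R) :
  continuous (fun p : R * R => f p.1 p.2) (x, y) -> continuous (fun u => f u y) x.
Proof.
move=> h; apply: (continuous_comp (fun v => (v, y)) (fun p => f p.1 p.2)) => //.
apply: (@continuous_Cpair _ id (fun _ => y)); [exact: continuous_id|exact: continuous_const].
Qed.

Lemma ex_RInt_cont (f : R -> R) (a b : R) :
  (forall x, continuous f x) -> ex_RInt f a b.
Proof. by move=> h; apply: (@ex_RInt_continuous R_CompleteNormedModule) => x _. Qed.

Notation jointly_continuous f :=
  (forall p, continuous (fun q : R * R => f q.1 q.2) p).

(** The uniform continuity of [f] on a compact rectangle makes a parametric
    integral continuous. *)
Lemma continuous_RInt_snd (f : R -> R -> R) (a b y : R) :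
  jointly_continuous f -> continuous (fun v => RInt (fun u => f u v) a b) y.
Proof.
move=> hf; wlog ab : a b / a <= b => [hw|].
  case: (Rle_lt_dec a b) => ab; first exact: hw.
  apply: (continuous_ext (fun v => opp (RInt (fun u => f u v) b a))) => [v|].
    apply: opp_RInt_swap; apply: ex_RInt_cont => x.
    exact: continuous_slice_l (hf (x, v)).
  by apply: (continuous_opp (V := R_NormedModule)); apply: hw; lra.
apply/filterlim_locally => e.
have e2 : 0 < e / (b - a + 1) by apply: Rdiv_lt_0_compat; [exact: cond_pos|lra].
have [d hd] := @uniform_continuity_2d f a b (y - 1) (y + 1)
  (fun x' y' _ _ => continuity_2d_pt_continuous (hf (x', y'))) (mkposreal _ e2).
have d1 : 0 < Rmin d 1 by apply: Rmin_glb_lt; [exact: cond_pos|lra].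
exists (mkposreal _ d1) => v hv.
have [hv1 hv2] : Rabs (v - y) < d /\ Rabs (v - y) < 1.
  by split; apply: Rlt_le_trans hv _; [exact: Rmin_l|exact: Rmin_r].
have {}hv2 := Rabs_def2 _ _ hv2.
have i v' : ex_RInt (fun u => f u v') a b.
  by apply: ex_RInt_cont => x; exact: continuous_slice_l (hf (x, v')).
have hm := RInt_correct _ _ _ (i v); have hm2 := RInt_correct _ _ _ (i y).
have /= h := is_RInt_minus _ _ _ _ _ _ hm hm2.
have bd := norm_RInt_le_const _ a b _ (e / (b - a + 1)) ab _ h.
have := cond_pos e => e0.
apply: Rle_lt_trans (bd _) _ => [x hx|].
  apply: Rlt_le; apply: (hd x y x v) => //; try lra.
  by rewrite Rminus_diag Rabs_R0; exact: cond_pos.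
rewrite /Rdiv -Rmult_assoc (Rmult_comm _ e) Rmult_assoc.
rewrite -[X in _ < X]Rmult_1_r; apply: Rmult_lt_compat_l => //.
apply/Rlt_div_l; lra.
Qed.

Lemma continuous_swap (f : R -> R -> R) :
  jointly_continuous f -> jointly_continuous (fun x y => f y x).
Proof.
move=> hf [x y].
apply: (continuous_comp (fun q : R * R => (q.2, q.1)) (fun q => f q.1 q.2)) => //.
by apply: continuous_Cpair; [exact: continuous_snd | exact: continuous_fst].
Qed.

(** Both sides are primitives, in the upper bound [b], of the integral over
    [[c, d]]. *)
Lemma Fubini_R (f : R -> R -> R) (a b c d : R) :
  a <= b -> jointly_continuous f ->
  is_RInt (fun x => RInt (f x) c d) a b
    (RInt (fun y => RInt (fun x => f x y) a b) c d).
Proof.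
move=> ab hf.
pose F X y := RInt (fun x => f x y) a X.
have dF X y : is_derive (fun X => F X y) X (f X y).
  apply: (is_derive_RInt (fun x => f x y) _ a).
    exists (mkposreal _ Rlt_0_1) => t _; apply: RInt_correct.
    by apply: ex_RInt_cont => x; exact: continuous_slice_l (hf (x, y)).
  exact: continuous_slice_l (hf (X, y)).
have dG X : is_derive (fun X => RInt (F X) c d) X (RInt (f X) c d).
  have -> : RInt (f X) c d = RInt (fun t => Derive (fun u => F u t) X) c d.
    by apply: RInt_ext => t _; rewrite (is_derive_unique _ _ _ (dF X t)).
  apply: is_derive_RInt_param.
  - by exists (mkposreal _ Rlt_0_1) => t _ u _; exists (f t u); exact: dF.
  - move=> t _; apply: (continuity_2d_pt_ext f) => [u v|].
      by rewrite (is_derive_unique _ _ _ (dF u v)).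
    exact: continuity_2d_pt_continuous.
  - exists (mkposreal _ Rlt_0_1) => X' _; apply: ex_RInt_cont => y.
    exact: (continuous_RInt_snd (f := f)).
have := is_RInt_derive (fun X => RInt (F X) c d) (fun X => RInt (f X) c d) a b
  (fun X _ => dG X) (fun X _ => @continuous_RInt_snd _ c d X (continuous_swap hf)).
suff -> : minus (RInt (F b) c d) (RInt (F a) c d) = RInt (F b) c d by [].
have -> : RInt (F a) c d = RInt (fun _ => 0) c d.
  by apply: RInt_ext => y _; rewrite /F RInt_point.
rewrite RInt_const /minus /opp /plus /scal /= /mult /=; ring.
Qed.

Definition clamp (a b x : R) := Rmax a (Rmin b x).

Lemma clamp_id (a b x : R) : a <= x <= b -> clamp a b x = x.
Proof. by move=> h; rewrite /clamp Rmin_right ?Rmax_right; lra. Qed.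

Lemma clamp_bound (a b x : R) : a <= b -> a <= clamp a b x <= b.
Proof.
move=> ab; rewrite /clamp; split; first exact: Rmax_l.
by apply: Rmax_lub => //; exact: Rmin_l.
Qed.

Lemma continuous_clamp (a b x : R) : continuous (clamp a b) x.
Proof.
apply: (continuous_comp (Rmin b) (Rmax a)).
- apply: (continuous_ext (fun x => (b + x - Rabs (b - x)) / 2)) => [u|].
    by rewrite /Rmin /Rabs; case: Rle_dec; case: Rcase_abs; lra.
  apply: (continuous_mult (K := R_AbsRing)); last exact: continuous_const.
  apply: (continuous_minus (V := R_NormedModule)).
    apply: (continuous_plus (V := R_NormedModule)); [exact: continuous_const|exact: continuous_id].
  apply: continuous_comp; last exact: continuous_Rabs.
  apply: (continuous_minus (V := R_NormedModule)); [exact: continuous_const|exact: continuous_id].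
- apply: (continuous_ext (fun x => (a + x + Rabs (a - x)) / 2)) => [u|].
    by rewrite /Rmax /Rabs; case: Rle_dec; case: Rcase_abs; lra.
  apply: (continuous_mult (K := R_AbsRing)); last exact: continuous_const.
  apply: (continuous_plus (V := R_NormedModule)).
    apply: (continuous_plus (V := R_NormedModule)); [exact: continuous_const|exact: continuous_id].
  apply: continuous_comp; last exact: continuous_Rabs.
  apply: (continuous_minus (V := R_NormedModule)); [exact: continuous_const|exact: continuous_id].
Qed.

(** Precomposing with the projection onto the rectangle extends [f] to a
    continuous function on the plane without changing the integrals. *)
Lemma Fubini_C (f : R -> R -> C) (a b c d : R) :
  a <= b -> c <= d ->
  (forall x y, a <= x <= b -> c <= y <= d ->
    @continuous _ C_UniformSpace (fun p : R * R => f p.1 p.2) (x, y)) ->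
  is_CInt (fun x => CInt (f x) c d) a b
    (CInt (fun y => CInt (fun x => f x y) a b) c d).
Proof.
move=> ab cd hf.
pose g x y := f (clamp a b x) (clamp c d y).
have hg p : @continuous _ C_UniformSpace (fun q : R * R => g q.1 q.2) p.
  case: p => x y.
  apply: (continuous_comp (fun q : R * R => (clamp a b q.1, clamp c d q.2))
    (fun q => f q.1 q.2)); last by apply: hf; exact: clamp_bound.
  apply: continuous_Cpair.
  - by apply: (continuous_comp (fun q : R * R => q.1)); [exact: continuous_fst|exact: continuous_clamp].
  - by apply: (continuous_comp (fun q : R * R => q.2)); [exact: continuous_snd|exact: continuous_clamp].
have g1 : jointly_continuous (fun x y => (g x y).1) by move=> p; exact: continuous_Re.
have g2 : jointly_continuous (fun x y => (g x y).2) by move=> p; exact: continuous_Im.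
have slr x y : Ccontinuous (g x) y by exact: (continuous_slice_r (f := g) (hg (x, y))).
have sll x y : Ccontinuous (fun x => g x y) x by exact: (continuous_slice_l (f := g) (hg (x, y))).
have comp (h : R -> C) u v : (forall x, Ccontinuous h x) ->
    CInt h u v = (RInt (fun x => (h x).1) u v, RInt (fun x => (h x).2) u v).
  move=> hh; apply: CInt_unique; apply/is_CInt_pair; split=> /=; apply: RInt_correct;
    apply: ex_RInt_cont => x; [exact: continuous_Re|exact: continuous_Im].
have -> : CInt (fun y => CInt (fun x => f x y) a b) c d =
  (RInt (fun y => RInt (fun x => (g x y).1) a b) c d,
   RInt (fun y => RInt (fun x => (g x y).2) a b) c d).
  apply: CInt_unique.
  apply: (is_CInt_ext (f := fun y => CInt (fun x => g x y) a b)) => // [y hy|].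
    by apply: CInt_ext => // x hx; rewrite /g !clamp_id.
  apply/is_CInt_pair; split.
  - apply: (is_RInt_ext (fun y => RInt (fun x => (g x y).1) a b)) => [y _|].
      by rewrite comp.
    by apply: RInt_correct; apply: ex_RInt_cont => y; exact: (@continuous_RInt_snd (fun x y => (g x y).1)).
  - apply: (is_RInt_ext (fun y => RInt (fun x => (g x y).2) a b)) => [y _|].
      by rewrite comp.
    by apply: RInt_correct; apply: ex_RInt_cont => y; exact: (@continuous_RInt_snd (fun x y => (g x y).2)).
apply: (is_CInt_ext (f := fun x => CInt (g x) c d)) => // [x hx|].
  by apply: CInt_ext => // y hy; rewrite /g !clamp_id.
apply/is_CInt_pair; split.
- apply: (is_RInt_ext (fun x => RInt (fun y => (g x y).1) c d)) => [x _|].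
    by rewrite comp.
  exact: (@Fubini_R (fun x y => (g x y).1)).
- apply: (is_RInt_ext (fun x => RInt (fun y => (g x y).2) c d)) => [x _|].
    by rewrite comp.
  exact: (@Fubini_R (fun x y => (g x y).2)).
Qed.

(** * Holomorphic functions and Cauchy's theorem on rectangles *)

Notation CCcontinuous := (@continuous C_UniformSpace C_UniformSpace).

(** The complex derivative is defined through the chain rule along curves, so
    that it restricts at once to both sides of a rectangle. *)
Definition is_complex_derivative (g : C -> C) (w d : C) : Prop :=
  forall (gamma : R -> C) (t : R) (v : C), gamma t = w ->
    is_Cderive gamma t v -> is_Cderive (fun u => g (gamma u)) t (v * d)%C.

Definition holomorphic (A : C -> Prop) (g : C -> C) : Prop :=
  exists D : C -> C, forall w, A w ->
    [/\ is_complex_derivative g w (D w), CCcontinuous D w & CCcontinuous g w].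

Lemma holomorphic_sub (A B : C -> Prop) (g : C -> C) :
  (forall w, A w -> B w) -> holomorphic B g -> holomorphic A g.
Proof. by move=> AB [D hD]; exists D => w /AB; exact: hD. Qed.

Lemma holomorphic_ext (A : C -> Prop) (f g : C -> C) :
  (forall w, f w = g w) -> holomorphic A f -> holomorphic A g.
Proof.
move=> fg [D hD]; exists D => w /hD[h1 h2 h3]; split => //.
- move=> gamma t v e hg; apply: is_derive_ext (h1 gamma t v e hg) => u; exact: fg.
- exact: continuous_ext h3.
Qed.

Lemma holomorphic_const (A : C -> Prop) (c : C) : holomorphic A (fun _ => c).
Proof.
exists (fun _ => 0%C) => w _; split; [|exact: continuous_const..].
move=> gamma t v _ _; rewrite Cmult_0_r.
exact: (@is_derive_const R_AbsRing C_R_NormedModule).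
Qed.

Lemma holomorphic_id (A : C -> Prop) : holomorphic A (fun w => w).
Proof.
exists (fun _ => 1%C) => w _; split; [|exact: continuous_const|exact: continuous_id].
by move=> gamma t v _; rewrite Cmult_1_r.
Qed.

Lemma holomorphic_plus (A : C -> Prop) (f g : C -> C) :
  holomorphic A f -> holomorphic A g -> holomorphic A (fun w => f w + g w)%C.
Proof.
move=> [D hD] [E hE]; exists (fun w => D w + E w)%C => w hw.
have [d1 d2 d3] := hD w hw; have [e1 e2 e3] := hE w hw.
split; [|exact: continuous_Cplus..].
move=> gamma t v e hg; rewrite Cmult_plus_distr_l.
by apply: is_Cderive_plus; auto.
Qed.

Lemma holomorphic_mult (A : C -> Prop) (f g : C -> C) :
  holomorphic A f -> holomorphic A g -> holomorphic A (fun w => f w * g w)%C.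
Proof.
move=> [D hD] [E hE]; exists (fun w => D w * g w + f w * E w)%C => w hw.
have [d1 d2 d3] := hD w hw; have [e1 e2 e3] := hE w hw.
split; [|apply: continuous_Cplus; exact: continuous_Cmult|exact: continuous_Cmult].
move=> gamma t v e hg.
have -> : (v * (D w * g w + f w * E w) = (v * D w) * g w + f w * (v * E w))%C by ring.
by rewrite -{2 3}e; apply: is_Cderive_mult; auto.
Qed.

Lemma holomorphic_minus (A : C -> Prop) (f g : C -> C) :
  holomorphic A f -> holomorphic A g -> holomorphic A (fun w => f w - g w)%C.
Proof.
move=> hf hg.
apply: (holomorphic_ext (f := fun w => f w + (RtoC (-1)) * g w)%C) => [w|].
  by rewrite (RtoC_opp 1); ring.
by apply: holomorphic_plus => //; apply: holomorphic_mult => //; exact: holomorphic_const.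
Qed.

Lemma holomorphic_inv (A : C -> Prop) (f : C -> C) :
  (forall w, A w -> f w <> 0) ->
  holomorphic A f -> holomorphic A (fun w => / f w)%C.
Proof.
move=> nz [D hD]; exists (fun w => - (D w / (f w * f w)))%C => w hw.
have [d1 d2 d3] := hD w hw; have nw := nz w hw.
split; last exact: continuous_Cinv.
- move=> gamma t v e hg.
  have -> : (v * - (D w / (f w * f w)) = - ((v * D w) / (f w * f w)))%C by field.
  rewrite -{2 3}e; apply: is_Cderive_inv; first by auto.
  by rewrite e.
- apply: continuous_Copp; apply: continuous_Cmult => //.
  apply: continuous_Cinv; first exact: continuous_Cmult.
  by apply: Cmult_neq_0.
Qed.

Lemma holomorphic_Cexp (A : C -> Prop) (f : C -> C) :
  holomorphic A f -> holomorphic A (fun w => Cexp (f w)).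
Proof.
move=> [D hD]; exists (fun w => D w * Cexp (f w))%C => w hw.
have [d1 d2 d3] := hD w hw.
split; [|apply: continuous_Cmult => //; exact: continuous_Cexp|exact: continuous_Cexp].
move=> gamma t v e hg; rewrite Cmult_assoc -{2}e.
by apply: is_Cderive_Cexp; auto.
Qed.

Lemma holomorphic_scal (A : C -> Prop) (c : C) (f : C -> C) :
  holomorphic A f -> holomorphic A (fun w => c * f w)%C.
Proof. by apply: holomorphic_mult; exact: holomorphic_const. Qed.

Lemma holomorphic_continuous (A : C -> Prop) (g : C -> C) (w : C) :
  holomorphic A g -> A w -> CCcontinuous g w.
Proof. by move=> [D hD] /hD[]. Qed.

Definition in_rect (a b c d : R) (w : C) : Prop :=
  a <= w.1 <= b /\ c <= w.2 <= d.

Lemma continuous_horizontal (g : C -> C) (x y : R) :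
  CCcontinuous g (x, y) -> Ccontinuous (fun x => g (x, y)) x.
Proof.
move=> h; apply: (continuous_comp (fun v => (v, y)) g) => //.
by apply: continuous_Cpair; [exact: continuous_id|exact: continuous_const].
Qed.

Lemma continuous_vertical (g : C -> C) (x y : R) :
  CCcontinuous g (x, y) -> Ccontinuous (fun y => g (x, y)) y.
Proof.
move=> h; apply: (continuous_comp (fun v => (x, v)) g) => //.
by apply: continuous_Cpair; [exact: continuous_const|exact: continuous_id].
Qed.

Lemma ex_CInt_horizontal (g : C -> C) (a b y : R) :
  a <= b -> (forall x, a <= x <= b -> CCcontinuous g (x, y)) ->
  ex_CInt (fun x => g (x, y)) a b.
Proof. by move=> ab h; apply: ex_CInt_continuous => // x hx; apply: continuous_horizontal; auto. Qed.

Lemma ex_CInt_vertical (g : C -> C) (c d x : R) :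
  c <= d -> (forall y, c <= y <= d -> CCcontinuous g (x, y)) ->
  ex_CInt (fun y => g (x, y)) c d.
Proof. by move=> ab h; apply: ex_CInt_continuous => // y hy; apply: continuous_vertical; auto. Qed.

Definition rect_integral (a b c d : R) (g : C -> C) : C :=
  (CInt (fun x => g (x, c)) a b + Ci * CInt (fun y => g (b, y)) c d
   - CInt (fun x => g (x, d)) a b - Ci * CInt (fun y => g (a, y)) c d)%C.

(** If [D] is the derivative of [g], then both [D] and [i D], integrated over
    the rectangle in one order or in the other, give the increments of [g]
    across the rectangle; the two orders give the same value. *)
Lemma Cauchy_rect (a b c d : R) (g : C -> C) :
  a <= b -> c <= d -> holomorphic (in_rect a b c d) g ->
  rect_integral a b c d g = 0.
Proof.
move=> ab cd [D hD].
have hR x y : a <= x <= b -> c <= y <= d -> in_rect a b c d (x, y) by [].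
have cD x y : a <= x <= b -> c <= y <= d -> CCcontinuous D (x, y).
  by move=> hx hy; case: (hD _ (hR _ _ hx hy)).
have cg x y : a <= x <= b -> c <= y <= d -> CCcontinuous g (x, y).
  by move=> hx hy; case: (hD _ (hR _ _ hx hy)).
have fub := Fubini_C (f := fun x y => D (x, y)) ab cd.
have {}fub := fub (fun x y hx hy => continuous_ext (fun p : R * R => D p) _ _
  (fun p => f_equal D (surjective_pairing p)) (cD x y hx hy)).
have I1 y : c <= y <= d -> CInt (fun x => D (x, y)) a b = (g (b, y) - g (a, y))%C.
  move=> hy; apply: CInt_unique.
  apply: (is_CInt_Cderive (f := fun x => g (x, y))) => // x hx.
  - have [h _ _] := hD _ (hR _ _ hx hy).
    have := h (fun x => (x, y)) x (1, 0) erefl.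
    have -> : ((1, 0) * D (x, y) = D (x, y))%C.
      by apply: injective_projections => /=; ring.
    by apply; apply: is_Cderive_pair; [exact: is_derive_id|exact: is_derive_const].
  - exact: continuous_horizontal (cD _ _ hx hy).
have I2 x : a <= x <= b -> (Ci * CInt (fun y => D (x, y)) c d)%C = (g (x, d) - g (x, c))%C.
  move=> hx; rewrite -CInt_scal; last first.
    by apply: ex_CInt_vertical => // y hy; exact: cD.
  apply: CInt_unique.
  apply: (is_CInt_Cderive (f := fun y => g (x, y))) => // y hy.
  - have [h _ _] := hD _ (hR _ _ hx hy).
    have := h (fun y => (x, y)) y Ci erefl.
    by apply; apply: is_Cderive_pair; [exact: is_derive_const|exact: is_derive_id].
  - apply: continuous_Cmult; first exact: continuous_const.
    exact: continuous_vertical (cD _ _ hx hy).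
have aa : a <= a <= b by lra.
have bb : a <= b <= b by lra.
have cc : c <= c <= d by lra.
have dd : c <= d <= d by lra.
have {}fub := @is_CInt_scal Ci _ _ _ _ fub.
have e1 : CInt (fun y => CInt (fun x => D (x, y)) a b) c d =
   (CInt (fun y => g (b, y)) c d - CInt (fun y => g (a, y)) c d)%C.
  rewrite -CInt_minus; [exact: CInt_ext|apply: ex_CInt_vertical..] => // y hy; exact: cg.
have e2 := is_CInt_ext ab I2 fub.
have e3 : (CInt (fun x => g (x, d)) a b - CInt (fun x => g (x, c)) a b)%C =
   (Ci * (CInt (fun y => g (b, y)) c d - CInt (fun y => g (a, y)) c d))%C.
  rewrite -CInt_minus; [|apply: ex_CInt_horizontal => // x hx; exact: cg..].
  by rewrite (CInt_unique e2) e1.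
have -> : rect_integral a b c d g =
  (Ci * (CInt (fun y => g (b, y)) c d - CInt (fun y => g (a, y)) c d) -
   (CInt (fun x => g (x, d)) a b - CInt (fun x => g (x, c)) a b))%C.
  by rewrite /rect_integral; ring.
by rewrite e3; ring.
Qed.

(** The part with real part at most [b] of the Hankel contour, in the
    coordinate [w = ln s] in which the contour is the boundary of a half-strip
    of width [2 th]. *)
Definition strip_integral (a b th : R) (g : C -> C) : C :=
  (- CInt (fun x => g (x, (Ropp th))) a b + Ci * CInt (fun y => g (a, y)) (Ropp th) th
   + CInt (fun x => g (x, th)) a b)%C.

Lemma strip_integral_rect (a a' b th : R) (g : C -> C) :
  a <= a' <= b ->
  (forall x, a <= x <= b -> CCcontinuous g (x, th) /\ CCcontinuous g (x, - th)) ->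
  strip_integral a b th g =
    (strip_integral a' b th g - rect_integral a a' (- th) th g)%C.
Proof.
move=> aab hc.
rewrite /strip_integral /rect_integral.
rewrite -(CInt_Chasles (f := fun x => g (x, - th)) (a := a) (b := a') (c := b));
  try by apply: ex_CInt_horizontal; [lra|move=> x hx; apply hc; lra].
rewrite -(CInt_Chasles (f := fun x => g (x, th)) (a := a) (b := a') (c := b));
  try by apply: ex_CInt_horizontal; [lra|move=> x hx; apply hc; lra].
ring.
Qed.

Lemma strip_integral_shift (a a' b th : R) (g : C -> C) :
  a <= a' <= b -> 0 <= th -> holomorphic (in_rect a a' (- th) th) g ->
  (forall x, a <= x <= b -> CCcontinuous g (x, th) /\ CCcontinuous g (x, - th)) ->
  strip_integral a b th g = strip_integral a' b th g.
Proof.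
move=> aab th0 hg hc; rewrite (strip_integral_rect aab hc) Cauchy_rect //; try lra.
ring.
Qed.

(** * The complex exponential *)

Lemma Cexp_plus (a b : C) : Cexp (a + b)%C = (Cexp a * Cexp b)%C.
Proof.
rewrite /Cexp /Re /Im /= exp_plus cos_plus sin_plus.
by apply: injective_projections => /=; ring.
Qed.

Lemma Cexp_RtoC (x : R) : Cexp (RtoC x) = RtoC (exp x).
Proof. by rewrite /Cexp /RtoC /Re /Im /= cos_0 sin_0; apply: injective_projections => /=; ring. Qed.

Lemma Cexp_0 : Cexp 0 = 1.
Proof. by rewrite Cexp_RtoC exp_0. Qed.

Lemma Cmod_Cexp (z : C) : Cmod (Cexp z) = exp z.1.
Proof.
rewrite /Cmod /Cexp /Re /Im /=.
have -> : exp z.1 * cos z.2 * (exp z.1 * cos z.2 * 1) +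
   exp z.1 * sin z.2 * (exp z.1 * sin z.2 * 1) =
   (exp z.1)² * ((sin z.2)² + (cos z.2)²) by rewrite /Rsqr; ring.
rewrite sin2_cos2 Rmult_1_r sqrt_Rsqr //; apply: Rlt_le; exact: exp_pos.
Qed.

Lemma Cexp_neq_0 (z : C) : Cexp z <> 0.
Proof.
move=> h; have := Cmod_Cexp z; rewrite h Cmod_0.
have := exp_pos z.1; lra.
Qed.

Lemma Cexp_opp (z : C) : Cexp (- z)%C = (/ Cexp z)%C.
Proof.
have nz := @Cexp_neq_0 z.
have h : (Cexp (- z) * Cexp z)%C = 1.
  by rewrite -Cexp_plus -Cexp_0; congr Cexp; ring.
by rewrite -[LHS]Cmult_1_r -(Cinv_r _ nz) Cmult_assoc h Cmult_1_l.
Qed.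

Lemma Cmod_triang_sub (a b : C) : Cmod (a - b)%C <= Cmod a + Cmod b.
Proof. by apply: Rle_trans (Cmod_triangle _ _) _; rewrite Cmod_opp; lra. Qed.

Lemma Cmod_sub_sym (a b : C) : Cmod (a - b)%C = Cmod (b - a)%C.
Proof. by rewrite -Cmod_opp; congr Cmod; ring. Qed.

Lemma Cmod_triang3 (a b c : C) : Cmod (a - c)%C <= Cmod (a - b)%C + Cmod (b - c)%C.
Proof. have -> : (a - c = (a - b) + (b - c))%C by ring. exact: Cmod_triangle. Qed.

Lemma CCcontinuous_Cmod (f : C -> C) (w0 : C) (e : R) :
  CCcontinuous f w0 -> 0 < e ->
  exists2 d : R, 0 < d & forall w, Cmod (w - w0)%C < d -> Cmod (f w - f w0)%C < e.
Proof.
move=> h e0.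
have := h _ (@locally_ball_norm R_AbsRing C_R_NormedModule (f w0) (mkposreal _ e0)).
move=> /(@locally_norm_le_locally R_AbsRing C_R_NormedModule) [d hd].
exists d; first exact: cond_pos.
by move=> w hw; have := hd w; rewrite /ball_norm -!Cmod_norm; apply.
Qed.

(** The source of all decay estimates on the rays of the contour, where
    [k = - cos th]. The constant comes from the tangent of [exp] at
    [ln (p / k)], the point where the two exponents have the same slope. *)
Lemma exp_exp_decay (k p : R) : 0 < k -> 0 < p ->
  exists2 K : R, 0 < K & forall t, exp (- (k * exp t)) <= K * exp (- (p * t)).
Proof.
move=> k0 p0; exists (exp (p * (ln (p / k) - 1))); first exact: exp_pos.
move=> t; rewrite -exp_plus.
have h : k * exp t = p * exp (t - ln (p / k)).
  rewrite /Rminus exp_plus exp_Ropp exp_ln; last exact: Rdiv_lt_0_compat.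
  by field; lra.
have := exp_ineq1_le (t - ln (p / k)) => h2.
have h3 : - (k * exp t) <= p * (ln (p / k) - 1) + - (p * t) by rewrite h; nra.
case: h3 => h3; first exact/Rlt_le/exp_increasing.
by rewrite h3; lra.
Qed.

Lemma exp_le_compat (x y : R) : x <= y -> exp x <= exp y.
Proof. by case=> [h|->]; [exact/Rlt_le/exp_increasing|lra]. Qed.

(** * Limits at infinity and improper integrals *)

Definition tends_to (f : R -> C) (l : C) : Prop :=
  forall e, 0 < e -> exists B, forall b, B <= b -> Cmod (f b - l)%C < e.

Lemma tends_to_filterlim (f : R -> C) (l : C) :
  tends_to f l <-> filterlim f (Rbar_locally p_infty) (@locally C_UniformSpace l).
Proof.
split=> h.
- move=> P /(@locally_norm_le_locally R_AbsRing C_R_NormedModule) [e he].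
  have [B hB] := h e (cond_pos e).
  exists B => b hb; apply: he; rewrite /ball_norm -Cmod_norm.
  by apply: hB; lra.
- move=> e e0.
  have := @locally_ball_norm R_AbsRing C_R_NormedModule l (mkposreal _ e0).
  move=> /h [B hB].
  exists (B + 1) => b hb; have := hB b; rewrite /ball_norm -Cmod_norm; apply; lra.
Qed.

Lemma tends_to_unique (f : R -> C) (l m : C) :
  tends_to f l -> tends_to f m -> l = m.
Proof.
move=> /tends_to_filterlim h1 /tends_to_filterlim h2.
exact: (@filterlim_locally_unique R R_AbsRing C_R_NormedModule
  _ (Proper_StrongProper _ (Rbar_locally_filter p_infty)) f l m h1 h2).
Qed.

Lemma tends_to_ext (f g : R -> C) (a : R) (l : C) :
  (forall b, a <= b -> f b = g b) -> tends_to f l -> tends_to g l.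
Proof.
move=> fg h e /h[B hB]; exists (Rmax a B) => b hb; rewrite -fg.
- by apply: hB; apply: Rle_trans hb; exact: Rmax_r.
- by apply: Rle_trans hb; exact: Rmax_l.
Qed.

Lemma tends_to_plus (f g : R -> C) (l m : C) :
  tends_to f l -> tends_to g m -> tends_to (fun b => f b + g b)%C (l + m)%C.
Proof.
move=> hf hg e e0; have e2 : 0 < e / 2 by lra.
have [B hB] := hf _ e2; have [D hD] := hg _ e2.
exists (Rmax B D) => b hb.
have h1 := hB b (Rle_trans _ _ _ (Rmax_l _ _) hb).
have h2 := hD b (Rle_trans _ _ _ (Rmax_r _ _) hb).
have -> : (f b + g b - (l + m) = (f b - l) + (g b - m))%C by ring.
apply: Rle_lt_trans (Cmod_triangle _ _) _; lra.
Qed.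

Lemma tends_to_const (c : C) : tends_to (fun _ => c) c.
Proof.
move=> e e0; exists 0 => b _; have -> : (c - c)%C = 0 by ring.
by rewrite Cmod_0.
Qed.

Lemma tends_to_scal (c : C) (f : R -> C) (l : C) :
  tends_to f l -> tends_to (fun b => c * f b)%C (c * l)%C.
Proof.
move=> hf e e0; have c0 := Cmod_ge_0 c.
have e2 : 0 < e / (Cmod c + 1) by apply: Rdiv_lt_0_compat; lra.
have [B hB] := hf _ e2; exists B => b /hB h.
have -> : (c * f b - c * l = c * (f b - l))%C by ring.
rewrite Cmod_mult.
have h1 := Cmod_ge_0 (f b - l)%C.
have : (Cmod c + 1) * Cmod (f b - l)%C < e.
  by move: h => /Rlt_div_r h; rewrite Rmult_comm; apply: h; lra.
nra.
Qed.

Lemma tends_to_shift (f : R -> C) (x : R) (l : C) :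
  tends_to f l -> tends_to (fun b => f (b + x)) l.
Proof. by move=> h e /h[B hB]; exists (B - x) => b hb; apply: hB; lra. Qed.

Lemma exp_small (K c e : R) : 0 < c -> 0 < e ->
  exists B, forall b, B <= b -> K * exp (- (c * b)) < e.
Proof.
move=> c0 e0; have K1 : 0 < Rabs K + 1 by have := Rabs_pos K; lra.
have q : 0 < e / (Rabs K + 1) by exact: Rdiv_lt_0_compat.
exists (- ln (e / (Rabs K + 1)) / c) => b hb.
have : exp (- (c * b)) <= e / (Rabs K + 1).
  rewrite -[X in _ <= X]exp_ln //; apply: exp_le_compat.
  have : c * (- ln (e / (Rabs K + 1)) / c) = - ln (e / (Rabs K + 1)) by field; lra.
  nra.
move=> /Rle_div_r h; have {}h := h K1.
have := exp_pos (- (c * b)); have := Rle_abs K; nra.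
Qed.

Lemma tends_to_exp_rate (f : R -> C) (l : C) (K c a : R) :
  0 < c -> (forall b, a <= b -> Cmod (f b - l)%C <= K * exp (- (c * b))) ->
  tends_to f l.
Proof.
move=> c0 h e e0; have [B hB] := exp_small K c0 e0.
exists (Rmax a B) => b hb; apply: Rle_lt_trans (h _ _) (hB _ _).
- by apply: Rle_trans hb; exact: Rmax_l.
- by apply: Rle_trans hb; exact: Rmax_r.
Qed.

Lemma is_RInt_exponential (M c a b : R) : c <> 0 ->
  is_RInt (fun x => M * exp (- (c * x))) a b
    (M / c * exp (- (c * a)) - M / c * exp (- (c * b))).
Proof.
move=> c0.
have -> : M / c * exp (- (c * a)) - M / c * exp (- (c * b)) =
  minus (- (M / c) * exp (- (c * b))) (- (M / c) * exp (- (c * a))).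
  by rewrite /minus /plus /opp /=; ring.
apply: (is_RInt_derive (fun x => - (M / c) * exp (- (c * x)))) => x _.
- by auto_derive => //; field.
- apply: (@ex_derive_continuous R_AbsRing R_NormedModule); by auto_derive.
Qed.

Lemma Cmod_CInt_exp (f : R -> C) (a b M c : R) (l : C) :
  a <= b -> 0 < c -> (forall x, a <= x <= b -> Cmod (f x) <= M * exp (- (c * x))) ->
  is_CInt f a b l -> Cmod l <= M / c * exp (- (c * a)).
Proof.
move=> ab c0 hf hl.
have M0 : 0 <= M.
  have := hf a (conj (Rle_refl a) ab); have := Cmod_ge_0 (f a); have := exp_pos (- (c * a)); nra.
have h := Cmod_CInt_le ab hf hl (@is_RInt_exponential M c a b (Rgt_not_eq _ _ c0)).
have : 0 <= M / c * exp (- (c * b)).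
  apply: Rmult_le_pos; last exact/Rlt_le/exp_pos.
  by apply: Rdiv_le_0_compat.
lra.
Qed.

Lemma improper_CInt (f : R -> C) (a M c : R) :
  0 < c -> (forall x, a <= x -> Ccontinuous f x) ->
  (forall x, a <= x -> Cmod (f x) <= M * exp (- (c * x))) ->
  exists l : C, forall b, a <= b ->
    Cmod (CInt f a b - l)%C <= M / c * exp (- (c * b)).
Proof.
move=> c0 cf hf.
have ex u v : a <= u -> u <= v -> ex_CInt f u v.
  by move=> au uv; apply: ex_CInt_continuous => // x hx; apply: cf; lra.
have tail u v : a <= u -> u <= v ->
    Cmod (CInt f a v - CInt f a u)%C <= M / c * exp (- (c * u)).
  move=> au uv; rewrite -(CInt_Chasles (b := u) (ex _ _ (Rle_refl a) au) (ex _ _ au uv)).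
  have -> : (CInt f a u + CInt f u v - CInt f a u)%C = CInt f u v by ring.
  apply: (Cmod_CInt_exp (f := f) (b := v)) => // [x hx|]; first by apply: hf; lra.
  by apply: CInt_correct; exact: ex.
have [l hl] : exists l : C, tends_to (fun b => CInt f a b) l.
  have [l hl] : exists l, filterlim (fun b => CInt f a b) (Rbar_locally p_infty)
      (@locally C_R_CompleteNormedModule l).
    apply/filterlim_locally_cauchy => e.
    have [B hB] := exp_small (2 * (M / c)) c0 (cond_pos e).
    exists (fun u => Rmax a B < u); split; first by exists (Rmax a B).
    move=> u v hu hv; apply: (@norm_compat1 R_AbsRing C_R_NormedModule).
    rewrite -Cmod_norm.
    have [m1 m2] := (Rmax_l a B, Rmax_r a B).
    have p0 := tail (Rmax a B) u m1 (Rlt_le _ _ hu).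
    have p1 := tail (Rmax a B) v m1 (Rlt_le _ _ hv).
    apply: Rle_lt_trans (Cmod_triang3 _ (CInt f a (Rmax a B)) _) _.
    rewrite [X in _ + X]Cmod_sub_sym.
    have := hB _ m2; lra.
  by exists l; apply/tends_to_filterlim.
exists l => b ab; apply: le_epsilon => e e0.
have [B hB] := hl _ e0.
have [m1 m2] := (Rmax_l b B, Rmax_r b B).
apply: Rle_trans (Cmod_triang3 _ (CInt f a (Rmax b B)) _) _.
have := hB _ m2; have := tail b (Rmax b B) ab m1.
rewrite [X in X <= _]Cmod_sub_sym; lra.
Qed.

(** * Integrals over the boundary of a half-strip *)

Definition on_strip (a th : R) (w : C) : Prop :=
  (w.1 = a /\ - th <= w.2 <= th) \/ (a <= w.1 /\ (w.2 = th \/ w.2 = - th)).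

Lemma on_strip_side (a th y : R) : - th <= y <= th -> on_strip a th (a, y).
Proof. by left. Qed.

Lemma on_strip_top (a th x : R) : a <= x -> on_strip a th (x, th).
Proof. by right; split => //; left. Qed.

Lemma on_strip_bot (a th x : R) : a <= x -> on_strip a th (x, - th).
Proof. by right; split => //; right. Qed.

Definition strip_continuous (a th : R) (g : C -> C) : Prop :=
  forall w, on_strip a th w -> CCcontinuous g w.

Lemma ex_CInt_strip (a b th : R) (g : C -> C) :
  a <= b -> 0 <= th -> strip_continuous a th g ->
  [/\ ex_CInt (fun x => g (x, - th)) a b,
      ex_CInt (fun y => g (a, y)) (- th) th
    & ex_CInt (fun x => g (x, th)) a b].
Proof.
move=> ab th0 hg; split.
- by apply: ex_CInt_horizontal => // x hx; apply/hg/on_strip_bot; lra.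
- by apply: ex_CInt_vertical => [|y hy]; [lra|exact/hg/on_strip_side].
- by apply: ex_CInt_horizontal => // x hx; apply/hg/on_strip_top; lra.
Qed.

Lemma strip_integral_plus (a b th : R) (f g : C -> C) :
  a <= b -> 0 <= th -> strip_continuous a th f -> strip_continuous a th g ->
  strip_integral a b th (fun w => f w + g w)%C =
  (strip_integral a b th f + strip_integral a b th g)%C.
Proof.
move=> ab th0 /(ex_CInt_strip ab th0)[f1 f2 f3] /(ex_CInt_strip ab th0)[g1 g2 g3].
by rewrite /strip_integral !CInt_plus //; ring.
Qed.

Lemma strip_integral_minus (a b th : R) (f g : C -> C) :
  a <= b -> 0 <= th -> strip_continuous a th f -> strip_continuous a th g ->
  strip_integral a b th (fun w => f w - g w)%C =
  (strip_integral a b th f - strip_integral a b th g)%C.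
Proof.
move=> ab th0 /(ex_CInt_strip ab th0)[f1 f2 f3] /(ex_CInt_strip ab th0)[g1 g2 g3].
by rewrite /strip_integral !CInt_minus //; ring.
Qed.

Lemma strip_integral_scal (a b th : R) (c : C) (f : C -> C) :
  a <= b -> 0 <= th -> strip_continuous a th f ->
  strip_integral a b th (fun w => c * f w)%C = (c * strip_integral a b th f)%C.
Proof.
move=> ab th0 /(ex_CInt_strip ab th0)[f1 f2 f3].
by rewrite /strip_integral !CInt_scal //; ring.
Qed.

Lemma strip_integral_ext (a b th : R) (f g : C -> C) :
  a <= b -> 0 <= th -> (forall w, on_strip a th w -> f w = g w) ->
  strip_integral a b th f = strip_integral a b th g.
Proof.
move=> ab th0 h; rewrite /strip_integral.
have -> : CInt (fun x => f (x, - th)) a b = CInt (fun x => g (x, - th)) a b.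
  by apply: CInt_ext => // x hx; apply/h/on_strip_bot; lra.
have -> : CInt (fun x => f (x, th)) a b = CInt (fun x => g (x, th)) a b.
  by apply: CInt_ext => // x hx; apply/h/on_strip_top; lra.
have -> // : CInt (fun y => f (a, y)) (- th) th = CInt (fun y => g (a, y)) (- th) th.
by apply: CInt_ext => [|y hy]; [lra|exact/h/on_strip_side].
Qed.

Lemma Cmod_Ci_mult (z : C) : Cmod (Ci * z)%C = Cmod z.
Proof.
rewrite Cmod_mult; have -> : Cmod Ci = 1; last by rewrite Rmult_1_l.
by rewrite /Cmod /=; apply: etrans sqrt_1; congr sqrt; ring.
Qed.

Lemma strip_integral_bound (a b th M c : R) (g : C -> C) :
  a <= b -> 0 <= th -> 0 < c -> strip_continuous a th g ->
  (forall w, on_strip a th w -> Cmod (g w) <= M * exp (- (c * w.1))) ->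
  Cmod (strip_integral a b th g) <= M * (2 / c + 2 * th) * exp (- (c * a)).
Proof.
move=> ab th0 c0 cg hg; have [g1 g2 g3] := ex_CInt_strip ab th0 cg.
have h1 := Cmod_CInt_exp ab c0 (fun x hx => hg (x, - th) (on_strip_bot _ (proj1 hx))) (CInt_correct g1).
have h3 := Cmod_CInt_exp ab c0 (fun x hx => hg (x, th) (on_strip_top _ (proj1 hx))) (CInt_correct g3).
have tt : - th <= th by lra.
have h2 := Cmod_CInt_le_const (M := M * exp (- (c * a))) tt (fun y hy => hg (a, y) (on_strip_side _ hy)) (CInt_correct g2).
rewrite /strip_integral.
apply: Rle_trans (Cmod_triangle _ _) _.
apply: Rle_trans (Rplus_le_compat_r _ _ _ (Cmod_triangle _ _)) _.
rewrite Cmod_opp Cmod_Ci_mult.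
have -> : M * (2 / c + 2 * th) * exp (- (c * a)) =
  M / c * exp (- (c * a)) + (th - - th) * (M * exp (- (c * a))) + M / c * exp (- (c * a)).
  by rewrite /=; field; lra.
move: h1 h2 h3 => /= h1 h2 h3; lra.
Qed.

Lemma strip_integral_limit (a th M c : R) (g : C -> C) :
  0 <= th -> 0 < c -> strip_continuous a th g ->
  (forall w, on_strip a th w -> Cmod (g w) <= M * exp (- (c * w.1))) ->
  exists l : C, forall b, a <= b ->
    Cmod (strip_integral a b th g - l)%C <= 2 * (M / c) * exp (- (c * b)).
Proof.
move=> th0 c0 cg hg.
have [l1 h1] := improper_CInt (f := fun x => g (x, - th)) c0
  (fun x hx => continuous_horizontal (cg _ (on_strip_bot th hx)))
  (fun x hx => hg _ (on_strip_bot th hx)).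
have [l3 h3] := improper_CInt (f := fun x => g (x, th)) c0
  (fun x hx => continuous_horizontal (cg _ (on_strip_top th hx)))
  (fun x hx => hg _ (on_strip_top th hx)).
exists (- l1 + Ci * CInt (fun y => g (a, y)) (Ropp th) th + l3)%C => b ab.
rewrite /strip_integral.
set u := CInt _ a b; set v := CInt _ a b; set m := CInt _ _ _.
have -> : (- u + Ci * m + v - (- l1 + Ci * m + l3) = (v - l3) - (u - l1))%C by ring.
apply: Rle_trans (Cmod_triang_sub _ _) _.
have := h1 b ab; have := h3 b ab; rewrite -/u -/v; lra.
Qed.

Lemma strip_Fubini (F : R -> C -> C) (u v a b th : R) :
  u <= v -> a <= b -> 0 <= th ->
  (forall p : R * C,
    @continuous (prod_UniformSpace R_UniformSpace C_UniformSpace) C_UniformSpace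
      (fun q => F q.1 q.2) p) ->
  is_CInt (fun x => strip_integral a b th (F x)) u v
    (strip_integral a b th (fun w => CInt (fun x => F x w) u v)).
Proof.
move=> uv ab th0 hF.
have cont (k : R * R -> C) (p : R * R) : @continuous _ C_UniformSpace k p ->
    @continuous _ C_UniformSpace (fun q : R * R => F q.1 (k q)) p.
  move=> hk; apply: (@continuous_comp_2 _ R_UniformSpace C_UniformSpace C_UniformSpace
    (fun q : R * R => q.1) k F) => //.
  by case: p {hk} => p1 p2; exact: continuous_fst.
have c1 y x t : @continuous _ C_UniformSpace (fun q : R * R => F q.1 (q.2, y)) (x, t).
  apply: cont; apply: continuous_Cpair; [exact: continuous_snd|exact: continuous_const].
have c2 x t : @continuous _ C_UniformSpace (fun q : R * R => F q.1 (a, q.2)) (x, t).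
  apply: cont; apply: continuous_Cpair; [exact: continuous_const|exact: continuous_snd].
have tt : - th <= th by lra.
have f1 := Fubini_C (f := fun x t => F x (t, - th)) uv ab (fun x t _ _ => c1 _ x t).
have f2 := Fubini_C (f := fun x t => F x (t, th)) uv ab (fun x t _ _ => c1 _ x t).
have f3 := Fubini_C (f := fun x t => F x (a, t)) uv tt (fun x t _ _ => c2 x t).
rewrite /strip_integral; apply: is_CInt_plus f2; apply: is_CInt_plus; last exact: is_CInt_scal.
exact: (@is_RInt_opp C_R_NormedModule).
Qed.

Lemma Cmod_CInt_exp_neg (f : R -> C) (a b M c : R) (l : C) :
  a <= b -> 0 < c -> (forall x, a <= x <= b -> Cmod (f x) <= M * exp (c * x)) ->
  is_CInt f a b l -> Cmod l <= M / c * exp (c * b).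
Proof.
move=> ab c0 hf hl.
have M0 : 0 <= M.
  have := hf a (conj (Rle_refl a) ab); have := Cmod_ge_0 (f a); have := exp_pos (c * a); nra.
have nc : - c <> 0 by lra.
have e x : - (- c * x) = c * x by ring.
have hi := @is_RInt_exponential M (- c) a b nc.
have {}hi : is_RInt (fun x => M * exp (c * x)) a b
    (M / - c * exp (c * a) - M / - c * exp (c * b)).
  by move: hi; rewrite !e; apply: is_RInt_ext => x _; rewrite e.
have h := Cmod_CInt_le ab hf hl hi.
have : 0 <= M / c * exp (c * a).
  apply: Rmult_le_pos; last exact/Rlt_le/exp_pos.
  by apply: Rdiv_le_0_compat.
have e2 : M / - c = - (M / c) by field; lra.
rewrite e2 in h; lra.
Qed.

Lemma symmetric_CInt_tail (f : R -> C) (M c A B : R) :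
  0 < c -> 0 <= A <= B -> (forall x, Ccontinuous f x) ->
  (forall x, Cmod (f x) <= M * exp (- (c * Rabs x))) ->
  Cmod (CInt f (- B) B - CInt f (- A) A)%C <= 2 * (M / c) * exp (- (c * A)).
Proof.
move=> c0 AB cf hf.
have ex u v : u <= v -> ex_CInt f u v by move=> uv; apply: ex_CInt_continuous.
rewrite -(CInt_Chasles (f := f) (a := - B) (b := - A) (c := B)); try by apply: ex; lra.
rewrite -(CInt_Chasles (f := f) (a := - A) (b := A) (c := B)); try by apply: ex; lra.
have -> : (CInt f (Ropp B) (Ropp A) + (CInt f (Ropp A) A + CInt f A B) - CInt f (Ropp A) A =
  CInt f (Ropp B) (Ropp A) + CInt f A B)%C by ring.
apply: Rle_trans (Cmod_triangle _ _) _.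
have lAB : A <= B by lra.
have lnAB : - B <= - A by lra.
have h1 : Cmod (CInt f A B) <= M / c * exp (- (c * A)).
  apply: (Cmod_CInt_exp (f := f) (b := B)) => // [x hx|]; last exact/CInt_correct/ex.
  by have := hf x; rewrite Rabs_pos_eq; lra.
have h2 : Cmod (CInt f (- B) (- A)) <= M / c * exp (c * - A).
  apply: (Cmod_CInt_exp_neg (f := f) (a := - B)) => // [x hx|]; last exact/CInt_correct/ex.
  have := hf x; rewrite Rabs_left1; last lra.
  by have -> : - (c * - x) = c * x by ring.
have e : c * - A = - (c * A) by ring.
rewrite e in h2; lra.
Qed.

Lemma symmetric_CInt_bound (f : R -> C) (M c A : R) (l : C) :
  0 < c -> 0 <= A -> is_CInt f (- A) A l ->
  (forall x, Cmod (f x) <= M * exp (- (c * Rabs x))) -> Cmod l <= 2 * (M / c).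
Proof.
move=> c0 A0 hl hf; have exl : ex_CInt f (- A) A by exists l.
have A01 : - A <= 0 <= A by lra.
have ex1 := @ex_RInt_Chasles_1 C_R_CompleteNormedModule _ _ _ _ A01 exl.
have ex2 := @ex_RInt_Chasles_2 C_R_CompleteNormedModule _ _ _ _ A01 exl.
rewrite -(CInt_unique hl) -(CInt_Chasles ex1 ex2).
apply: Rle_trans (Cmod_triangle _ _) _.
have nA : - A <= 0 by lra.
have h1 : Cmod (CInt f 0 A) <= M / c * exp (- (c * 0)).
  apply: (Cmod_CInt_exp A0 c0 _ (CInt_correct ex2)) => x hx.
  by have := hf x; rewrite Rabs_pos_eq; lra.
have h2 : Cmod (CInt f (- A) 0) <= M / c * exp (c * 0).
  apply: (Cmod_CInt_exp_neg nA c0 _ (CInt_correct ex1)) => x hx.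
  have := hf x; rewrite Rabs_left1; last lra.
  by have -> : - (c * - x) = c * x by ring.
move: h1 h2; rewrite Rmult_0_r Ropp_0 exp_0; lra.
Qed.

(** Fubini's theorem for two improper integrals, by comparison with the doubly
    truncated integral, to which [strip_Fubini] applies. The inner integrals
    [K] and [L], and the truncation [I] of [L], are parameters because they are
    known in closed form where the lemma is used; their continuity is read off
    from these formulas. *)
Lemma strip_Fubini_limit (F : R -> C -> C) (K : R -> C) (I : R -> C -> C)
    (L : C -> C) (a th M c : R) :
  0 <= th -> 0 < c -> 0 <= M ->
  (forall p : R * C,
    @continuous (prod_UniformSpace R_UniformSpace C_UniformSpace) C_UniformSpace
      (fun q => F q.1 q.2) p) ->
  (forall x w, on_strip a th w ->
    Cmod (F x w) <= M * exp (- (c * Rabs x)) * exp (- (c * w.1))) ->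
  (forall x, Ccontinuous K x) -> strip_continuous a th L ->
  (forall x, tends_to (fun b => strip_integral a b th (F x)) (K x)) ->
  (forall A, strip_continuous a th (I A)) ->
  (forall A w, 0 <= A -> on_strip a th w ->
    CInt (fun x => F x w) (- A) A = I A w) ->
  (forall w, on_strip a th w -> tends_to (fun A => I A w) (L w)) ->
  exists S : R, forall A b, 0 <= A -> a <= b ->
    Cmod (CInt K (- A) A - strip_integral a b th L)%C <=
      S * exp (- (c * A)) + S * exp (- (c * b)).
Proof.
move=> th0 c0 M0 cF hF cK cL hK cI hI hL.
have cFx x w : CCcontinuous (F x) w.
  apply: (@continuous_comp_2 _ R_UniformSpace C_UniformSpace C_UniformSpace (fun _ => x) id F).
  - exact: continuous_const.
  - exact: continuous_id.
  - exact: cF.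
have cFw x w : Ccontinuous (fun x => F x w) x.
  apply: (@continuous_comp_2 _ R_UniformSpace C_UniformSpace C_UniformSpace id (fun _ => w) F).
  - exact: continuous_id.
  - exact: continuous_const.
  - exact: cF.
have Ktail x b : a <= b -> Cmod (strip_integral a b th (F x) - K x)%C <=
    2 * (M * exp (- (c * Rabs x)) / c) * exp (- (c * b)).
  move=> ab; have [l hl] := strip_integral_limit th0 c0 (fun w _ => cFx x w) (hF x).
  by rewrite -(tends_to_unique (tends_to_exp_rate c0 hl) (hK x)); exact: hl.
have Ltail w A : on_strip a th w -> 0 <= A ->
    Cmod (L w - I A w)%C <=
    2 * (M * exp (- (c * w.1)) / c) * exp (- (c * A)).
  move=> hw A0; apply: le_epsilon => e e0.
  have [B hB] := hL w hw e e0.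
  have [m1 m2] := (Rmax_l A B, Rmax_r A B).
  have hFw x : Cmod (F x w) <= M * exp (- (c * w.1)) * exp (- (c * Rabs x)).
    by have := hF x w hw; lra.
  have := symmetric_CInt_tail c0 (conj A0 m1) (fun x => cFw x w) hFw.
  have := hB _ m2.
  rewrite !hI //; last lra.
  rewrite Cmod_sub_sym => h1 h2.
  apply: Rle_trans (Cmod_triang3 _ (I (Rmax A B) w) _) _.
  lra.
exists (Rmax (2 * (2 * (M / c) / c)) (2 * (M / c) * (2 / c + 2 * th) * exp (- (c * a)))) => A b A0 ab.
set S := Rmax _ _; have [s1 s2] := (Rmax_l _ _ : _ <= S, Rmax_r _ _ : _ <= S).
have AA : - A <= A by lra.
have fub := strip_Fubini AA ab th0 cF.
have exK : ex_CInt K (- A) A by apply: ex_CInt_continuous.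
have ex1 : ex_CInt (fun x => strip_integral a b th (F x)) (- A) A by eexists; exact: fub.
have e : strip_integral a b th (fun w => CInt (fun x => F x w) (- A) A) =
    strip_integral a b th (I A).
  by apply: strip_integral_ext => // w hw; exact: hI.
rewrite {}e in fub.
have ea : exp (- (c * A)) > 0 := exp_pos _; have eb : exp (- (c * b)) > 0 := exp_pos _.
apply: Rle_trans (Cmod_triang3 _ (strip_integral a b th (I A)) _) _.
rewrite Rplus_comm; apply: Rplus_le_compat.
- rewrite -strip_integral_minus //.
  have bd w : on_strip a th w -> Cmod (I A w - L w)%C <=
      2 * (M / c) * exp (- (c * A)) * exp (- (c * w.1)).
    by move=> hw; rewrite Cmod_sub_sym; have := Ltail w A hw A0; rewrite /Rdiv; lra.
  have cd : strip_continuous a th (fun w => I A w - L w)%C.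
    by move=> w hw; apply: continuous_Cminus; [exact: cI|exact: cL].
  have := strip_integral_bound ab th0 c0 cd bd; nra.
- rewrite -(CInt_unique fub) -CInt_minus //.
  have bd x : Cmod (K x - strip_integral a b th (F x))%C <=
      2 * (M / c) * exp (- (c * b)) * exp (- (c * Rabs x)).
    by rewrite Cmod_sub_sym; have := Ktail x b ab; rewrite /Rdiv; lra.
  have exd := is_CInt_minus (CInt_correct exK) (CInt_correct ex1).
  have := symmetric_CInt_bound c0 A0 exd bd; rewrite -CInt_minus // => h.
  apply: Rle_trans h _.
  have -> : 2 * (2 * (M / c) * exp (- (c * b)) / c) = 2 * (2 * (M / c) / c) * exp (- (c * b)).
    by field; lra.
  nra.
Qed.

(** * The residue at a simple pole *)

Definition on_square (r : R) (w : C) : Prop :=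
  in_rect (- r) r (- r) r w /\ (Rabs w.1 = r \/ Rabs w.2 = r).

Lemma on_square_Cmod (r : R) (w : C) : on_square r w -> r <= Cmod w.
Proof.
move=> [_ h]; apply: Rle_trans (Rmax_Cmod w).
by case: h => <-; [exact: Rmax_l|exact: Rmax_r].
Qed.

Lemma on_square_neq_0 (r : R) (w : C) : 0 < r -> on_square r w -> w <> 0.
Proof. by move=> r0 /on_square_Cmod h e; move: h; rewrite e Cmod_0; lra. Qed.

Lemma rect_integral_split_x (a m b c d : R) (g : C -> C) :
  a <= m <= b ->
  (forall x, a <= x <= b -> CCcontinuous g (x, c) /\ CCcontinuous g (x, d)) ->
  rect_integral a b c d g = (rect_integral a m c d g + rect_integral m b c d g)%C.
Proof.
move=> amb hc; rewrite /rect_integral.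
rewrite -(CInt_Chasles (f := fun x => g (x, c)) (a := a) (b := m) (c := b));
  try by apply: ex_CInt_horizontal; [lra|move=> x hx; apply hc; lra].
rewrite -(CInt_Chasles (f := fun x => g (x, d)) (a := a) (b := m) (c := b));
  try by apply: ex_CInt_horizontal; [lra|move=> x hx; apply hc; lra].
ring.
Qed.

Lemma rect_integral_split_y (a b c m d : R) (g : C -> C) :
  c <= m <= d ->
  (forall y, c <= y <= d -> CCcontinuous g (a, y) /\ CCcontinuous g (b, y)) ->
  rect_integral a b c d g = (rect_integral a b c m g + rect_integral a b m d g)%C.
Proof.
move=> cmd hc; rewrite /rect_integral.
rewrite -(CInt_Chasles (f := fun y => g (a, y)) (a := c) (b := m) (c := d));
  try by apply: ex_CInt_vertical; [lra|move=> x hx; apply hc; lra].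
rewrite -(CInt_Chasles (f := fun y => g (b, y)) (a := c) (b := m) (c := d));
  try by apply: ex_CInt_vertical; [lra|move=> x hx; apply hc; lra].
ring.
Qed.

Lemma ex_CInt_square (r : R) (g : C -> C) :
  0 < r -> (forall w, on_square r w -> CCcontinuous g w) ->
  [/\ ex_CInt (fun x => g (x, - r)) (- r) r, ex_CInt (fun y => g (r, y)) (- r) r,
      ex_CInt (fun x => g (x, r)) (- r) r & ex_CInt (fun y => g (- r, y)) (- r) r].
Proof.
move=> r0 hg; have rr : - r <= r by lra.
have ar : Rabs r = r by rewrite Rabs_pos_eq; lra.
have anr : Rabs (- r) = r by rewrite Rabs_Ropp.
split; [apply: ex_CInt_horizontal|apply: ex_CInt_vertical|apply: ex_CInt_horizontal|
  apply: ex_CInt_vertical] => // x hx; apply: hg; split; rewrite /in_rect /=; try lra; auto.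
Qed.

Lemma rect_integral_minus (r : R) (f g : C -> C) :
  0 < r -> (forall w, on_square r w -> CCcontinuous f w) ->
  (forall w, on_square r w -> CCcontinuous g w) ->
  rect_integral (- r) r (- r) r (fun w => f w - g w)%C =
  (rect_integral (- r) r (- r) r f - rect_integral (- r) r (- r) r g)%C.
Proof.
move=> r0 /(ex_CInt_square r0)[f1 f2 f3 f4] /(ex_CInt_square r0)[g1 g2 g3 g4].
by rewrite /rect_integral !CInt_minus //; ring.
Qed.

Lemma rect_integral_bound (r M : R) (g : C -> C) :
  0 < r -> (forall w, on_square r w -> CCcontinuous g w) ->
  (forall w, on_square r w -> Cmod (g w) <= M) ->
  Cmod (rect_integral (- r) r (- r) r g) <= 8 * r * M.
Proof.
move=> r0 cg hg; have [g1 g2 g3 g4] := ex_CInt_square r0 cg.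
have rr : - r <= r by lra.
have ar : Rabs r = r by rewrite Rabs_pos_eq; lra.
have anr : Rabs (- r) = r by rewrite Rabs_Ropp.
have on1 x : - r <= x <= r -> on_square r (x, - r) by split; rewrite /in_rect /=; try lra; auto.
have on2 x : - r <= x <= r -> on_square r (r, x) by split; rewrite /in_rect /=; try lra; auto.
have on3 x : - r <= x <= r -> on_square r (x, r) by split; rewrite /in_rect /=; try lra; auto.
have on4 x : - r <= x <= r -> on_square r (- r, x) by split; rewrite /in_rect /=; try lra; auto.
have h1 := Cmod_CInt_le_const rr (fun x hx => hg _ (on1 x hx)) (CInt_correct g1).
have h2 := Cmod_CInt_le_const rr (fun x hx => hg _ (on2 x hx)) (CInt_correct g2).
have h3 := Cmod_CInt_le_const rr (fun x hx => hg _ (on3 x hx)) (CInt_correct g3).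
have h4 := Cmod_CInt_le_const rr (fun x hx => hg _ (on4 x hx)) (CInt_correct g4).
rewrite /rect_integral.
apply: Rle_trans (Cmod_triang_sub _ _) _; rewrite Cmod_Ci_mult.
apply: Rle_trans (Rplus_le_compat_r _ _ _ (Cmod_triang_sub _ _)) _.
apply: Rle_trans (Rplus_le_compat_r _ _ _ (Rplus_le_compat_r _ _ _ (Cmod_triangle _ _))) _.
rewrite Cmod_Ci_mult; lra.
Qed.

Lemma is_RInt_atan (r : R) : 0 < r ->
  is_RInt (fun x => 2 * r / (x ^ 2 + r ^ 2)) (- r) r PI.
Proof.
move=> r0.
have -> : PI = minus (2 * atan (r / r)) (2 * atan (- r / r)).
  have -> : r / r = 1 by field; lra.
  have -> : - r / r = - 1 by field; lra.
  rewrite atan_opp atan_1 /minus /plus /opp /=; field.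
apply: (is_RInt_derive (fun x => 2 * atan (x / r))) => x _.
- by auto_derive => //; field; split; nra.
- apply: (@ex_derive_continuous R_AbsRing R_NormedModule); auto_derive; nra.
Qed.

Lemma CCcontinuous_inv (w : C) : w <> 0 -> CCcontinuous (fun w => / w)%C w.
Proof. by move=> h; apply: continuous_Cinv => //; exact: continuous_id. Qed.

Lemma rect_integral_inv (r : R) : 0 < r ->
  rect_integral (- r) r (- r) r Cinv = (2 * PI * Ci)%C.
Proof.
move=> r0.
have [g1 g2 g3 g4] := ex_CInt_square r0 (fun w hw => CCcontinuous_inv (on_square_neq_0 r0 hw)).
have rr : - r <= r by lra.
have atan_int := is_RInt_atan r0.
have H1 : (CInt (fun x => / (x, Ropp r)) (Ropp r) r - CInt (fun x => / (x, r)) (Ropp r) r = Ci * PI)%C.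
  rewrite -CInt_minus //; apply: CInt_unique.
  apply: (is_CInt_ext (f := fun x => Ci * RtoC (2 * r / (x ^ 2 + r ^ 2)))%C) => // [x hx|].
    by apply: injective_projections => /=; field; nra.
  apply: is_CInt_scal; apply/is_CInt_pair; split => //=.
  have := @is_RInt_const R_NormedModule (- r) r 0; congr is_RInt.
  by rewrite /scal /= /mult /=; ring.
have H2 : (CInt (fun y => / (r, y)) (Ropp r) r - CInt (fun y => / (Ropp r, y)) (Ropp r) r = PI)%C.
  rewrite -CInt_minus //; apply: CInt_unique.
  apply: (is_CInt_ext (f := fun x => RtoC (2 * r / (x ^ 2 + r ^ 2)))%C) => // [x hx|].
    by apply: injective_projections => /=; field; nra.
  apply/is_CInt_pair; split => //=.
  have := @is_RInt_const R_NormedModule (- r) r 0; congr is_RInt.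
  by rewrite /scal /= /mult /=; ring.
have -> : rect_integral (- r) r (- r) r Cinv =
  (CInt (fun x => / (x, Ropp r)) (Ropp r) r - CInt (fun x => / (x, r)) (Ropp r) r +
   Ci * (CInt (fun y => / (r, y)) (Ropp r) r - CInt (fun y => / (Ropp r, y)) (Ropp r) r))%C.
  by rewrite /rect_integral; ring.
by rewrite H1 H2; ring.
Qed.

(** The integral over the boundary of the square [[- r, r]^2] does not depend
    on [r], by Cauchy's theorem on the four rectangles between two squares, and
    near [0] the function is close to [l / w]. *)
Lemma residue_square (r : R) (g : C -> C) (l : C) :
  0 < r ->
  holomorphic (fun w => in_rect (- r) r (- r) r w /\ w <> 0) g ->
  (forall e, 0 < e -> exists2 d, 0 < d &
     forall w : C, w <> 0 -> Cmod w < d -> Cmod (w * g w - l)%C <= e) ->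
  rect_integral (- r) r (- r) r g = (2 * PI * Ci * l)%C.
Proof.
move=> r0 hg lim.
have cg w : in_rect (- r) r (- r) r w -> w <> 0 -> CCcontinuous g w.
  by move=> h1 h2; apply: (holomorphic_continuous hg).
have nz1 x y : x <> 0 -> ((x, y) : C) <> 0 by move=> h [].
have nz2 x y : y <> 0 -> ((x, y) : C) <> 0 by move=> h [].
have shrink d : 0 < d <= r -> rect_integral (- r) r (- r) r g = rect_integral (- d) d (- d) d g.
  move=> dr.
  have C0 a b c e : - r <= a <= b -> b <= r -> - r <= c <= e -> e <= r ->
      (0 < a \/ b < 0 \/ 0 < c \/ e < 0) -> rect_integral a b c e g = 0.
    move=> h1 h2 h3 h4 h5; apply: Cauchy_rect; try lra.
    apply: holomorphic_sub hg => w [k1 k2]; split; first by split; lra.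
    by move=> e0; rewrite e0 /= in k1 k2; lra.
  rewrite (@rect_integral_split_x (- r) (- d) r); [|lra|].
    rewrite (@rect_integral_split_x (- d) d r); [|lra|].
      rewrite (@rect_integral_split_y (- d) d (- r) (- d) r); [|lra|].
        rewrite (@rect_integral_split_y (- d) d (- d) d r); [|lra|].
          rewrite !(C0 (- r) (- d)) ?(C0 d r) ?(C0 (- d) d (- r) (- d)) ?(C0 (- d) d d r); try lra.
          ring.
        by move=> y hy; split; apply: cg; [rewrite /in_rect /=; lra|apply: nz1; lra|
          rewrite /in_rect /=; lra|apply: nz1; lra].
      by move=> y hy; split; apply: cg; [rewrite /in_rect /=; lra|apply: nz1; lra|
          rewrite /in_rect /=; lra|apply: nz1; lra].
    by move=> y hy; split; apply: cg; [rewrite /in_rect /=; lra|apply: nz2; lra|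
          rewrite /in_rect /=; lra|apply: nz2; lra].
  by move=> y hy; split; apply: cg; [rewrite /in_rect /=; lra|apply: nz2; lra|
          rewrite /in_rect /=; lra|apply: nz2; lra].
suff h : Cmod (rect_integral (- r) r (- r) r g - 2 * PI * Ci * l)%C <= 0.
  have : (rect_integral (- r) r (- r) r g - 2 * PI * Ci * l)%C = 0.
    by apply: Cmod_eq_0; apply: Rle_antisym => //; exact: Cmod_ge_0.
  set u := rect_integral _ _ _ _ _; set v := (_ * l)%C => e.
  have -> : u = (u - v + v)%C by ring.
  by rewrite e; ring.
apply: le_epsilon => e e0; rewrite Rplus_0_l.
have e8 : 0 < e / 8 by lra.
have [d0 d0p hd] := lim _ e8.
(* A point of the square of half-side d has modulus at most sqrt 2 * d. *)
pose d := Rmin r (d0 / 4).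
have [dm1 dm2] : d <= r /\ d <= d0 / 4 by split; [exact: Rmin_l|exact: Rmin_r].
have dp : 0 < d by apply: Rmin_glb_lt; lra.
rewrite (shrink d) //.
have sq w : on_square d w -> in_rect (- r) r (- r) r w by case=> -[? ?] _; split; lra.
have cd w : on_square d w -> CCcontinuous g w.
  by move=> hw; apply: cg; [exact: sq|exact: on_square_neq_0 hw].
have ci w : on_square d w -> CCcontinuous (fun w => l * / w)%C w.
  move=> hw; apply: continuous_Cmult; first exact: continuous_const.
  apply: CCcontinuous_inv; exact: on_square_neq_0 hw.
have -> : (2 * PI * Ci * l)%C = rect_integral (- d) d (- d) d (fun w => l * / w)%C.
  have [g1 g2 g3 g4] := ex_CInt_square dp (fun w hw => CCcontinuous_inv (on_square_neq_0 dp hw)).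
  rewrite -(rect_integral_inv dp) /rect_integral !CInt_scal //; ring.
rewrite -rect_integral_minus //.
have -> : e = 8 * d * (e / 8 / d) by field; lra.
apply: rect_integral_bound => // w hw.
  by apply: continuous_Cminus; [exact: cd|exact: ci].
have nw := on_square_neq_0 dp hw.
have -> : (g w - l * / w)%C = ((w * g w - l) / w)%C by field.
rewrite Cmod_div //.
have m0 := on_square_Cmod hw.
have h : Cmod (w * g w - l)%C <= e / 8.
  apply: hd => //; apply: Rle_lt_trans (Cmod_2Rmax w) _.
  have : Rmax (Rabs w.1) (Rabs w.2) <= d.
    by case: hw => -[? ?] _; apply: Rmax_lub; apply: Rabs_le.
  have s2 : sqrt 2 < 2.
    by rewrite -[X in _ < X]sqrt_Rsqr; [apply: sqrt_lt_1; rewrite /Rsqr; lra|lra].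
  have := Rmax_l (Rabs w.1) (Rabs w.2); have := Rabs_pos w.1; have := sqrt_pos 2.
  nra.
apply: Rmult_le_compat => //; [exact: Cmod_ge_0|by apply/Rlt_le/Rinv_0_lt_compat; lra|].
by apply: Rinv_le_contravar.
Qed.

(** * Euler's integral *)

Lemma continuous_RtoC (T : UniformSpace) (f : T -> R) (x : T) :
  continuous f x -> @continuous T C_UniformSpace (fun t => RtoC (f t)) x.
Proof. by move=> h; apply: continuous_Cpair => //; exact: continuous_const. Qed.

Lemma is_Cderive_RtoC (f : R -> R) (x l : R) :
  is_derive f x l -> is_Cderive (fun t => RtoC (f t)) x (RtoC l).
Proof. by move=> h; apply: is_Cderive_pair => //; exact: is_derive_const. Qed.

Lemma is_CInt_comp_ln (f : R -> C) (p s t : R) : 0 < p -> 0 < s -> s <= t ->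
  (forall x, s <= x <= t -> Ccontinuous f (ln x / p)) ->
  is_CInt (fun r => Cmult (/ RtoC r)%C (f (ln r / p))) s t (Cmult p (CInt f (ln s / p) (ln t / p))).
Proof.
move=> p0 s0 st cf.
have h : is_CInt (fun r => scal (/ (r * p)) (f (ln r / p) : C_R_NormedModule)) s t
    (CInt f (ln s / p) (ln t / p)).
  apply: (@is_RInt_comp C_R_CompleteNormedModule f (fun r => ln r / p) (fun r => / (r * p)));
    rewrite Rmin_left // Rmax_right // => x hx.
  split; first by auto_derive; [lra|field; lra].
  apply: (@ex_derive_continuous R_AbsRing R_NormedModule); auto_derive; nra.
apply: (is_CInt_ext st _ (@is_CInt_scal p _ _ _ _ h)) => x hx.
by apply: injective_projections; rewrite /scal /= /prod_scal /scal /= /mult /=; field; nra.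
Qed.

Lemma exp_two_sided_decay (c q m : R) : 0 < c <= q -> 0 < m ->
  exists2 K : R, 0 < K &
    forall x, exp (q * x - m * exp x) <= K * exp (- (c * Rabs x)).
Proof.
move=> cq m0; have p0 : 0 < q + c by lra.
have [K K0 hK] := exp_exp_decay m0 p0.
exists (1 + K); first lra.
move=> x; have e0 := exp_pos (- (c * Rabs x)).
case: (Rle_lt_dec 0 x) => hx.
- rewrite Rabs_pos_eq // in e0 *.
  rewrite /Rminus exp_plus.
  have := hK x => h.
  have : exp (q * x) * exp (- (m * exp x)) <= exp (q * x) * (K * exp (- ((q + c) * x))).
    by apply: Rmult_le_compat_l => //; exact/Rlt_le/exp_pos.
  have -> : exp (q * x) * (K * exp (- ((q + c) * x))) = K * exp (- (c * x)).
    have -> : - (c * x) = q * x + - ((q + c) * x) by ring.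
    by rewrite exp_plus; ring.
  lra.
- rewrite Rabs_left // in e0 *.
  have : exp (q * x - m * exp x) <= exp (- (c * - x)).
    by apply: exp_le_compat; have := exp_pos x; nra.
  nra.
Qed.

(** The integrand of [Gamma_Euler nu] after the substitution [t = exp x]. *)
Definition gamma_integrand (nu : C) (x : R) : C := Cexp (nu * x - exp x)%C.

Lemma continuous_gamma_integrand (nu : C) (x : R) :
  Ccontinuous (gamma_integrand nu) x.
Proof.
apply: continuous_Cexp; apply: continuous_Cminus.
- apply: continuous_Cmult; first exact: continuous_const.
  by apply: continuous_RtoC; exact: continuous_id.
- by apply: continuous_RtoC; exact: continuous_exp.
Qed.

Lemma gamma_integrand_bound (nu : C) : 0 < nu.1 ->
  exists c K : R, [/\ 0 < c, 0 < K &
    forall x, Cmod (gamma_integrand nu x) <= K * exp (- (c * Rabs x))].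
Proof.
move=> nu0; have h1 : 0 < 1 by lra.
have [K K0 hK] := exp_two_sided_decay (conj nu0 (Rle_refl _)) h1.
exists nu.1, K; split => // x; rewrite /gamma_integrand Cmod_Cexp.
apply: Rle_trans (hK x); apply: Req_le; congr exp => /=; ring.
Qed.

Lemma gamma_integrand_limit (nu : C) : 0 < nu.1 ->
  exists l : C, exists c S : R, 0 < c /\
    forall u v, u <= 0 -> 0 <= v ->
      Cmod (CInt (gamma_integrand nu) u v - l)%C <= S * exp (c * u) + S * exp (- (c * v)).
Proof.
move=> /gamma_integrand_bound [c [K [c0 K0 hK]]].
set E := gamma_integrand nu in hK *.
have cE x : Ccontinuous E x := @continuous_gamma_integrand nu x.
have [l1 h1] : exists l : C, forall b, 0 <= b ->
    Cmod (CInt E 0 b - l)%C <= K / c * exp (- (c * b)).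
  apply: improper_CInt => // x hx; by have := hK x; rewrite Rabs_pos_eq.
have [l2 h2] : exists l : C, forall b, 0 <= b ->
    Cmod (CInt (fun x => E (Ropp x)) 0 b - l)%C <= K / c * exp (- (c * b)).
  apply: improper_CInt => // x hx; last by have := hK (- x); rewrite Rabs_Ropp Rabs_pos_eq.
  apply: (continuous_comp Ropp E) => //.
  by apply: (continuous_opp (V := R_NormedModule)); exact: continuous_id.
exists (l1 + l2)%C, c, (K / c); split => // u v u0 v0.
have ex a b : a <= b -> ex_CInt E a b by move=> ab; exact: ex_CInt_continuous.
rewrite -(CInt_Chasles (ex _ _ u0) (ex _ _ v0)).
have -> : CInt E u 0 = CInt (fun x => E (- x)) 0 (- u).
  have := @is_RInt_comp_opp C_R_NormedModule E (- u) 0 (CInt E u 0).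
  rewrite Ropp_involutive Ropp_0 => h; have {}h := h (CInt_correct (ex _ _ u0)).
  have {}h := @is_RInt_swap C_R_NormedModule _ _ _ _ h.
  have {}h := @is_RInt_opp C_R_NormedModule _ _ _ _ h.
  apply/esym/CInt_unique.
  rewrite -(opp_opp (CInt E u 0 : C_R_NormedModule)).
  move: h; apply: is_RInt_ext => x _; exact: opp_opp.
have u1 : 0 <= - u by lra.
have -> : (CInt (fun x => E (Ropp x)) 0 (Ropp u) + CInt E 0 v - (l1 + l2) =
  (CInt (fun x => E (Ropp x)) 0 (Ropp u) - l2) + (CInt E 0 v - l1))%C by ring.
apply: Rle_trans (Cmod_triangle _ _) _.
have := h1 v v0; have := h2 _ u1.
have -> : - (c * - u) = c * u by ring.
lra.
Qed.

(** The substitution [t = e^x] sends the two ends [0] and infinity of Euler's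
    integral to the two ends of the real line, where the integrand has
    exponential decay. *)
Lemma Gamma_Euler_limit (nu : C) : 0 < nu.1 ->
  tends_to (fun A => CInt (gamma_integrand nu) (- A) A) (Gamma_Euler nu).
Proof.
move=> nu0; have [l [c [S [c0 hS]]]] := gamma_integrand_limit nu0.
suff -> : Gamma_Euler nu = l.
  apply: (tends_to_exp_rate (K := 2 * S) (c := c) (a := 0)) => // b b0.
  have nb : - b <= 0 by lra.
  have := hS _ _ nb b0; have -> : c * - b = - (c * b) by ring.
  lra.
have pf1 : ProperFilter' (at_right 0) by apply: Proper_StrongProper; exact: at_right_proper_filter.
have pf2 : ProperFilter' (Rbar_locally p_infty) by apply: Proper_StrongProper; exact: Rbar_locally_filter.
apply: (@is_RInt_gen_unique C_R_CompleteNormedModule (at_right 0) (Rbar_locally p_infty)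
  pf1 pf2 (fun t => polar_pow t 0 (nu - 1)%C * exp (- t))%C l).
apply/(@filterlimi_locally _ C_R_NormedModule) => e.
have e2 : 0 < e / 2 by have := cond_pos e; lra.
have [B hB] := exp_small S c0 e2.
have [m0 m1] := (Rmax_l 0 B, Rmax_r 0 B).
have smin : 0 < exp (- Rmax 0 B) := exp_pos _.
apply: (Filter_prod _ _ _ (fun s => 0 < s < exp (- Rmax 0 B)) (fun t => exp (Rmax 0 B) < t)).
- exists (mkposreal _ smin) => s hs s0; split => //.
  move: hs; rewrite /ball /= /AbsRing_ball /abs /= /minus /plus /opp /=.
  by move=> /Rabs_def2; lra.
- by exists (exp (Rmax 0 B)).
move=> s t [s0 hs] ht.
have t0 : 0 < t by have := exp_pos (Rmax 0 B); lra.
have ls : ln s < - Rmax 0 B by rewrite -[X in _ < X]ln_exp; exact: ln_increasing.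
have lt : Rmax 0 B < ln t by rewrite -[X in X < _]ln_exp; apply: ln_increasing => //; exact: exp_pos.
have st : s <= t.
  by left; apply: ln_lt_inv => //; lra.
exists (CInt (gamma_integrand nu) (ln s) (ln t)); split.
- have := is_CInt_comp_ln Rlt_0_1 s0 st (fun x _ => @continuous_gamma_integrand nu (ln x / 1)).
  rewrite !Rdiv_1_r Cmult_1_l; apply: (is_CInt_ext st) => x hx; rewrite Rdiv_1_r.
  have x0 : 0 < x by lra.
  have -> : (/ RtoC x)%C = Cexp (- ln x)%C.
    by rewrite Cexp_opp Cexp_RtoC exp_ln.
  rewrite /gamma_integrand /polar_pow exp_ln // -Cexp_RtoC -!Cexp_plus; congr Cexp.
  by apply: injective_projections => /=; ring.
- apply: (@norm_compat1 R_AbsRing C_R_NormedModule); rewrite -Cmod_norm.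
  have ls0 : ln s <= 0 by lra.
  have lt0 : 0 <= ln t by lra.
  have := hS _ _ ls0 lt0 => h; apply: Rle_lt_trans h _.
  have b1 : B <= - ln s by lra.
  have b2 : B <= ln t by lra.
  have := hB _ b1; have := hB _ b2.
  have -> : - (c * - ln s) = c * ln s by ring.
  lra.
Qed.

(** * Hankel's formula *)

Definition hankel_integrand (nu w : C) : C :=
  (Cexp (Cexp w) * Cexp ((1 - nu) * w))%C.

Lemma Cmod_Cexp_Cexp (w : C) : Cmod (Cexp (Cexp w)) = exp (exp w.1 * cos w.2).
Proof. by rewrite Cmod_Cexp. Qed.

Lemma Rmult_le_Rabs (x y t : R) : - t <= y <= t -> x * y <= Rabs x * t.
Proof.
move=> h; apply: Rle_trans (Rle_abs _) _; rewrite Rabs_mult.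
apply: Rmult_le_compat_l; first exact: Rabs_pos.
exact: Rabs_le.
Qed.

Lemma on_strip_Im (a th : R) (w : C) : 0 <= th -> on_strip a th w -> - th <= w.2 <= th.
Proof. by move=> th0; rewrite /on_strip; lra. Qed.

Lemma on_strip_Re (a th : R) (w : C) : on_strip a th w -> a <= w.1.
Proof. by rewrite /on_strip; lra. Qed.

(** The bound on the vertical side is a matter of compactness; on the rays it
    comes from [|exp (e^w)| = exp (e^(Re w) cos th)] and [cos th < 0]. *)
Lemma strip_Cexp_decay (a th : R) (la : C) : 0 <= th -> cos th < 0 ->
  exists2 M : R, 0 <= M & forall w, on_strip a th w ->
    Cmod (Cexp (Cexp w) * Cexp (la * w))%C <= M * exp (- (1 * w.1)).
Proof.
move=> th0 cth.
have k0 : 0 < - cos th by lra.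
have p0 : 0 < Rabs la.1 + 1 by have := Rabs_pos la.1; lra.
have [K K0 hK] := exp_exp_decay k0 p0.
pose q := Rabs la.1 - la.1; have q0 : 0 <= q by rewrite /q; have := Rle_abs la.1; lra.
pose M1 := exp (exp a + la.1 * a + Rabs la.2 * th + a).
pose M2 := K * exp (- (q * a) + Rabs la.2 * th).
have M10 : 0 < M1 := exp_pos _.
have M20 : 0 < M2 by apply: Rmult_lt_0_compat => //; exact: exp_pos.
exists (M1 + M2); first lra.
move=> w hw; rewrite Cmod_mult Cmod_Cexp_Cexp Cmod_Cexp.
have ew := exp_pos (- (1 * w.1)).
have i2 : - la.2 * w.2 <= Rabs la.2 * th.
  by rewrite -(Rabs_Ropp la.2); apply: Rmult_le_Rabs; exact: on_strip_Im hw.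
have -> : (la * w)%C.1 = la.1 * w.1 + - la.2 * w.2 by rewrite /=; ring.
case: hw => [[e1 _]|[e1 e2]].
- have h : exp (exp w.1 * cos w.2) * exp (la.1 * w.1 + - la.2 * w.2) <= M1 * exp (- (1 * w.1)).
    rewrite -!exp_plus; apply: exp_le_compat.
    have := COS_bound w.2; have := exp_pos w.1; rewrite e1 in i2 *; nra.
  nra.
- have ec : cos w.2 = cos th by case: e2 => ->; rewrite ?cos_neg.
  have h := hK w.1.
  have h2 : exp (la.1 * w.1 + - la.2 * w.2) <= exp (la.1 * w.1 + Rabs la.2 * th).
    by apply: exp_le_compat; lra.
  have h3 : exp (exp w.1 * cos w.2) * exp (la.1 * w.1 + - la.2 * w.2) <=
     K * exp (- ((Rabs la.1 + 1) * w.1)) * exp (la.1 * w.1 + Rabs la.2 * th).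
    apply: Rmult_le_compat => //; try exact/Rlt_le/exp_pos.
    by rewrite ec; have -> : exp w.1 * cos th = - (- cos th * exp w.1) by ring.
  have h4 : exp (- ((Rabs la.1 + 1) * w.1)) * exp (la.1 * w.1 + Rabs la.2 * th) <=
     exp (- (q * a) + Rabs la.2 * th) * exp (- (1 * w.1)).
    rewrite -!exp_plus; apply: exp_le_compat; rewrite /q in q0 *; nra.
  have : M2 * exp (- (1 * w.1)) >= K * exp (- ((Rabs la.1 + 1) * w.1)) * exp (la.1 * w.1 + Rabs la.2 * th).
    rewrite /M2; nra.
  nra.
Qed.

Lemma holomorphic_linear_Cexp (A : C -> Prop) (la : C) :
  holomorphic A (fun w => Cexp (la * w)%C).
Proof. by apply/holomorphic_Cexp/holomorphic_scal/holomorphic_id. Qed.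

Lemma holomorphic_hankel_integrand (A : C -> Prop) (nu : C) :
  holomorphic A (hankel_integrand nu).
Proof.
apply: holomorphic_mult; last exact: holomorphic_linear_Cexp.
by apply/holomorphic_Cexp/holomorphic_Cexp/holomorphic_id.
Qed.

Lemma continuous_hankel_integrand (nu w : C) : CCcontinuous (hankel_integrand nu) w.
Proof. by apply: (@holomorphic_continuous (fun _ => True)) => //; exact: holomorphic_hankel_integrand. Qed.

(** The limit does not depend on the abscissa [a] of the vertical side;
    quantifying over [a] makes translations of the contour available. *)
Definition hankel_limit (th : R) (nu l : C) : Prop :=
  forall a, tends_to (fun b => strip_integral a b th (hankel_integrand nu)) l.

Lemma hankel_limit_exists (th : R) (nu : C) :
  0 <= th -> cos th < 0 -> exists l, hankel_limit th nu l.
Proof.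
move=> th0 cth.
have [M M0 hM] := strip_Cexp_decay 0 (1 - nu)%C th0 cth.
have [l hl] := strip_integral_limit th0 Rlt_0_1 (fun w _ => @continuous_hankel_integrand nu w) hM.
exists l => a.
have {}hl := tends_to_exp_rate Rlt_0_1 hl.
have shift u v : u <= v -> forall b, v <= b ->
    strip_integral u b th (hankel_integrand nu) = strip_integral v b th (hankel_integrand nu).
  move=> uv b vb; apply: strip_integral_shift => //; try lra.
  - exact: holomorphic_hankel_integrand.
  - by move=> x _; split; exact: continuous_hankel_integrand.
case: (Rle_lt_dec a 0) => ha.
- by apply: (tends_to_ext (a := 0)) hl => b hb; rewrite (shift a 0).
- by apply: (tends_to_ext (a := a)) hl => b hb; rewrite (shift 0 a) //; lra.
Qed.

Lemma strip_integral_derivative (a b th : R) (g D : C -> C) :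
  a <= b -> 0 <= th ->
  (forall w, is_complex_derivative g w (D w)) -> (forall w, CCcontinuous D w) ->
  strip_integral a b th D = (g (b, th) - g (b, Ropp th))%C.
Proof.
move=> ab th0 hD cD; have tt : - th <= th by lra.
have I1 y : CInt (fun x => D (x, y)) a b = (g (b, y) - g (a, y))%C.
  apply: CInt_unique; apply: (is_CInt_Cderive (f := fun x => g (x, y))) => // x hx.
  - have := hD (x, y) (fun x => (x, y)) x (1, 0) erefl.
    have -> : ((1, 0) * D (x, y) = D (x, y))%C.
      by apply: injective_projections => /=; ring.
    by apply; apply: is_Cderive_pair; [exact: is_derive_id|exact: is_derive_const].
  - exact: continuous_horizontal.
have I2 : (Ci * CInt (fun y => D (a, y)) (Ropp th) th)%C = (g (a, th) - g (a, Ropp th))%C.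
  rewrite -CInt_scal; last by apply: ex_CInt_vertical.
  apply: CInt_unique; apply: (is_CInt_Cderive (f := fun y => g (a, y))) => // y hy.
  - have := hD (a, y) (fun y => (a, y)) y Ci erefl.
    by apply; apply: is_Cderive_pair; [exact: is_derive_const|exact: is_derive_id].
  - apply: continuous_Cmult; first exact: continuous_const.
    exact: continuous_vertical.
by rewrite /strip_integral !I1 I2; ring.
Qed.

(** Integration by parts, in the form that the derivative of
    [exp (e^w) e^(- nu w)] has no integral over the contour. *)
Lemma hankel_limit_rec (th : R) (nu l m : C) :
  0 <= th -> cos th < 0 ->
  hankel_limit th nu l -> hankel_limit th (nu + 1)%C m -> l = (nu * m)%C.
Proof.
move=> th0 cth hl hm.
pose g w := (Cexp (Cexp w) * Cexp (- nu * w))%C.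
pose D w := (hankel_integrand nu w + (- nu) * hankel_integrand (nu + 1) w)%C.
have gD w : is_complex_derivative g w (D w).
  move=> gamma t v e hg.
  have h1 := is_Cderive_Cexp (is_Cderive_Cexp hg).
  have h2 : is_Cderive (fun t => (- nu * gamma t)%C) t (0 * gamma t + - nu * v)%C.
    by apply: is_Cderive_mult => //; exact: (@is_derive_const R_AbsRing C_R_NormedModule).
  have h := is_Cderive_mult h1 (is_Cderive_Cexp h2).
  have -> : (v * D w = v * Cexp (gamma t) * Cexp (Cexp (gamma t)) * Cexp (- nu * gamma t) +
    Cexp (Cexp (gamma t)) * ((0 * gamma t + - nu * v) * Cexp (- nu * gamma t)))%C.
    rewrite /D /hankel_integrand e.
    have -> : ((1 - nu) * w = w + - nu * w)%C by ring.
    have -> : ((1 - (nu + 1)) * w = - nu * w)%C by ring.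
    by rewrite Cexp_plus; ring.
  exact: h.
have cont nu' w := @continuous_hankel_integrand nu' w.
have cD w : CCcontinuous D w.
  apply: continuous_Cplus => //; apply: continuous_Cmult => //; exact: continuous_const.
have lim1 := tends_to_plus (hl 0) (tends_to_scal (- nu) (hm 0)).
suff lim2 : tends_to (fun b => strip_integral 0 b th (hankel_integrand nu) +
    - nu * strip_integral 0 b th (hankel_integrand (nu + 1)))%C 0.
  have e := tends_to_unique lim1 lim2.
  have -> : l = (l + - nu * m + nu * m)%C by ring.
  by rewrite e; ring.
have [M M0 hM] := strip_Cexp_decay 0 (- nu)%C th0 cth.
apply: (tends_to_exp_rate (K := 2 * M) (c := 1) (a := 0)); first lra.
move=> b b0.
rewrite -strip_integral_scal // -strip_integral_plus //; last first.
  by move=> w _; apply: continuous_Cmult => //; exact: continuous_const.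
rewrite (strip_integral_derivative b0 th0 gD cD).
have -> : (g (b, th) - g (b, Ropp th) - 0 = g (b, th) - g (b, Ropp th))%C by ring.
apply: Rle_trans (Cmod_triang_sub _ _) _.
have := hM _ (on_strip_top th b0); have := hM _ (on_strip_bot th b0).
rewrite /g /=; lra.
Qed.

Lemma Cexp_eq_1 (w : C) : Rabs w.2 <= PI -> Cexp w = 1 -> w = 0.
Proof.
move=> hw e.
have e1 : w.1 = 0.
  apply: exp_inv; rewrite exp_0 -Cmod_Cexp e; exact: Cmod_1.
have e2 : cos w.2 = 1.
  have := f_equal fst e; rewrite /Cexp /Re /Im /= e1 exp_0; lra.
suff e3 : w.2 = 0 by apply: injective_projections.
have e4 : cos (Rabs w.2) = 1.
  by rewrite /Rabs; case: Rcase_abs => _; rewrite ?cos_neg.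
case: (Req_dec w.2 0) => // nz; have p := Rabs_pos_lt _ nz.
have := cos_decreasing_1 0 (Rabs w.2); rewrite e4 cos_0; have := PI_RGT_0; lra.
Qed.

Lemma continuous_Cexp_id (w : C) : CCcontinuous Cexp w.
Proof. by apply: continuous_Cexp; exact: continuous_id. Qed.

(** [e^w - 1 - w] is [w] times the integral of [e^(t w) - 1] over [[0, 1]]. *)
Lemma Cexp_expansion (e : R) : 0 < e ->
  exists2 d, 0 < d & forall w : C, Cmod w < d -> Cmod (Cexp w - 1 - w)%C <= e * Cmod w.
Proof.
move=> e0; have [d d0 hd] := CCcontinuous_Cmod (@continuous_Cexp_id 0) e0.
exists d => // w hw.
have h01 : 0 <= 1 by lra.
have cf x : is_Cderive (fun t => RtoC t * w)%C x w.
  have := is_Cderive_mult (is_Cderive_RtoC (is_derive_id x)) (@is_derive_const R_AbsRing C_R_NormedModule w x).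
  have -> // : (RtoC one * w + RtoC x * zero)%C = w.
  by apply: injective_projections; rewrite /zero /one /=; ring.
have h : is_CInt (fun t => w * (Cexp (RtoC t * w) - 1))%C 0 1
    ((Cexp (RtoC 1 * w) - RtoC 1 * w) - (Cexp (RtoC 0 * w) - RtoC 0 * w))%C.
  apply: (is_CInt_Cderive (f := fun t => Cexp (RtoC t * w) - RtoC t * w)%C) => // x hx.
  - have -> : (w * (Cexp (RtoC x * w) - 1) = w * Cexp (RtoC x * w) + - w)%C by ring.
    apply: is_Cderive_plus; first exact: is_Cderive_Cexp.
    exact: is_Cderive_opp.
  - apply: continuous_Cmult; first exact: continuous_const.
    apply: continuous_Cminus; last exact: continuous_const.
    apply: continuous_Cexp; exact: continuous_Cderive (cf x).
have bd := Cmod_CInt_le_const (M := e * Cmod w) h01 _ h.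
have -> : (Cexp w - 1 - w = (Cexp (RtoC 1 * w) - RtoC 1 * w) - (Cexp (RtoC 0 * w) - RtoC 0 * w))%C.
  by rewrite Cmult_0_l Cexp_0 Cmult_1_l; ring.
apply: Rle_trans (bd _) _ => [x hx|]; last lra.
rewrite Cmod_mult Rmult_comm; apply: Rmult_le_compat_r; first exact: Cmod_ge_0.
have := hd (RtoC x * w)%C; rewrite Cexp_0 => h2; apply/Rlt_le/h2.
have -> : (RtoC x * w - 0 = RtoC x * w)%C by ring.
rewrite Cmod_mult Cmod_R Rabs_pos_eq; last lra.
have := Cmod_ge_0 w; nra.
Qed.

(** The integral of [e^(- u) e^(u s) s^(- nu)] over [u > 0] is
    [s^(- nu) / (1 - s)]; here [s = e^w] and [ds = e^w dw]. *)
Definition hankel_kernel (nu w : C) : C := (Cexp ((1 - nu) * w) / (1 - Cexp w))%C.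

Lemma hankel_kernel_residue (nu : C) (e : R) : 0 < e ->
  exists2 d, 0 < d & forall w : C, w <> 0 -> Cmod w < d ->
    Cmod (w * hankel_kernel nu w - RtoC (-1))%C <= e.
Proof.
move=> e0; pose e1 := Rmin (e / 4) (/ 2).
have e1p : 0 < e1 by apply: Rmin_glb_lt; lra.
have [m1 m2] : e1 <= e / 4 /\ e1 <= / 2 by split; [exact: Rmin_l|exact: Rmin_r].
have [d1 d1p h1] := Cexp_expansion e1p.
have cl : CCcontinuous (fun w => Cexp ((1 - nu) * w)%C) (RtoC 0).
  by apply: (@holomorphic_continuous (fun _ => True)) => //; exact: holomorphic_linear_Cexp.
have [d2 d2p h2] := CCcontinuous_Cmod cl e1p.
exists (Rmin d1 d2); first exact: Rmin_glb_lt.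
move=> w nw hw.
have w1 : Cmod w < d1 by apply: Rlt_le_trans hw _; exact: Rmin_l.
have w2 : Cmod w < d2 by apply: Rlt_le_trans hw _; exact: Rmin_r.
have w0 : 0 < Cmod w by apply Cmod_gt_0.
have {}h1 := h1 w w1.
have {}h2 : Cmod (Cexp ((1 - nu) * w) - 1)%C < e1.
  have := h2 w; rewrite Cmult_0_r Cexp_0; apply.
  by have -> : (w - 0)%C = w by ring.
have big : Cmod w / 2 <= Cmod (Cexp w - 1)%C.
  have := Cmod_triang3 w (w - (Cexp w - 1))%C 0.
  have -> : (w - (w - (Cexp w - 1)) = Cexp w - 1)%C by ring.
  have -> : (w - (Cexp w - 1) - 0 = - (Cexp w - 1 - w))%C by ring.
  have -> : (w - 0)%C = w by ring.
  rewrite Cmod_opp; nra.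
have nz : (Cexp w - 1)%C <> 0 by move=> h; rewrite h Cmod_0 in big; lra.
have -> : (w * hankel_kernel nu w - RtoC (-1) =
  ((Cexp w - 1 - w) - w * (Cexp ((1 - nu) * w) - 1)) / (Cexp w - 1))%C.
  rewrite /hankel_kernel (RtoC_opp 1); field; split => // h; apply: nz.
  have -> : (Cexp w - 1 = - (1 - Cexp w))%C by ring.
  by rewrite h; ring.
rewrite Cmod_div //; apply/Rle_div_l; first by lra.
apply: Rle_trans (Cmod_triang_sub _ _) _; rewrite Cmod_mult.
have := Cmod_ge_0 (Cexp ((1 - nu) * w) - 1)%C; nra.
Qed.

Lemma cos_neg_angle (th : R) : PI / 2 < th <= PI -> 0 < th /\ cos th < 0.
Proof. by move=> h; have := PI_RGT_0; split; [|apply: cos_lt_0]; lra. Qed.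

Lemma hankel_kernel_denominator (w : C) : Rabs w.2 <= PI -> w <> 0 -> (1 - Cexp w)%C <> 0.
Proof.
move=> h1 h2 h3; apply: h2; apply: Cexp_eq_1 => //.
have -> : Cexp w = (1 - (1 - Cexp w))%C by ring.
by rewrite h3; ring.
Qed.

Lemma holomorphic_hankel_kernel (A : C -> Prop) (nu : C) :
  (forall w, A w -> Rabs w.2 <= PI /\ w <> 0) -> holomorphic A (hankel_kernel nu).
Proof.
move=> hA; apply: holomorphic_mult; first exact: holomorphic_linear_Cexp.
apply: holomorphic_inv => [w /hA[]|]; first exact: hankel_kernel_denominator.
apply: holomorphic_minus; first exact: holomorphic_const.
by apply: holomorphic_Cexp; exact: holomorphic_id.
Qed.

(** Beyond the pole at [0] the contour can be pushed to the right, where the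
    kernel is small. *)
Lemma hankel_kernel_limit (th : R) (nu : C) :
  PI / 2 < th <= PI -> 0 < nu.1 ->
  tends_to (fun b => strip_integral (- th) b th (hankel_kernel nu)) (2 * PI * Ci)%C.
Proof.
move=> hth hnu; have [th0 cth] := cos_neg_angle hth; set L := hankel_kernel nu.
pose M := 2 * exp (Rabs nu.2 * th).
have side b y : 1 <= b -> - th <= y <= th -> Cmod (L (b, y)) <= M * exp (- (nu.1 * b)).
  move=> b1 hy; rewrite /L /hankel_kernel Cmod_div; last first.
    apply: hankel_kernel_denominator => /= [|[]]; [apply: Rabs_le|]; lra.
  have eb : 2 <= exp b by have := exp_ineq1_le b; lra.
  have den : exp b / 2 <= Cmod (1 - Cexp (b, y))%C.
    have := Cmod_triang3 (Cexp (b, y)) 1 0.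
    have -> : (Cexp (b, y) - 0)%C = Cexp (b, y) by ring.
    have -> : (1 - 0)%C = 1 by ring.
    rewrite Cmod_Cexp Cmod_1 /= Cmod_sub_sym; lra.
  apply/Rle_div_l; first lra.
  rewrite Cmod_Cexp /=.
  have h : exp ((1 + - nu.1) * b - (0 + - nu.2) * y) <= exp (Rabs nu.2 * th) * (exp (- (nu.1 * b)) * exp b).
    rewrite -!exp_plus; apply: exp_le_compat.
    have := Rmult_le_Rabs nu.2 hy; lra.
  apply: Rle_trans h _.
  have p1 := exp_pos (Rabs nu.2 * th); have p2 := exp_pos (- (nu.1 * b)).
  rewrite /M.
  have -> : exp (Rabs nu.2 * th) * (exp (- (nu.1 * b)) * exp b) =
    2 * exp (Rabs nu.2 * th) * exp (- (nu.1 * b)) * (exp b / 2) by field.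
  by apply: Rmult_le_compat_l => //; nra.
have ctop x y : - th <= y <= th -> ((x, y) : C) <> 0 -> CCcontinuous L (x, y).
  move=> hy nz; apply: (@holomorphic_continuous (fun w => Rabs w.2 <= PI /\ w <> 0)).
    exact: holomorphic_hankel_kernel.
  by split => //=; apply: Rabs_le; lra.
have nz2 x y : y <> 0 -> ((x, y) : C) <> 0 by move=> h [].
have nz1 x y : x <> 0 -> ((x, y) : C) <> 0 by move=> h [].
have rays x : CCcontinuous L (x, th) /\ CCcontinuous L (x, - th).
  by split; apply: ctop; try apply: nz2; lra.
have tt : - th <= th by lra.
apply: (tends_to_exp_rate (K := (th - - th) * M) (c := nu.1) (a := Rmax 1 th)) => // b hb.
have [b1 bt] : 1 <= b /\ th <= b.
  by split; apply: Rle_trans hb; [exact: Rmax_l|exact: Rmax_r].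
have tb : - th <= th <= b by lra.
have bb : th <= b <= b by lra.
rewrite (strip_integral_rect tb (fun x _ => rays x)).
rewrite (@residue_square th L (RtoC (-1))) //; first last.
- exact: hankel_kernel_residue.
- apply: holomorphic_hankel_kernel => w [[_ hw] nw]; split => //.
  by apply: Rabs_le; lra.
rewrite (strip_integral_shift bb (Rlt_le _ _ th0) _ (fun x _ => rays x)); last first.
  apply: holomorphic_hankel_kernel => w [hw1 hw2]; split; first by apply: Rabs_le; lra.
  by move=> e; rewrite e /= in hw1; lra.
have pt (f : R -> C) : CInt f b b = RtoC 0 by exact: RInt_point.
rewrite /strip_integral !pt.
have exI : ex_CInt (fun y => L (b, y)) (- th) th.
  by apply: ex_CInt_vertical => // y hy; apply: ctop => //; apply: nz1; lra.
have -> : (- 0 + Ci * CInt (fun y => L (b, y)) (Ropp th) th + 0 - 2 * PI * Ci * RtoC (-1) - 2 * PI * Ci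
   = Ci * CInt (fun y => L (b, y)) (Ropp th) th)%C by rewrite (RtoC_opp 1); ring.
rewrite Cmod_Ci_mult Rmult_assoc.
apply: (Cmod_CInt_le_const tt _ (CInt_correct exI)) => y hy; exact: side.
Qed.

(** This is [e^(- u) e^(u s) s^(- nu)] for [u = e^x] and [s = e^w], with the
    factors [u] and [s] of [du ds = u s dx dw]. *)
Definition hankel_gamma_integrand (nu : C) (x : R) (w : C) : C :=
  Cexp (RtoC x - RtoC (exp x) * (1 - Cexp w) + (1 - nu) * w)%C.

Lemma continuous_hankel_gamma_integrand (nu : C) (p : R * C) :
  @continuous (prod_UniformSpace R_UniformSpace C_UniformSpace) C_UniformSpace
    (fun q => hankel_gamma_integrand nu q.1 q.2) p.
Proof.
case: p => x w; apply: continuous_Cexp.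
have c1 : @continuous (prod_UniformSpace R_UniformSpace C_UniformSpace) _ (fun q => q.1) (x, w).
  exact: continuous_fst.
have c2 : @continuous (prod_UniformSpace R_UniformSpace C_UniformSpace) C_UniformSpace (fun q => q.2) (x, w).
  exact: continuous_snd.
apply: continuous_Cplus; last by apply: continuous_Cmult => //; exact: continuous_const.
apply: continuous_Cminus; first exact: continuous_RtoC.
apply: continuous_Cmult.
  by apply: continuous_RtoC; apply: (continuous_comp _ exp) => //; exact: continuous_exp.
by apply: continuous_Cminus; [exact: continuous_const|exact: continuous_Cexp].
Qed.

Lemma Re_Cexp_strip (th : R) (w : C) :
  PI / 2 < th <= PI -> on_strip (- th) th w -> (Cexp w).1 < 1.
Proof.
move=> /cos_neg_angle[th0 cth].
rewrite /Cexp /Re /Im /= => -[[e1 _]|[_ e2]].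
- have := COS_bound w.2; have := exp_pos w.1; rewrite e1.
  have : exp (- th) < exp 0 by apply: exp_increasing; lra.
  rewrite exp_0; nra.
- have -> : cos w.2 = cos th by case: e2 => ->; rewrite ?cos_neg.
  have := exp_pos w.1; nra.
Qed.

(** On the rays [e^(u s)] has modulus [exp (- k e^(x + Re w))], with
    [k = - cos th]. Estimated by [e^(- (1 - c) (x + Re w))], it leaves [e^(c x)], which is small
    for [x] near minus infinity, and turns [e^((1 - Re nu) Re w)] into
    [e^((c - Re nu) Re w)]; the choice of [c] makes this at most a multiple of
    [e^(- c Re w)]. *)
Lemma hankel_gamma_integrand_bound (th : R) (nu : C) :
  PI / 2 < th <= PI -> 0 < nu.1 ->
  exists c M : R, [/\ 0 < c, 0 <= M & forall x w, on_strip (- th) th w ->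
    Cmod (hankel_gamma_integrand nu x w) <=
      M * exp (- (c * Rabs x)) * exp (- (c * w.1))].
Proof.
move=> hth s0; have [th0 cth] := cos_neg_angle hth.
pose c := Rmin nu.1 1 / 2; pose B := Rabs nu.2 * th.
have [c1 c2 c3] : [/\ 0 < c, c <= 1 / 2 & 2 * c <= nu.1].
  rewrite /c; have := Rmin_l nu.1 1; have := Rmin_r nu.1 1.
  by have := Rmin_glb_lt nu.1 1 0 s0 Rlt_0_1; split; lra.
have mp : 0 < 1 - exp (- th).
  by have : exp (- th) < exp 0; [apply: exp_increasing; lra|rewrite exp_0; lra].
have q1 : 0 < c <= 1 by lra.
have [K1 K1p h1] := exp_two_sided_decay q1 mp.
have kp : 0 < - cos th by lra.
have pp : 0 < 1 - c by lra.
have [K2 K2p h2] := exp_exp_decay kp pp.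
have [K3 K3p h3] := exp_two_sided_decay (conj c1 (Rle_refl c)) Rlt_0_1.
pose M1 := K1 * exp ((nu.1 - 1) * th + B).
pose M2 := K2 * K3 * exp (B + (nu.1 - 2 * c) * th).
have M1p : 0 < M1 by apply: Rmult_lt_0_compat => //; exact: exp_pos.
have M2p : 0 < M2 by apply: Rmult_lt_0_compat; [nra|exact: exp_pos].
exists c, (M1 + M2); split; [lra|lra|] => x w hw.
rewrite /hankel_gamma_integrand Cmod_Cexp.
have hB : nu.2 * w.2 <= B by apply: Rmult_le_Rabs; apply: on_strip_Im hw; lra.
have -> : (RtoC x - RtoC (exp x) * (1 - Cexp w) + (1 - nu) * w)%C.1 =
  x - exp x * (1 - exp w.1 * cos w.2) + (1 - nu.1) * w.1 + nu.2 * w.2.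
  by rewrite /Cexp /Re /Im /=; ring.
have ex := exp_pos x; have ew := exp_pos w.1.
have p1 := exp_pos (- (c * Rabs x)); have p2 := exp_pos (- (c * w.1)).
case: hw => [[e1 _]|[e1 e2]].
- have g1 : exp (x - exp x * (1 - exp w.1 * cos w.2) + (1 - nu.1) * w.1 + nu.2 * w.2) <=
    exp (1 * x - (1 - exp (- th)) * exp x) * exp ((nu.1 - 1) * th + B).
    rewrite -exp_plus; apply: exp_le_compat; rewrite e1 in ew *.
    have hc := COS_bound w.2.
    have : 0 <= exp x * exp (- th) * (1 - cos w.2).
      by apply: Rmult_le_pos; [exact/Rlt_le/Rmult_lt_0_compat|lra].
    lra.
  have g2 : 1 <= exp (- (c * w.1)).
    by rewrite -exp_0; apply: exp_le_compat; rewrite e1; nra.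
  have g3 : exp (1 * x - (1 - exp (- th)) * exp x) * exp ((nu.1 - 1) * th + B) <=
      M1 * exp (- (c * Rabs x)).
    rewrite /M1; have := h1 x; have := exp_pos ((nu.1 - 1) * th + B); nra.
  have g4 : 0 < M1 * exp (- (c * Rabs x)) by exact: Rmult_lt_0_compat.
  have g5 : 0 < M2 * exp (- (c * Rabs x)) by exact: Rmult_lt_0_compat.
  nra.
- have ec : cos w.2 = cos th by case: e2 => ->; rewrite ?cos_neg.
  have g1 : exp (x - exp x * (1 - exp w.1 * cos w.2) + (1 - nu.1) * w.1 + nu.2 * w.2) <=
    exp (x - exp x) * exp (- (- cos th * exp (x + w.1))) * exp ((1 - nu.1) * w.1 + B).
    rewrite -!exp_plus; apply: exp_le_compat; rewrite ec exp_plus; nra.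
  have g2 : exp (x - exp x) * exp (- (- cos th * exp (x + w.1))) * exp ((1 - nu.1) * w.1 + B) <=
    exp (x - exp x) * (K2 * exp (- ((1 - c) * (x + w.1)))) * exp ((1 - nu.1) * w.1 + B).
    apply: Rmult_le_compat_r; first exact/Rlt_le/exp_pos.
    by apply: Rmult_le_compat_l; [exact/Rlt_le/exp_pos|exact: h2].
  have g3 : exp (x - exp x) * (K2 * exp (- ((1 - c) * (x + w.1)))) * exp ((1 - nu.1) * w.1 + B) =
    K2 * exp (c * x - 1 * exp x) * exp ((c - nu.1) * w.1 + B).
    have -> : exp (x - exp x) * (K2 * exp (- ((1 - c) * (x + w.1)))) * exp ((1 - nu.1) * w.1 + B) =
      K2 * (exp (x - exp x) * exp (- ((1 - c) * (x + w.1))) * exp ((1 - nu.1) * w.1 + B)) by ring.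
    by rewrite (Rmult_assoc K2) -!exp_plus; congr (_ * exp _); ring.
  have g4 : exp ((c - nu.1) * w.1 + B) <= exp (B + (nu.1 - 2 * c) * th) * exp (- (c * w.1)).
    by rewrite -exp_plus; apply: exp_le_compat; nra.
  have g5 : K2 * exp (c * x - 1 * exp x) * exp ((c - nu.1) * w.1 + B) <=
    K2 * (K3 * exp (- (c * Rabs x))) * (exp (B + (nu.1 - 2 * c) * th) * exp (- (c * w.1))).
    apply: Rmult_le_compat => //.
    - by apply: Rmult_le_pos; [lra|exact/Rlt_le/exp_pos].
    - exact/Rlt_le/exp_pos.
    - by apply: Rmult_le_compat_l; [lra|exact: h3].
  have g6 : K2 * (K3 * exp (- (c * Rabs x))) * (exp (B + (nu.1 - 2 * c) * th) * exp (- (c * w.1))) =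
    M2 * exp (- (c * Rabs x)) * exp (- (c * w.1)) by rewrite /M2; ring.
  have g7 : 0 < M1 * exp (- (c * Rabs x)) * exp (- (c * w.1)).
    by apply: Rmult_lt_0_compat => //; exact: Rmult_lt_0_compat.
  lra.
Qed.

Lemma strip_integral_translation (a b th x : R) (g : C -> C) :
  a <= b -> 0 <= th -> (forall w, CCcontinuous g w) ->
  strip_integral a b th (fun w => g (RtoC x + w)%C) = strip_integral (a + x) (b + x) th g.
Proof.
move=> ab th0 cg.
have e y : CInt (fun t => g (RtoC x + (t, y))%C) a b = CInt (fun t => g (t, y)) (a + x) (b + x).
  have abx : a + x <= b + x by lra.
  have ext := ex_CInt_horizontal (y := y) abx (fun t _ => cg (t, y)).
  have := @RInt_comp_lin C_R_CompleteNormedModule (fun t => g (t, y)) 1 x a b.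
  rewrite !Rmult_1_l => h; rewrite -h //; apply: CInt_ext => // t _.
  rewrite scal_one Rmult_1_l; congr g.
  by apply: injective_projections => /=; ring.
rewrite /strip_integral !e.
have -> // : CInt (fun y => g (RtoC x + (a, y))%C) (Ropp th) th = CInt (fun y => g (Rplus a x, y)) (Ropp th) th.
apply: CInt_ext => [|y _]; first lra.
by congr g; apply: injective_projections => /=; ring.
Qed.

(** Euler's integral, the substitution [s -> u s], and Fubini's theorem reduce
    the product of the two integrals to that of the kernel. *)
Lemma hankel_limit_Gamma (th : R) (nu H : C) :
  PI / 2 < th <= PI -> 0 < nu.1 ->
  hankel_limit th nu H -> (H * Gamma_Euler nu)%C = (2 * PI * Ci)%C.
Proof.
move=> hth hnu hH; have [th0 cth] := cos_neg_angle hth.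
set L := hankel_kernel nu; pose F := hankel_gamma_integrand nu.
have [c [M [c0 M0 hM]]] := hankel_gamma_integrand_bound hth hnu.
pose K x := (H * gamma_integrand nu x)%C.
pose I A w := ((Cexp (- RtoC (exp (- A)) * (1 - Cexp w)) -
               Cexp (- RtoC (exp A) * (1 - Cexp w))) * L w)%C.
have den w : on_strip (- th) th w -> (1 - Cexp w)%C <> 0.
  move=> /(Re_Cexp_strip hth) h e; have ew : Cexp w = (1 - (1 - Cexp w))%C by ring.
  by move: h; rewrite ew e /=; lra.
have cL : strip_continuous (- th) th L.
  move=> w hw; apply: (holomorphic_continuous _ hw); apply: holomorphic_hankel_kernel => v hv.
  split; first by apply: Rabs_le; have := on_strip_Im (Rlt_le _ _ th0) hv; lra.
  move=> e; apply: (den _ hv); rewrite e Cexp_0; ring.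
have cd w : CCcontinuous (fun w => 1 - Cexp w)%C w.
  by apply: continuous_Cminus; [exact: continuous_const|exact: continuous_Cexp_id].
have [S hS] : exists S : R, forall A b, 0 <= A -> - th <= b ->
    Cmod (CInt K (- A) A - strip_integral (- th) b th L)%C <=
      S * exp (- (c * A)) + S * exp (- (c * b)).
  apply: (@strip_Fubini_limit F K I L (- th) th M c) => //.
  - lra.
  - exact: continuous_hankel_gamma_integrand.
  - move=> x; apply: continuous_Cmult; first exact: continuous_const.
    exact: continuous_gamma_integrand.
  - move=> x.
    have e b : - th <= b -> strip_integral (- th) b th (F x) =
       (gamma_integrand nu x * strip_integral (- th + x) (b + x) th (hankel_integrand nu))%C.
      move=> hb; rewrite -strip_integral_translation //; first last.
      - exact: continuous_hankel_integrand.
      - lra.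
      rewrite -strip_integral_scal //; [|lra|].
        apply: strip_integral_ext => // [|w _]; first lra.
        rewrite /F /hankel_gamma_integrand /gamma_integrand /hankel_integrand.
        by rewrite -!Cexp_plus; congr Cexp; rewrite Cexp_plus Cexp_RtoC; ring.
      move=> w _; apply: (continuous_comp (fun w => RtoC x + w)%C (hankel_integrand nu)).
        by apply: continuous_Cplus; [exact: continuous_const|exact: continuous_id].
      exact: continuous_hankel_integrand.
    have := tends_to_scal (gamma_integrand nu x) (tends_to_shift x (hH (- th + x))).
    rewrite Cmult_comm; apply: (tends_to_ext (a := 0)) => b b0; rewrite e //; lra.
  - move=> A w hw; apply: continuous_Cmult; last exact: cL.
    by apply: continuous_Cminus; apply: continuous_Cexp; apply: continuous_Cmult => //;
      exact: continuous_const.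
  - move=> A w A0 hw; have nz := den w hw.
    have AA : - A <= A by lra.
    have -> : I A w = (- (Cexp (- RtoC (exp A) * (1 - Cexp w)) * L w)
       - - (Cexp (- RtoC (exp (- A)) * (1 - Cexp w)) * L w))%C by rewrite /I; ring.
    apply: CInt_unique.
    apply: (is_CInt_Cderive (f := fun x => - (Cexp (- RtoC (exp x) * (1 - Cexp w)) * L w))%C) => // x hx.
    + have h1 := is_Cderive_RtoC (is_derive_exp x).
      have h2 := is_Cderive_mult (is_Cderive_opp h1)
        (@is_derive_const R_AbsRing C_R_NormedModule (1 - Cexp w)%C x).
      have h3 := is_Cderive_opp (is_Cderive_mult (is_Cderive_Cexp h2)
        (@is_derive_const R_AbsRing C_R_NormedModule (L w) x)).
      have eF : F x w = (- ((- RtoC (exp x) * (1 - Cexp w) + - RtoC (exp x) * 0) *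
           Cexp (- RtoC (exp x) * (1 - Cexp w)) * L w +
           Cexp (- RtoC (exp x) * (1 - Cexp w)) * 0))%C.
        rewrite /F /hankel_gamma_integrand /L /hankel_kernel.
        have -> : (RtoC x - RtoC (exp x) * (1 - Cexp w) + (1 - nu) * w =
          RtoC x + (- RtoC (exp x) * (1 - Cexp w) + (1 - nu) * w))%C by ring.
        by rewrite !Cexp_plus Cexp_RtoC; field.
      rewrite eF; exact: h3.
    + apply: continuous_Cexp; apply: continuous_Cplus; last exact: continuous_const.
      apply: continuous_Cminus; first by apply: continuous_RtoC; exact: continuous_id.
      apply: continuous_Cmult; last exact: continuous_const.
      by apply: continuous_RtoC; exact: continuous_exp.
  - move=> w hw; have nz := den w hw.
    have u0 : 0 < (1 - Cexp w)%C.1 by have := Re_Cexp_strip hth hw; rewrite /=; lra.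
    set u := (1 - Cexp w)%C in u0 *.
    have t1 : tends_to (fun A => Cexp (- RtoC (exp (- A)) * u)%C) 1.
      move=> e e0; have [d d0 hd] := CCcontinuous_Cmod (@continuous_Cexp_id (RtoC 0)) e0.
      have [B hB] := exp_small (Cmod u) Rlt_0_1 d0.
      exists B => b hb; have := hd (- RtoC (exp (- b)) * u)%C; rewrite Cexp_0; apply.
      have -> : (- RtoC (exp (- b)) * u - 0 = - (RtoC (exp (- b)) * u))%C by ring.
      rewrite Cmod_opp Cmod_mult Cmod_R Rabs_pos_eq; last exact/Rlt_le/exp_pos.
      by have := hB b hb; rewrite Rmult_1_l; lra.
    have t2 : tends_to (fun A => Cexp (- RtoC (exp A) * u)%C) 0.
      apply: (tends_to_exp_rate (K := 1) (c := u.1) (a := 0)) => // b b0.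
      have -> : (Cexp (- RtoC (exp b) * u) - 0)%C = Cexp (- RtoC (exp b) * u) by ring.
      have re (r : R) (v : C) : (- RtoC r * v)%C.1 = - r * v.1 by rewrite /=; ring.
      rewrite Cmod_Cexp Rmult_1_l; apply: exp_le_compat; rewrite re.
      have := exp_ineq1_le b; nra.
    have t3 := tends_to_scal (L w) (tends_to_plus t1 (tends_to_scal (RtoC (-1)) t2)).
    have eL : (L w * (1 + RtoC (-1) * 0))%C = L w by ring.
    rewrite eL in t3.
    apply: (tends_to_ext (a := 0)) t3 => b _.
    by rewrite /I -/u (RtoC_opp 1); ring.
have t1 : tends_to (fun A => CInt K (- A) A) (2 * PI * Ci)%C.
  apply: (tends_to_exp_rate (K := S) (c := c) (a := 0)) => // A A0.
  apply: le_epsilon => e e0; have e2 : 0 < e / 2 by lra.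
  have [B1 hB1] := hankel_kernel_limit hth hnu e2.
  have [B2 hB2] := exp_small S c0 e2.
  pose b := Rmax (- th) (Rmax B1 B2).
  have b1 : - th <= b := Rmax_l _ _.
  have b2 : B1 <= b by apply: Rle_trans (Rmax_r (- th) _); exact: Rmax_l.
  have b3 : B2 <= b by apply: Rle_trans (Rmax_r (- th) _); exact: Rmax_r.
  apply: Rle_trans (Cmod_triang3 _ (strip_integral (- th) b th L) _) _.
  have := hS A b A0 b1; have := hB1 b b2; have := hB2 b b3; rewrite -/L; lra.
apply: tends_to_unique t1.
apply: (tends_to_ext (a := 0)) (tends_to_scal H (Gamma_Euler_limit hnu)) => A A0.
rewrite /K CInt_scal //; apply: ex_CInt_continuous; first lra.
by move=> x _; exact: continuous_gamma_integrand.
Qed.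

(** The recursion [1 / Gamma nu = nu / Gamma (nu + 1)], which defines [rGamma]
    to the left of the half-plane of convergence of Euler's integral, is also
    satisfied by the Hankel integral. *)
Lemma hankel_limit_rGamma (th : R) (nu l : C) :
  PI / 2 < th <= PI -> hankel_limit th nu l -> l = (2 * PI * Ci * rGamma nu)%C.
Proof.
move=> hth hl; have [th0 cth] := cos_neg_angle hth.
rewrite /rGamma; set m := Z.to_nat _.
have hm : 0 < (nu + INR m)%C.1.
  have [h _] := archimed (- Re nu).
  have h2 : IZR (up (- Re nu)) <= INR m.
    rewrite INR_IZR_INZ; apply: IZR_le; rewrite /m; lia.
  rewrite /= -/(Re nu); lra.
have [l' hl'] := hankel_limit_exists (nu + INR m)%C (Rlt_le _ _ th0) cth.
have iter N nu' u v : hankel_limit th nu' u -> hankel_limit th (nu' + INR N)%C v ->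
    u = ((\big[Cmult/RtoC 1]_(k < N) (nu' + INR k)) * v)%C.
  elim: N nu' u v => [|N IH] nu' u v hu hv.
    rewrite big_ord0 Cmult_1_l; apply: tends_to_unique (hu 0) _.
    by move: (hv 0); rewrite Cplus_0_r.
  rewrite big_ord_recl Cplus_0_r.
  have [u1 hu1] := hankel_limit_exists (nu' + 1)%C (Rlt_le _ _ th0) cth.
  rewrite (hankel_limit_rec (Rlt_le _ _ th0) cth hu hu1) -Cmult_assoc; congr (_ * _)%C.
  have e k : (nu' + INR k.+1)%C = (nu' + 1 + INR k)%C.
    by rewrite S_INR RtoC_plus; ring.
  rewrite (IH _ _ v hu1); last by rewrite -e.
  by congr (_ * _)%C; apply: eq_bigr => k _; rewrite -e.
rewrite (iter _ _ _ _ hl hl').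
have h := hankel_limit_Gamma hth hm hl'.
have nz : Gamma_Euler (nu + INR m)%C <> 0.
  move=> e; move: h; rewrite e Cmult_0_r => h.
  have := f_equal snd h; rewrite /=; have := PI_RGT_0; lra.
have -> : l' = (2 * PI * Ci / Gamma_Euler (nu + INR m))%C by rewrite -h; field.
by rewrite /Cdiv; ring.
Qed.

(** * Multiple geometric series *)

HB.instance Definition _ := Monoid.isComLaw.Build C (RtoC 0) Cplus
  Cplus_assoc Cplus_comm Cplus_0_l.
HB.instance Definition _ := Monoid.isComLaw.Build C (RtoC 1) Cmult
  Cmult_assoc Cmult_comm Cmult_1_l.
HB.instance Definition _ := Monoid.isMulLaw.Build C (RtoC 0) Cmult
  Cmult_0_l Cmult_0_r.
HB.instance Definition _ := Monoid.isAddLaw.Build C Cmult Cplus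
  (fun x y z => Cmult_plus_distr_r x y z) (fun x y z => Cmult_plus_distr_l x y z).

Lemma Rplus_associative : associative Rplus.
Proof. by move=> x y z; rewrite Rplus_assoc. Qed.

Lemma Rmult_associative : associative Rmult.
Proof. by move=> x y z; rewrite Rmult_assoc. Qed.

HB.instance Definition _ := Monoid.isComLaw.Build R 0 Rplus
  Rplus_associative Rplus_comm Rplus_0_l.
HB.instance Definition _ := Monoid.isComLaw.Build R 1 Rmult
  Rmult_associative Rmult_comm Rmult_1_l.

Definition seq_tends_to (u : nat -> C) (l : C) : Prop :=
  forall e, 0 < e -> exists N0, forall N, (N0 <= N)%N -> Cmod (u N - l)%C < e.

Lemma seq_tends_to_mult (u v : nat -> C) (l m : C) :
  seq_tends_to u l -> seq_tends_to v m ->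
  seq_tends_to (fun N => u N * v N)%C (l * m)%C.
Proof.
move=> hu hv e e0.
pose D := 1 + Cmod l + Cmod m.
have [l0 m0] := (Cmod_ge_0 l, Cmod_ge_0 m).
have D1 : 1 <= D by rewrite /D; lra.
pose d := Rmin 1 (e / (2 * D)).
have d0 : 0 < d by apply: Rmin_glb_lt; [lra|apply: Rdiv_lt_0_compat; lra].
have [dm1 dm2] : d <= 1 /\ d <= e / (2 * D) by split; [exact: Rmin_l|exact: Rmin_r].
have [N1 h1] := hu _ d0; have [N2 h2] := hv _ d0.
exists (maxn N1 N2) => N; rewrite geq_max => /andP[/h1 k1 /h2 k2].
have -> : (u N * v N - l * m = (u N - l) * (v N - m) + ((u N - l) * m + l * (v N - m)))%C by ring.
apply: Rle_lt_trans (Cmod_triangle _ _) _.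
apply: Rle_lt_trans (Rplus_le_compat_l _ _ _ (Cmod_triangle _ _)) _.
rewrite !Cmod_mult.
have [a0 b0] := (Cmod_ge_0 (u N - l)%C, Cmod_ge_0 (v N - m)%C).
have : d * (2 * D) <= e by apply/Rle_div_r => //; lra.
have : Cmod (u N - l)%C * Cmod (v N - m)%C <= d * 1 by apply: Rmult_le_compat; lra.
have : Cmod (u N - l)%C * Cmod m <= d * Cmod m by apply: Rmult_le_compat_r; lra.
have : Cmod l * Cmod (v N - m)%C <= Cmod l * d by apply: Rmult_le_compat_l; lra.
rewrite /D in D1 *; nra.
Qed.

Lemma seq_tends_to_prod (I : Type) (r : seq I) (u : I -> nat -> C) (l : I -> C) :
  (forall i, seq_tends_to (u i) (l i)) ->
  seq_tends_to (fun N => \big[Cmult/RtoC 1]_(i <- r) u i N)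
    (\big[Cmult/RtoC 1]_(i <- r) l i).
Proof.
move=> h; elim: r => [|i r IH] e e0.
- exists 0%N => N _; rewrite !big_nil.
  have -> : (1 - 1)%C = 0 by ring.
  by rewrite Cmod_0.
- have [N0 hN] := seq_tends_to_mult (h i) IH e0.
  by exists N0 => N /hN; rewrite !big_cons.
Qed.

Lemma sum_geometric (x : C) : Cmod x < 1 ->
  seq_tends_to (fun N => \big[Cplus/RtoC 0]_(i < N) Cpow x i) (/ (1 - x))%C.
Proof.
move=> hx.
have nz : (1 - x)%C <> 0.
  move=> e; have ex : x = (1 - (1 - x))%C by ring.
  move: hx; rewrite ex e; have -> : (1 - 0)%C = 1 by ring.
  rewrite Cmod_1; lra.
have sumE N : (\big[Cplus/RtoC 0]_(i < N) Cpow x i)%C = ((1 - Cpow x N) / (1 - x))%C.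
  elim: N => [|N IH]; first by rewrite big_ord0 /=; field.
  by rewrite big_ord_recr IH /=; field.
move=> e e0.
have n0 : 0 < Cmod (1 - x)%C by apply Cmod_gt_0.
have hx' : Rabs (Cmod x) < 1 by rewrite Rabs_pos_eq //; exact: Cmod_ge_0.
have [N0 hN0] := pow_lt_1_zero _ hx' (e * Cmod (1 - x)%C) (Rmult_lt_0_compat _ _ e0 n0).
exists N0 => N /leP hN; rewrite sumE.
have -> : ((1 - Cpow x N) / (1 - x) - / (1 - x) = - (Cpow x N / (1 - x)))%C by field.
rewrite Cmod_opp Cmod_div // Cmod_pow; apply/Rlt_div_l => //.
by apply: Rle_lt_trans (Rle_abs _) _; exact: hN0.
Qed.

Definition monomial (n : nat) (x : 'I_n -> C) (k : {ffun 'I_n -> nat}) : C :=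
  \big[Cmult/RtoC 1]_(j < n) Cpow (x j) (k j).

Definition box (n N : nat) : seq {ffun 'I_n -> nat} :=
  [seq [ffun j => nat_of_ord (f j)] | f : {ffun 'I_n -> 'I_N}].

Lemma box_uniq (n N : nat) : uniq (box n N).
Proof.
rewrite map_inj_uniq ?enum_uniq // => f g /ffunP h; apply/ffunP => j.
by apply: val_inj; have := h j; rewrite !ffunE.
Qed.

Lemma mem_box (n N : nat) (k : {ffun 'I_n -> nat}) :
  (forall j, (k j < N)%N) -> k \in box n N.
Proof.
move=> h; apply/imageP; exists [ffun j => Ordinal (h j)] => //.
by apply/ffunP => j; rewrite !ffunE.
Qed.

Lemma box_cover (n : nat) (s : seq {ffun 'I_n -> nat}) :
  exists M0, forall M, (M0 <= M)%N -> {subset s <= box n M}.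
Proof.
elim: s => [|k s [M0 h]]; first by exists 0%N.
exists (maxn M0 (\max_(j < n) k j).+1) => M; rewrite geq_max => /andP[/h hs hk] k'.
rewrite inE => /orP[/eqP->|]; last exact: hs.
apply: mem_box => j; apply: leq_trans hk; rewrite ltnS; exact: leq_bigmax.
Qed.

Lemma box_sum (n N : nat) (x : 'I_n -> C) :
  \big[Cplus/RtoC 0]_(k <- box n N) monomial x k =
  \big[Cmult/RtoC 1]_(j < n) \big[Cplus/RtoC 0]_(i < N) Cpow (x j) i.
Proof.
rewrite bigA_distr_bigA /box big_image /=; apply: eq_bigr => f _.
by apply: eq_bigr => j _; rewrite ffunE.
Qed.

Lemma box_sum_limit (n : nat) (x : 'I_n -> C) :
  (forall j, Cmod (x j) < 1) ->
  seq_tends_to (fun N => \big[Cplus/RtoC 0]_(k <- box n N) monomial x k)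
    (\big[Cmult/RtoC 1]_(j < n) (/ (1 - x j))%C).
Proof.
move=> hx e e0.
have [N0 h] := seq_tends_to_prod (index_enum 'I_n) (fun j => sum_geometric (hx j)) e0.
by exists N0 => N /h; rewrite box_sum.
Qed.

Lemma big_subseq_split (T : Type) (idx : T) (op : Monoid.com_law idx) (I : eqType)
    (s t : seq I) (F : I -> T) :
  uniq s -> uniq t -> {subset s <= t} ->
  \big[op/idx]_(i <- t) F i =
  op (\big[op/idx]_(i <- s) F i) (\big[op/idx]_(i <- t | i \notin s) F i).
Proof.
move=> us ut st; rewrite (bigID (mem s)) /=; congr (op _ _).
rewrite -big_filter; apply: perm_big; apply: uniq_perm => //.
  exact: filter_uniq.
by move=> i; rewrite mem_filter; case: (boolP (i \in s)) => //= /st.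
Qed.

Lemma Cmod_sum_le (I : Type) (r : seq I) (P : pred I) (F : I -> C) (G : I -> R) :
  (forall i, Cmod (F i) <= G i) ->
  Cmod (\big[Cplus/RtoC 0]_(i <- r | P i) F i) <= \big[Rplus/0]_(i <- r | P i) G i.
Proof.
move=> h; apply: (big_ind2 (fun a b => Cmod a <= b)) => //.
- by rewrite Cmod_0; lra.
- move=> a b c d h1 h2; apply: Rle_trans (Cmod_triangle _ _) _; lra.
Qed.

Lemma sum_le_pred (I : Type) (r : seq I) (P Q : pred I) (G : I -> R) :
  (forall i, 0 <= G i) -> (forall i, P i -> Q i) ->
  \big[Rplus/0]_(i <- r | P i) G i <= \big[Rplus/0]_(i <- r | Q i) G i.
Proof.
move=> h PQ; elim: r => [|i r IH]; first by rewrite !big_nil; lra.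
rewrite !big_cons; have := h i; have := PQ i.
by case: (P i) => [->|_] //; case: (Q i) => ?; lra.
Qed.

Lemma RtoC_sum (I : Type) (r : seq I) (P : pred I) (F : I -> R) :
  RtoC (\big[Rplus/0]_(i <- r | P i) F i) = \big[Cplus/RtoC 0]_(i <- r | P i) RtoC (F i).
Proof. by apply: (big_morph RtoC); [exact: RtoC_plus|]. Qed.

Lemma Cmod_prod (I : Type) (r : seq I) (P : pred I) (F : I -> C) :
  Cmod (\big[Cmult/RtoC 1]_(i <- r | P i) F i) = \big[Rmult/1]_(i <- r | P i) Cmod (F i).
Proof. by apply: (big_morph Cmod); [exact: Cmod_mult|exact: Cmod_1]. Qed.

Lemma prod_R_le (I : Type) (r : seq I) (F G : I -> R) :
  (forall i, 0 <= F i <= G i) ->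
  0 <= \big[Rmult/1]_(i <- r) F i <= \big[Rmult/1]_(i <- r) G i.
Proof.
move=> h; elim: r => [|i r IH]; first by rewrite !big_nil; lra.
rewrite !big_cons; have := h i => hi.
by split; [apply: Rmult_le_pos; lra|apply: Rmult_le_compat; lra].
Qed.

(** The multiple geometric series converges unconditionally to the product of
    the simple ones, uniformly in [x] on the polydisc of radii [q]: what a
    finite family of indices that contains a large box leaves out is dominated
    by the tail at [x = q]. *)
Lemma geometric_uniform (n : nat) (q : 'I_n -> R) (e : R) :
  (forall j, 0 <= q j < 1) -> 0 < e ->
  exists s0 : seq {ffun 'I_n -> nat}, forall s, uniq s -> {subset s0 <= s} ->
  forall x : 'I_n -> C, (forall j, Cmod (x j) <= q j) ->
  Cmod (\big[Cplus/RtoC 0]_(k <- s) monomial x k -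
        \big[Cmult/RtoC 1]_(j < n) (/ (1 - x j))%C)%C <= e.
Proof.
move=> hq e0; have e3 : 0 < e / 3 by lra.
have cq j : Cmod (RtoC (q j)) = q j by rewrite Cmod_R Rabs_pos_eq //; have := hq j; lra.
have hq1 j : Cmod (RtoC (q j)) < 1 by rewrite cq; have := hq j; lra.
have [N hN] := box_sum_limit hq1 e3.
exists (box n N) => s us sub x hx.
(* The terms at x = q, which dominate those at x. *)
pose G k := Cmod (monomial (fun j => RtoC (q j)) k).
have G0 k : 0 <= G k := Cmod_ge_0 _.
have mG k : RtoC (G k) = monomial (fun j => RtoC (q j)) k.
  rewrite /G /monomial Cmod_prod.
  rewrite (big_morph RtoC RtoC_mult (erefl (RtoC 1))); apply: eq_bigr => j _.
  by rewrite Cmod_pow cq RtoC_pow.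
have xG k : Cmod (monomial x k) <= G k.
  rewrite /G /monomial !Cmod_prod; apply prod_R_le => j; rewrite !Cmod_pow cq.
  have := Cmod_ge_0 (x j) => x0.
  by split; [exact: pow_le|apply: pow_incr; have := hx j; lra].
have [M0 hM0] := box_cover s.
have hx1 j : Cmod (x j) < 1 by apply: Rle_lt_trans (hx j) _; have := hq j; lra.
apply: le_epsilon => d d0.
have d3 : 0 < e / 3 + d by lra.
have [M1 hM1] := box_sum_limit hx1 d3.
pose M := maxn N (maxn M0 M1).
have sM : {subset s <= box n M} by apply: hM0; rewrite /M !leq_max leqnn orbT.
have hM1' := hM1 M (leq_trans (leq_maxr _ _) (leq_maxr _ _)).
pose r := \big[Rplus/0]_(k <- box n M | k \notin box n N) G k.
have er : (\big[Cplus/RtoC 0]_(k <- box n M) monomial (fun j => RtoC (q j)) k -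
    \big[Cplus/RtoC 0]_(k <- box n N) monomial (fun j => RtoC (q j)) k)%C = RtoC r.
  rewrite (big_subseq_split _ _ (box_uniq n N) (box_uniq n M)) => [|k /sub /sM //].
  rewrite /r RtoC_sum; under [in RHS]eq_bigr do rewrite mG.
  by rewrite /=; ring.
have r3 : Cmod (RtoC r) < e / 3 + e / 3.
  rewrite -er; apply: Rle_lt_trans (Cmod_triang3 _
    (\big[Cmult/RtoC 1]_(j < n) (/ (1 - RtoC (q j)))%C) _) _.
  rewrite [X in _ + X]Cmod_sub_sym.
  by apply: Rplus_lt_compat; apply: hN => //; rewrite /M leq_maxl.
have rest : Cmod (\big[Cplus/RtoC 0]_(k <- s) monomial x k -
    \big[Cplus/RtoC 0]_(k <- box n M) monomial x k)%C <= r.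
  rewrite (big_subseq_split _ _ us (box_uniq n M) sM) Cmod_sub_sym /=.
  set a := (X in Cmod (X + _ - _)%C); set b := (X in Cmod (_ + X - _)%C).
  have -> : (a + b - a)%C = b by ring.
  apply: Rle_trans (Cmod_sum_le _ _ xG) _.
  by apply: sum_le_pred => // k; apply: contra => /sub.
have := hM1' ; have := Rle_abs r; rewrite -Cmod_R => h1 h2.
apply: Rle_trans (Cmod_triang3 _ (\big[Cplus/RtoC 0]_(k <- box n M) monomial x k) _) _.
lra.
Qed.

(** * The Mittag-Leffler integral in the logarithmic coordinate *)

Lemma is_unordered_sum_inj (I : eqType) (a : I -> C) (l m : C) :
  is_unordered_sum a l -> is_unordered_sum a m -> m = l.
Proof.
move=> hl hm; suff h : Cmod (m - l)%C <= 0.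
  have e : (m - l)%C = 0 by apply: Cmod_eq_0; apply: Rle_antisym => //; exact: Cmod_ge_0.
  have -> : m = (m - l + l)%C by ring.
  by rewrite e Cplus_0_l.
apply: le_epsilon => e e0; have e2 : 0 < e / 2 by lra.
have [s1 h1] := hl _ e2; have [s2 h2] := hm _ e2.
pose s := undup (s1 ++ s2).
have sub1 : {subset s1 <= s} by move=> x hx; rewrite mem_undup mem_cat hx.
have sub2 : {subset s2 <= s} by move=> x hx; rewrite mem_undup mem_cat hx orbT.
have k1 := h1 s (undup_uniq _) sub1; have k2 := h2 s (undup_uniq _) sub2.
apply: Rle_trans (Cmod_triang3 _ (\big[Cplus/RtoC 0]_(i <- s) a i) _) _.
rewrite Cmod_sub_sym; lra.
Qed.

Lemma unordered_sum_unique (I : eqType) (a : I -> C) (l : C) :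
  is_unordered_sum a l -> unordered_sum a = l.
Proof.
move=> hl; apply: (@iota_unique R_AbsRing C_R_CompleteNormedModule) => // m hm.
exact: is_unordered_sum_inj hl hm.
Qed.

Lemma eventually_forall (I : finType) (P : I -> R -> Prop) :
  (forall i, exists B, forall b, B <= b -> P i b) ->
  exists B, forall b, B <= b -> forall i, P i b.
Proof.
move=> h; suff [B hB] : exists B, forall b, B <= b -> forall i, i \in enum I -> P i b.
  by exists B => b hb i; apply: hB => //; rewrite mem_enum.
elim: (enum I) => [|i r [B hB]]; first by exists 0.
have [D hD] := h i; exists (Rmax B D) => b hb k.
rewrite inE => /orP[/eqP->|].
- by apply: hD; apply: Rle_trans hb; exact: Rmax_r.
- by apply: hB; apply: Rle_trans hb; exact: Rmax_l.
Qed.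

Lemma Cexp_sum (I : Type) (r : seq I) (F : I -> C) :
  Cexp (\big[Cplus/RtoC 0]_(i <- r) F i) = \big[Cmult/RtoC 1]_(i <- r) Cexp (F i).
Proof. by apply: (big_morph Cexp); [exact: Cexp_plus|exact: Cexp_0]. Qed.

Lemma Cpow_Cexp (u : C) (k : nat) : Cpow (Cexp u) k = Cexp (INR k * u)%C.
Proof.
elim: k => [|k IH]; first by rewrite Cmult_0_l Cexp_0.
rewrite Cpow_S IH -Cexp_plus; congr Cexp.
by rewrite S_INR RtoC_plus; ring.
Qed.

Lemma Cprod_neq_0 (I : Type) (r : seq I) (F : I -> C) :
  (forall i, F i <> 0) -> \big[Cmult/RtoC 1]_(i <- r) F i <> 0.
Proof.
move=> h; apply: (big_ind (fun x : C => x <> 0)) => //.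
- exact: C1_nz.
- exact: Cmult_neq_0.
Qed.

Lemma Cprod_inv (I : Type) (r : seq I) (F : I -> C) :
  (forall i, F i <> 0) ->
  \big[Cmult/RtoC 1]_(i <- r) (/ F i)%C = (/ \big[Cmult/RtoC 1]_(i <- r) F i)%C.
Proof.
move=> h; have nz := @Cprod_neq_0 _ r F h.
have e : (\big[Cmult/RtoC 1]_(i <- r) (/ F i) * \big[Cmult/RtoC 1]_(i <- r) F i)%C = 1.
  by rewrite -big_split big1 //= => i _; exact: Cinv_l.
move: nz e; set X := \big[Cmult/RtoC 1]_(i <- r) (/ F i)%C.
set Y := \big[Cmult/RtoC 1]_(i <- r) F i => nz e.
have -> : X = (X * Y / Y)%C by field.
by rewrite e; field.
Qed.

Lemma holomorphic_prod (A : C -> Prop) (I : Type) (r : seq I) (F : I -> C -> C) :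
  (forall i, holomorphic A (F i)) ->
  holomorphic A (fun w => \big[Cmult/RtoC 1]_(i <- r) F i w).
Proof.
move=> h; elim: r => [|i r IH].
- apply: (holomorphic_ext (f := fun _ => RtoC 1)) => [w|]; first by rewrite big_nil.
  exact: holomorphic_const.
- apply: (holomorphic_ext (f := fun w => F i w * \big[Cmult/RtoC 1]_(i <- r) F i w)%C) => [w|].
    by rewrite big_cons.
  exact: holomorphic_mult.
Qed.

(** The integrand of the Mittag-Leffler integral after the substitution
    [s = e^(P v)], with [P] the product of the [alpha j]: the exponents no
    longer involve [P]. The factor [P] of [ds = P e^(P v) dv] is left out. *)
Definition ml_log_integrand (n : nat) (alpha : 'I_n -> R) (mu : C)
    (z : 'I_n -> C) (v : C) : C :=
  (Cexp (Cexp v) * Cexp ((RtoC (sum_alpha alpha) + 1 - mu) * v)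
   / \big[Cmult/RtoC 1]_(j < n) (Cexp (alpha j * v) - z j))%C.

(** [Omega_minus], in the form in which it excludes poles at [Cexp (alpha v) = z]
    for [v] in the half-strip. *)
Definition avoids_strip (a th alpha : R) (z : C) : Prop :=
  Cmod z < exp (alpha * a) \/ (z <> 0 /\ alpha * th < Rabs (Carg z)).

Lemma avoids_strip_neq (a th alpha : R) (z v : C) :
  0 < alpha -> avoids_strip a th alpha z -> a <= v.1 -> - th <= v.2 <= th ->
  (Cexp (alpha * v) - z)%C <> 0.
Proof.
move=> al0 hz hv1 hv2 e.
have {}e : Cexp (alpha * v) = z.
  have -> : Cexp (alpha * v) = (Cexp (alpha * v) - z + z)%C by ring.
  by rewrite e Cplus_0_l.
have re : (RtoC alpha * v)%C.1 = alpha * v.1 by rewrite /=; ring.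
have im : (RtoC alpha * v)%C.2 = alpha * v.2 by rewrite /=; ring.
have m : Cmod z = exp (alpha * v.1) by rewrite -e Cmod_Cexp re.
case: hz => [h|[nz h]].
- have : exp (alpha * a) <= exp (alpha * v.1) by apply: exp_le_compat; nra.
  lra.
- have [[c1 c2] c3] := Carg_spec nz.
  have ec : cos (alpha * v.2) = cos (Carg z).
    have := f_equal fst c3; rewrite -{1}e m /Cexp /polar /Re /Im re im /= => k.
    apply: (Rmult_eq_reg_l (exp (alpha * v.1))) => //.
    by have := exp_pos (alpha * v.1); lra.
  have cabs x : cos (Rabs x) = cos x by rewrite /Rabs; case: Rcase_abs => _; rewrite ?cos_neg.
  have b1 : Rabs (alpha * v.2) <= alpha * th.
    rewrite Rabs_mult Rabs_pos_eq; last lra.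
    by apply: Rmult_le_compat_l; [lra|exact: Rabs_le].
  have b2 : Rabs (Carg z) <= PI by apply: Rabs_le; lra.
  have := cos_decreasing_1 (Rabs (alpha * v.2)) (Rabs (Carg z)).
  rewrite !cabs ec; have := Rabs_pos (alpha * v.2); have := Rabs_pos (Carg z); lra.
Qed.

Lemma holomorphic_ml_log_integrand (A : C -> Prop) (n : nat) (alpha : 'I_n -> R)
    (mu : C) (z : 'I_n -> C) (a th : R) :
  (forall j, 0 < alpha j) -> (forall j, avoids_strip a th (alpha j) (z j)) ->
  (forall v, A v -> a <= v.1 /\ - th <= v.2 <= th) ->
  holomorphic A (ml_log_integrand alpha mu z).
Proof.
move=> al0 hz hA; apply: holomorphic_mult.
- apply: holomorphic_mult; last exact: holomorphic_linear_Cexp.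
  by apply/holomorphic_Cexp/holomorphic_Cexp/holomorphic_id.
- apply: holomorphic_inv => [v /hA[h1 h2]|].
    by apply: Cprod_neq_0 => j; exact: avoids_strip_neq (hz j) h1 h2.
  apply: holomorphic_prod => j; apply: holomorphic_minus; last exact: holomorphic_const.
  exact: holomorphic_linear_Cexp.
Qed.

Lemma hankel_integrand_monomial (n : nat) (alpha : 'I_n -> R) (mu : C)
    (z : 'I_n -> C) (k : {ffun 'I_n -> nat}) (v : C) :
  (hankel_integrand mu v * monomial (fun j => z j * Cexp (- (alpha j * v))) k)%C =
  (monomial z k * hankel_integrand (mu + RtoC (weight alpha k)) v)%C.
Proof.
have -> : monomial (fun j => (z j * Cexp (- (alpha j * v)))%C) k =
    (monomial z k * Cexp (- (RtoC (weight alpha k) * v)))%C.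
  rewrite /monomial (eq_bigr (fun j => Cpow (z j) (k j) *
      Cexp (- (RtoC (alpha j * INR (k j)) * v)))%C) => [|j _]; last first.
    rewrite Cpow_mult_l Cpow_Cexp; congr (_ * Cexp _)%C.
    by rewrite RtoC_mult; ring.
  rewrite big_split /=; congr (_ * _)%C; rewrite -Cexp_sum; congr Cexp.
  rewrite /weight RtoC_sum big_distrl /=.
  by apply: (big_ind2 (fun a b => a = (- b)%C)) => [|a b c d -> ->|//]; ring.
rewrite /hankel_integrand.
have -> : ((1 - (mu + RtoC (weight alpha k))) * v = (1 - mu) * v + - (RtoC (weight alpha k) * v))%C.
  by ring.
by rewrite Cexp_plus; ring.
Qed.

Lemma ml_log_integrand_geometric (n : nat) (alpha : 'I_n -> R) (mu : C)
    (z : 'I_n -> C) (v : C) :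
  (forall j, Cmod (z j * Cexp (- (alpha j * v)))%C < 1) ->
  ml_log_integrand alpha mu z v =
  (hankel_integrand mu v *
   \big[Cmult/RtoC 1]_(j < n) (/ (1 - z j * Cexp (- (alpha j * v)))))%C.
Proof.
move=> hx.
have nz j : (1 - z j * Cexp (- (alpha j * v)))%C <> 0.
  move=> e; have := hx j.
  have -> : (z j * Cexp (- (alpha j * v)))%C = (1 - (1 - z j * Cexp (- (alpha j * v))))%C by ring.
  rewrite e; have -> : (1 - 0)%C = 1 by ring.
  rewrite Cmod_1; lra.
rewrite /ml_log_integrand.
have -> : \big[Cmult/RtoC 1]_(j < n) (Cexp (alpha j * v) - z j)%C =
    (Cexp (RtoC (sum_alpha alpha) * v) *
     \big[Cmult/RtoC 1]_(j < n) (1 - z j * Cexp (- (alpha j * v))))%C.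
  rewrite /sum_alpha RtoC_sum big_distrl /= Cexp_sum -big_split /=.
  apply: eq_bigr => j _; rewrite Cexp_opp.
  by have := @Cexp_neq_0 (alpha j * v)%C => ne; field.
rewrite Cprod_inv // /hankel_integrand.
have p := @Cprod_neq_0 _ (index_enum 'I_n) _ nz.
have q := @Cexp_neq_0 (RtoC (sum_alpha alpha) * v)%C.
have -> : ((RtoC (sum_alpha alpha) + 1 - mu) * v = RtoC (sum_alpha alpha) * v + (1 - mu) * v)%C by ring.
have cancel (X Y Z W : C) : Y <> 0 -> Z <> 0 -> (X * (Z * W) / (Z * Y) = X * W * / Y)%C.
  by move=> ? ?; field.
by rewrite Cexp_plus; exact: cancel.
Qed.

Lemma strip_integral_hankel_sum (th a : R) (I : Type) (c : I -> C) (nu : I -> C) (s : seq I) :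
  PI / 2 < th <= PI ->
  strip_continuous a th (fun v => \big[Cplus/RtoC 0]_(i <- s) (c i * hankel_integrand (nu i) v)%C) /\
  tends_to (fun b => strip_integral a b th
     (fun v => \big[Cplus/RtoC 0]_(i <- s) (c i * hankel_integrand (nu i) v)%C))
    (2 * PI * Ci * \big[Cplus/RtoC 0]_(i <- s) (c i * rGamma (nu i)))%C.
Proof.
move=> hth; have [th0 cth] := cos_neg_angle hth.
elim: s => [|i s [IHc IHl]].
- split.
    move=> w _; apply: (continuous_ext (fun _ => RtoC 0)) => [v|]; first by rewrite big_nil.
    exact: continuous_const.
  rewrite big_nil Cmult_0_r; apply: (tends_to_ext (a := a)) (tends_to_const 0) => b ab.
  have c0 : strip_continuous a th (fun _ => RtoC 0) by move=> w _; exact: continuous_const.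
  rewrite (strip_integral_ext (g := fun v => 0 * RtoC 0)%C) //; [|lra|].
    by rewrite strip_integral_scal //; [rewrite Cmult_0_l|lra].
  by move=> w _; rewrite big_nil Cmult_0_l.
- have ci : strip_continuous a th (fun v => c i * hankel_integrand (nu i) v)%C.
    move=> w _; apply: continuous_Cmult; first exact: continuous_const.
    exact: continuous_hankel_integrand.
  split.
    move=> w hw; apply: (continuous_ext (fun v => (c i * hankel_integrand (nu i) v +
      \big[Cplus/RtoC 0]_(i <- s) (c i * hankel_integrand (nu i) v))%C)) => [v|].
      by rewrite big_cons.
    by apply: continuous_Cplus; [exact: ci|exact: IHc].
  have [l hl] := hankel_limit_exists (nu i) (Rlt_le _ _ th0) cth.
  have := tends_to_plus (tends_to_scal (c i) (hl a)) IHl.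
  rewrite (hankel_limit_rGamma hth hl) big_cons.
  set S := \big[Cplus/RtoC 0]_(j <- s) _.
  have -> : (c i * (2 * PI * Ci * rGamma (nu i)) + 2 * PI * Ci * S =
    2 * PI * Ci * (c i * rGamma (nu i) + S))%C by ring.
  apply: (tends_to_ext (a := a)) => b ab.
  rewrite -strip_integral_scal //; [|lra|by move=> w _; exact: continuous_hankel_integrand].
  rewrite -strip_integral_plus //; last lra.
  by apply: strip_integral_ext => //; [lra|move=> w _; rewrite big_cons].
Qed.

(** Far enough to the right, all [z j e^(- alpha j v)] are at most [1/2] in
    modulus on the contour; expanding the integrand in a multiple geometric
    series and integrating term by term gives the Mittag-Leffler series. *)
Lemma ml_integral_right (n : nat) (alpha : 'I_n -> R) (mu : C) (z : 'I_n -> C)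
    (a th : R) (l : C) :
  PI / 2 < th <= PI -> (forall j, 0 < alpha j) ->
  (forall j, Cmod (z j) * exp (- (alpha j * a)) <= 1 / 2) ->
  strip_continuous a th (ml_log_integrand alpha mu z) ->
  tends_to (fun b => strip_integral a b th (ml_log_integrand alpha mu z)) l ->
  l = (2 * PI * Ci * mittag_leffler alpha z mu)%C.
Proof.
move=> hth al0 hz cPhi hl; have [th0 cth] := cos_neg_angle hth.
set Phi := ml_log_integrand alpha mu z in cPhi hl *.
have small v j : on_strip a th v -> Cmod (z j * Cexp (- (alpha j * v)))%C <= 1 / 2.
  move=> hv; apply: Rle_trans (hz j); rewrite Cmod_mult; apply: Rmult_le_compat_l.
    exact: Cmod_ge_0.
  rewrite Cmod_Cexp; apply: exp_le_compat => /=.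
  have := on_strip_Re hv; have := al0 j; nra.
have [M M0 hM] := strip_Cexp_decay a (1 - mu)%C (Rlt_le _ _ th0) cth.
pose T := M * (2 / 1 + 2 * th) * exp (- (1 * a)).
have T0 : 0 <= T.
  by apply: Rmult_le_pos; [apply: Rmult_le_pos; lra|exact/Rlt_le/exp_pos].
pose c k := monomial z k.
pose nu k := (mu + RtoC (weight alpha k))%C.
have pi0 := PI_RGT_0.
have nzpi : (2 * PI * Ci)%C <> 0.
  by move=> e; have := f_equal snd e => /=; lra.
have C2 : Cmod (2 * PI * Ci)%C = 2 * PI.
  have -> : (2 * PI * Ci = Ci * RtoC (2 * PI))%C by rewrite RtoC_mult; ring.
  by rewrite Cmod_Ci_mult Cmod_R Rabs_pos_eq; lra.
have cancel (X Y W : C) : Y <> 0 -> W = (X / Y)%C -> X = (Y * W)%C.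
  by move=> ? ->; field.
apply: cancel => //.
apply: unordered_sum_unique => e e0.
have e1 : 0 < e / (T + 1) by apply: Rdiv_lt_0_compat; lra.
have hq (j : 'I_n) : 0 <= 1 / 2 < 1 by lra.
have [s0 hs0] := geometric_uniform hq e1.
exists s0 => s us sub; have {hs0}hs := hs0 s us sub.
have [cS lS] := strip_integral_hankel_sum a c nu s hth.
set S := (fun v => \big[Cplus/RtoC 0]_(i <- s) (c i * hankel_integrand (nu i) v)%C) in cS lS.
have close v : on_strip a th v -> Cmod (S v - Phi v)%C <= e / (T + 1) * M * exp (- (1 * v.1)).
  move=> hv.
  have -> : S v = (hankel_integrand mu v * \big[Cplus/RtoC 0]_(k <- s)
      monomial (fun j => z j * Cexp (- (alpha j * v)))%C k)%C.
    rewrite big_distrr /=; apply: eq_bigr => k _; by rewrite hankel_integrand_monomial.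
  rewrite /Phi ml_log_integrand_geometric; last by move=> j; have := small v j hv; lra.
  set X := \big[Cplus/RtoC 0]_(k <- s) _; set Y := \big[Cmult/RtoC 1]_(j < n) _.
  have -> : (hankel_integrand mu v * X - hankel_integrand mu v * Y =
    (X - Y) * hankel_integrand mu v)%C by ring.
  rewrite Cmod_mult Rmult_assoc; apply: Rmult_le_compat; try exact: Cmod_ge_0.
  - by apply: hs => j; exact: small.
  - exact: hM.
have bd b : a <= b -> Cmod (strip_integral a b th S - strip_integral a b th Phi)%C <= e / (T + 1) * T.
  move=> ab; rewrite -strip_integral_minus //; last lra.
  have cd : strip_continuous a th (fun v => S v - Phi v)%C.
    by move=> w hw; apply: continuous_Cminus; [exact: cS|exact: cPhi].
  have := strip_integral_bound ab (Rlt_le _ _ th0) Rlt_0_1 cd close.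
  by rewrite /T !Rmult_assoc.
have lim : Cmod (2 * PI * Ci * \big[Cplus/RtoC 0]_(i <- s) (c i * rGamma (nu i)) - l)%C <= e / (T + 1) * T.
  apply: le_epsilon => d d0; have d2 : 0 < d / 2 by lra.
  have [B1 hB1] := hl _ d2; have [B2 hB2] := lS _ d2.
  pose b := Rmax a (Rmax B1 B2).
  have b1 : a <= b := Rmax_l _ _.
  have b2 : B1 <= b by apply: Rle_trans (Rmax_r a _); exact: Rmax_l.
  have b3 : B2 <= b by apply: Rle_trans (Rmax_r a _); exact: Rmax_r.
  apply: Rle_trans (Cmod_triang3 _ (strip_integral a b th S) _) _.
  apply: Rle_trans (Rplus_le_compat_l _ _ _ (Cmod_triang3 _ (strip_integral a b th Phi) _)) _.
  rewrite [X in X + _]Cmod_sub_sym.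
  apply: Rle_trans (Rplus_le_compat _ _ _ _ (Rlt_le _ _ (hB2 b b3))
    (Rplus_le_compat _ _ _ _ (bd b b1) (Rlt_le _ _ (hB1 b b2)))) _.
  lra.
set Z := \big[Cplus/RtoC 0]_(i <- s) (c i * rGamma (nu i))%C in lim.
have factor (X Y : C) : Y <> 0 -> (Z - X / Y = (Y * Z - X) / Y)%C by move=> ?; field.
rewrite factor //.
rewrite Cmod_div // C2; apply/Rlt_div_l; first lra.
apply: Rle_lt_trans lim _.
have h2 : e / (T + 1) * T <= e.
  have -> : e / (T + 1) * T = e * (T / (T + 1)) by field; lra.
  rewrite -[X in _ <= X]Rmult_1_r; apply: Rmult_le_compat_l; first lra.
  by apply/Rle_div_l; lra.
have := PI2_1; nra.
Qed.

(** The general position of the contour follows by moving it to the right: the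
    condition on [z] keeps the poles out of the region that is swept. *)
Lemma ml_integral (n : nat) (alpha : 'I_n -> R) (mu : C) (z : 'I_n -> C) (a th : R) :
  PI / 2 < th <= PI -> (forall j, 0 < alpha j) ->
  (forall j, avoids_strip a th (alpha j) (z j)) ->
  let Phi := ml_log_integrand alpha mu z in
  exists lb lt : C, [/\ tends_to (fun b => CInt (fun x => Phi (x, - th)) a b) lb,
    tends_to (fun b => CInt (fun x => Phi (x, th)) a b) lt
    & (- lb + Ci * CInt (fun y => Phi (a, y)) (Ropp th) th + lt =
       2 * PI * Ci * mittag_leffler alpha z mu)%C].
Proof.
move=> hth al0 hz Phi; have [th0 cth] := cos_neg_angle hth.
have tp := Rlt_le _ _ th0.
have half : 0 < 1 / 2 by lra.
have [B hB] : exists B, forall b, B <= b -> forall j, Cmod (z j) * exp (- (alpha j * b)) < 1 / 2.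
  by apply: eventually_forall => j; exact: exp_small.
pose a' := Rmax a B.
have aa' : a <= a' := Rmax_l _ _.
have hza j : Cmod (z j) * exp (- (alpha j * a')) <= 1 / 2 by apply/Rlt_le/hB; exact: Rmax_r.
have hPhi : holomorphic (fun v => a <= v.1 /\ - th <= v.2 <= th) Phi.
  exact: holomorphic_ml_log_integrand al0 hz _.
have cPhi u : a <= u -> strip_continuous u th Phi.
  move=> au v hv; apply: (holomorphic_continuous hPhi).
  by have := on_strip_Re hv; have := on_strip_Im tp hv; lra.
have [M M0 hM] := strip_Cexp_decay a' (1 - mu)%C tp cth.
pose K := \big[Rmult/1]_(j < n) 2.
have bound v : on_strip a' th v -> Cmod (Phi v) <= M * K * exp (- (1 * v.1)).
  move=> hv.
  have small j : Cmod (z j * Cexp (- (alpha j * v)))%C <= 1 / 2.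
    apply: Rle_trans (hza j); rewrite Cmod_mult; apply: Rmult_le_compat_l.
      exact: Cmod_ge_0.
    rewrite Cmod_Cexp; apply: exp_le_compat => /=.
    have := on_strip_Re hv; have := al0 j; nra.
  rewrite /Phi ml_log_integrand_geometric; last by move=> j; have := small j; lra.
  rewrite Cmod_mult Cmod_prod.
  have -> : M * K * exp (- (1 * v.1)) = M * exp (- (1 * v.1)) * K by ring.
  have [p0 pK] : 0 <= \big[Rmult/1]_(j < n) Cmod (/ (1 - z j * Cexp (- (alpha j * v))))%C <= K.
    apply: prod_R_le => j; split; first exact: Cmod_ge_0.
    have d : 1 / 2 <= Cmod (1 - z j * Cexp (- (alpha j * v)))%C.
      have := Cmod_triang3 (z j * Cexp (- (alpha j * v)))%C 1 0.
      set u := (z j * _)%C.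
      have -> : (1 - 0)%C = 1 by ring.
      have e : u = (1 - (1 - u))%C by ring.
      have := small j; rewrite -/u => k _.
      have := Cmod_triangle (1 - u)%C u.
      have -> : (1 - u + u)%C = 1 by ring.
      rewrite Cmod_1; lra.
    rewrite Cmod_inv; last by move=> e; rewrite e Cmod_0 in d; lra.
    have -> : 2 = / (1 / 2) by field.
    by apply: Rinv_le_contravar.
  apply: Rmult_le_compat => //; first exact: Cmod_ge_0.
  exact: hM.
have ray y : y = th \/ y = - th -> exists l1 l2 : C,
    [/\ tends_to (fun b => CInt (fun x => Phi (x, y)) a' b) l1
      & tends_to (fun b => CInt (fun x => Phi (x, y)) a b) l2].
  move=> hy.
  have on u x : u <= x -> on_strip u th (x, y) by move=> ux; right.
  have cx u x : a <= u -> u <= x -> CCcontinuous Phi (x, y).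
    by move=> au ux; apply: (cPhi u) => //; exact: on.
  have [l hl] := improper_CInt (f := fun x => Phi (x, y)) Rlt_0_1
    (fun x hx => continuous_horizontal (cx _ _ aa' hx)) (fun x hx => bound _ (on _ _ hx)).
  have t := tends_to_exp_rate Rlt_0_1 hl.
  exists l, (CInt (fun x => Phi (x, y)) a a' + l)%C; split => //.
  apply: (tends_to_ext (a := a')) (tends_to_plus (tends_to_const _) t) => b ab.
  apply: CInt_Chasles; apply: ex_CInt_horizontal => // x hx; apply: (cx a); lra.
have [lb' [lb [tb' tb]]] := ray _ (or_intror erefl).
have [lt' [lt [tt' tt]]] := ray _ (or_introl erefl).
exists lb, lt; split => //.
have strip_lim u l1 l2 : tends_to (fun b => CInt (fun x => Phi (x, - th)) u b) l1 ->
    tends_to (fun b => CInt (fun x => Phi (x, th)) u b) l2 ->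
    tends_to (fun b => strip_integral u b th Phi)
      (- l1 + Ci * CInt (fun y => Phi (u, y)) (Ropp th) th + l2)%C.
  move=> h1 h2; have := tends_to_plus (tends_to_plus (tends_to_scal (RtoC (-1)) h1)
     (tends_to_const (Ci * CInt (fun y => Phi (u, y)) (Ropp th) th)%C)) h2.
  have -> : (RtoC (-1) * l1 = - l1)%C by rewrite (RtoC_opp 1); ring.
  apply: (tends_to_ext (a := 0)) => b _.
  by rewrite /strip_integral (RtoC_opp 1); ring.
have t1 := strip_lim _ _ _ tb tt; have t2 := strip_lim _ _ _ tb' tt'.
rewrite -(ml_integral_right hth al0 hza (cPhi _ aa') t2).
apply: tends_to_unique t1 _; apply: (tends_to_ext (a := a')) t2 => b ab.
apply/esym/strip_integral_shift => //.
- by apply: holomorphic_sub hPhi => w [h1 h2]; lra.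
- move=> x hx; split; apply: (cPhi a (Rle_refl a)); [apply: on_strip_top|apply: on_strip_bot]; lra.
Qed.

(** * Return to polar coordinates *)

Lemma is_RInt_gen_tends_to (f I : R -> C) (a : R) (l : C) :
  (forall t, a <= t -> is_CInt f a t (I t)) -> tends_to I l ->
  @is_RInt_gen C_R_NormedModule f (at_point a) (Rbar_locally p_infty) l.
Proof.
move=> hI hl; apply/(@filterlimi_locally _ C_R_NormedModule) => e.
have [B hB] := hl _ (cond_pos e).
apply: (Filter_prod _ _ _ (fun s => s = a) (fun t => Rmax a B < t)) => //.
  by exists (Rmax a B).
move=> s t -> ht; exists (I t); split.
- by apply: hI => /=; have := Rmax_l a B; lra.
- apply: (@norm_compat1 R_AbsRing C_R_NormedModule); rewrite -Cmod_norm.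
  by apply: hB; have := Rmax_r a B; lra.
Qed.

Lemma tends_to_ln (f : R -> C) (p : R) (l : C) : 0 < p ->
  tends_to f l -> tends_to (fun t => f (ln t / p)) l.
Proof.
move=> p0 h e /h[B hB]; exists (exp (B * p)) => t ht; apply: hB.
apply/Rle_div_r => //; rewrite -[X in X <= _]ln_exp.
by apply: ln_le => //; exact: exp_pos.
Qed.

Lemma Cexp_ln (r th : R) : 0 < r -> Cexp (ln r, th) = polar r th.
Proof. by move=> r0; rewrite /Cexp /polar /Re /Im /= exp_ln. Qed.

Lemma prod_alpha_gt_0 (n : nat) (alpha : 'I_n -> R) :
  (forall j, 0 < alpha j) -> 0 < prod_alpha alpha.
Proof.
move=> h; rewrite /prod_alpha; apply: (big_ind (fun x => 0 < x)) => //; first lra.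
exact: Rmult_lt_0_compat.
Qed.

(** In the exponent of [ml_integrand] the summand [- 1] cancels against the
    factor [s] of [ds = s (dr / r + i dth)]. *)
Lemma ml_integrand_polar (n : nat) (alpha : 'I_n -> R) (mu : C) (z : 'I_n -> C) (r th : R) :
  (forall j, 0 < alpha j) -> 0 < r ->
  (ml_integrand alpha mu z r th * polar r th)%C =
  ml_log_integrand alpha mu z (ln r / prod_alpha alpha, th / prod_alpha alpha).
Proof.
move=> al0 r0; have := prod_alpha_gt_0 al0.
rewrite /ml_integrand /ml_log_integrand; set P := prod_alpha alpha => P0.
have e : ((ln r / P, th / P) : C) = (/ RtoC P * (ln r, th))%C.
  by apply: injective_projections => /=; field; lra.
have nP : RtoC P <> 0 by move=> h; have := f_equal fst h => /=; lra.
rewrite e -(Cexp_ln th r0) /polar_pow.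
have -> : Cexp (RtoC 1 / RtoC P * (ln r, th)) = Cexp (/ RtoC P * (ln r, th)).
  by congr Cexp; field.
have -> : \big[Cmult/RtoC 1]_(j < n) (Cexp (RtoC 1 / beta alpha j * (ln r, th)) - z j)%C =
   \big[Cmult/RtoC 1]_(j < n) (Cexp (alpha j * (/ RtoC P * (ln r, th))) - z j)%C.
  apply: eq_bigr => j _; congr (Cexp _ - _)%C.
  have aj := al0 j; rewrite /beta -/P RtoC_mult RtoC_inv; last lra.
  by field; split => //; move=> h; have := f_equal fst h => /=; lra.
have -> : Cexp ((RtoC (sum_alpha alpha) + 1 - mu) * (/ RtoC P * (ln r, th))) =
  (Cexp (((RtoC (sum_alpha alpha) + 1 - mu) / RtoC P - 1) * (ln r, th)) * Cexp (ln r, th))%C.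
  by rewrite -Cexp_plus; congr Cexp; field.
by rewrite /Cdiv; ring.
Qed.

Unset Implicit Arguments.

Theorem lemma5p1 (n : nat) (alpha : 'I_n -> R) (mu : C) (z : 'I_n -> C)
    (eps eta : R)
    (hn : (0 < n)%N)
    (halpha : forall j : 'I_n, 0 < alpha j < 2)
    (hprod : prod_alpha alpha < 2)
    (heps : 0 < eps)
    (heta : PI / 2 * prod_alpha alpha < eta
            <= Rmin PI (PI * prod_alpha alpha))
    (hz : forall j : 'I_n,
        Omega_minus (Rpower eps (1 / beta alpha j)) (eta / beta alpha j) (z j)) :
  ex_hankel_integral eps eta (ml_integrand alpha mu z) /\
  mittag_leffler alpha z mu =
    (1 / (2 * PI * Ci) * (1 / prod_alpha alpha)
     * hankel_integral eps eta (ml_integrand alpha mu z))%C.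
Proof.
have al0 j : 0 < alpha j by case: (halpha j).
have P0 := prod_alpha_gt_0 al0.
set P := prod_alpha alpha in P0 heta *.
pose a := ln eps / P; pose th := eta / P.
have hth : PI / 2 < th <= PI.
  case: heta => h1 h2; split; first by apply/(Rlt_div_r _ _ _ P0).
  apply/(Rle_div_l _ _ _ P0); apply: Rle_trans h2 (Rmin_r _ _).
have th0 : 0 < th by have := PI_RGT_0; lra.
have eta_th : eta = P * th by rewrite /th; field; lra.
have avoid j : avoids_strip a th (alpha j) (z j).
  have aj := al0 j; have e1 : 1 / beta alpha j = alpha j / P by rewrite /beta -/P; field; lra.
  have e2 : eta / beta alpha j = alpha j * th by rewrite /beta -/P /th; field; lra.
  have := hz j; rewrite /Omega_minus /avoids_strip e1 e2 /Rpower.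
  by have -> : alpha j / P * ln eps = alpha j * a by rewrite /a; field; lra.
have [lb [lt [tb tt sum]]] := ml_integral mu hth al0 avoid.
set Phi := ml_log_integrand alpha mu z in tb tt sum.
set f := ml_integrand alpha mu z.
have fPhi r t : 0 < r -> (f r t * polar r t)%C = Phi (ln r / P, t / P).
  by move=> r0; exact: ml_integrand_polar.
have holo : holomorphic (fun v => a <= v.1 /\ - th <= v.2 <= th) Phi.
  exact: holomorphic_ml_log_integrand al0 avoid _.
have polar1 r t : polar r t = (RtoC r * polar 1 t)%C.
  by apply: injective_projections => /=; ring.
have ray t l : - th <= t / P <= th ->
    tends_to (fun b => CInt (fun x => Phi (x, t / P)) a b) l ->
    @is_RInt_gen C_R_NormedModule (ray_integrand f t) (at_point eps) (Rbar_locally p_infty) (P * l)%C.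
  move=> ht hl.
  refine (@is_RInt_gen_tends_to _ (fun r => Cmult P (CInt (fun x => Phi (x, t / P)) a (ln r / P)))
    eps (P * l)%C _ _); last exact: (tends_to_scal P (tends_to_ln P0 hl)).
  move=> r hr; have := is_CInt_comp_ln (f := fun x => Phi (x, t / P)) P0 heps hr.
    move=> h; apply: (is_CInt_ext hr _ (h _)) => x hx.
    - have x0 : 0 < x by lra.
      rewrite -fPhi // /ray_integrand polar1.
      have nx : RtoC x <> 0 by move=> e; have := f_equal fst e => /=; lra.
      by field.
    - apply: continuous_horizontal; apply: (holomorphic_continuous holo); split => //=.
      rewrite /a; apply: Rmult_le_compat_r; first exact/Rlt_le/Rinv_0_lt_compat.
      by apply: ln_le; lra.
have e1 : - eta / P = - th by rewrite /th; field; lra.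
have ray_bot : @is_RInt_gen C_R_NormedModule (ray_integrand f (- eta)) (at_point eps)
    (Rbar_locally p_infty) (P * lb)%C by apply: ray; rewrite e1 //; lra.
have ray_top : @is_RInt_gen C_R_NormedModule (ray_integrand f eta) (at_point eps)
    (Rbar_locally p_infty) (P * lt)%C by apply: ray; rewrite -/th //; lra.
have arc : is_CInt (arc_integrand f eps) (- eta) eta
    (P * (Ci * CInt (fun y => Phi (a, y)) (Ropp th) th))%C.
  have tt2 : - th <= th by lra.
  have ex : ex_CInt (fun y => Phi (a, y)) (- th) th.
    apply: ex_CInt_vertical => // y hy; apply: (holomorphic_continuous holo).
    by split => //=; lra.
  have h := @is_RInt_comp_lin C_R_NormedModule (fun y => Phi (a, y)) (/ P) 0 (- eta) eta
    (CInt (fun y => Phi (a, y)) (Ropp th) th).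
  have ee1 : / P * - eta + 0 = - th by rewrite /th; field; lra.
  have ee2 : / P * eta + 0 = th by rewrite /th; field; lra.
  rewrite ee1 ee2 in h; have {}h := h (CInt_correct ex).
  have {}h := @is_CInt_scal P _ _ _ _ (@is_CInt_scal Ci _ _ _ _ h).
  have ne : - eta <= eta by rewrite eta_th; nra.
  apply: (is_CInt_ext ne _ h) => y hy.
  have -> : (arc_integrand f eps y = Ci * (f eps y * polar eps y))%C.
    by rewrite /arc_integrand; ring.
  rewrite fPhi // -/a.
  have -> : / P * y + 0 = y / P by rewrite /Rdiv; ring.
  move: (Phi _) => u.
  by apply: injective_projections; rewrite /scal /= /prod_scal /scal /= /mult /=; field; lra.
split.
  by split; [exists (P * lb)%C|exists (P * (Ci * CInt (fun y => Phi (a, y)) (Ropp th) th))%C|exists (P * lt)%C].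
have pf1 : ProperFilter' (at_point eps) by apply: Proper_StrongProper; exact: at_point_filter.
have pf2 : ProperFilter' (Rbar_locally p_infty) by apply: Proper_StrongProper; exact: Rbar_locally_filter.
have u1 := @is_RInt_gen_unique C_R_CompleteNormedModule _ _ pf1 pf2 _ _ ray_bot.
have u2 := @is_RInt_gen_unique C_R_CompleteNormedModule _ _ pf1 pf2 _ _ ray_top.
have eH : hankel_integral eps eta f = (RtoC P * (2 * PI * Ci * mittag_leffler alpha z mu))%C.
  by rewrite -sum /hankel_integral u1 u2 (CInt_unique arc); ring.
rewrite eH.
have pi0 := PI_RGT_0.
have nzpi : (2 * PI * Ci)%C <> 0 by move=> e; have := f_equal snd e => /=; lra.
have nP : RtoC P <> 0 by move=> h; have := f_equal fst h => /=; lra.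
have cancel (X Y W : C) : X <> 0 -> Y <> 0 -> W = (1 / X * (1 / Y) * (Y * (X * W)))%C.
  by move=> ? ?; field.
exact: cancel.
Qed.
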